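(* Let $\mathbb K$ be an algebraically closed field of characteristic $3$, let $$A=\begin{pmatrix}2&-1&-1\\-1&2&-1\\-1&-1&0\end{pmatrix},$$ with $x_3,y_3$ odd and $x_1,x_2,y_1,y_2$ even, and let $\mathfrak g(2,3)=\mathfrak g(A)$ with positive basis elements $x_1,x_2,x_3$, $x_4=[x_1,x_2]$, $x_5=[x_1,x_3]$, $x_6=[x_2,x_3]$, $x_7=[x_3,[x_1,x_2]]$, $x_8=[[x_1,x_2],[x_1,x_3]]$, $x_9=[[x_1,x_2],[x_2,x_3]]$, $x_{10}=[[x_1,x_2],[x_3,[x_1,x_2]]]$, $x_{11}=[[x_3,[x_1,x_2]],[x_3,[x_1,x_2]]]$, the $y_i$ being given by the same expressions in $y_1,y_2,y_3$, and $h_i=[x_i,y_i]$ for $i=1,2,3$. (a1) For $\mathfrak g=\mathfrak g(2,3)$, for a basis of $H^1(\mathfrak g;\mathfrak g)$ one can take the class of the derivation that sends $D_4$ to $-h_1+h_2$ and vanishes on $\mathfrak g^{(1)}$. (a2) $H^2(\mathfrak g(2,3))=0$. (b1) Let $\mathfrak g=\mathfrak{bj}:=\mathfrak g(2,3)^{(1)}/\mathfrak c$, where $\mathfrak c$ is the center. For a basis of $H^1(\mathfrak g;\mathfrak g)$ one can take the classes of the seven derivations $D_{-3}^1$, $D_{-3}^2$, $\theta D_{-3}^1\theta^{-1}$, $\theta D_{-3}^2\theta^{-1}$, $D_0^1$, $D_0^2$, $D_0^3$, where (elements not mentioned are sent to $0$) $D_{-3}^1$: $x_1\mapsto y_4$,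 $x_4\mapsto y_1$, $x_8\mapsto x_3$, $x_{10}\mapsto -x_6$, $y_3\mapsto y_8$, $y_6\mapsto -y_{10}$; $D_{-3}^2$: $x_2\mapsto -y_4$, $x_4\mapsto -y_2$, $x_9\mapsto -x_3$, $x_{10}\mapsto -x_5$, $y_3\mapsto -y_9$, $y_5\mapsto -y_{10}$; $D_0^1$: $x_1\mapsto x_2$, $x_5\mapsto x_6$, $x_8\mapsto x_9$, $y_2\mapsto -y_1$, $y_6\mapsto -y_5$, $y_9\mapsto -y_8$; $D_0^2$: $x_1\mapsto x_1$, $x_2\mapsto -x_2$, $x_5\mapsto x_5$, $x_6\mapsto -x_6$, $x_8\mapsto x_8$, $x_9\mapsto -x_9$, $y_1\mapsto -y_1$, $y_2\mapsto y_2$, $y_5\mapsto -y_5$, $y_6\mapsto y_6$, $y_8\mapsto -y_8$, $y_9\mapsto y_9$; $D_0^3$: $x_2\mapsto x_1$, $x_6\mapsto x_5$, $x_9\mapsto x_8$, $y_1\mapsto -y_2$, $y_5\mapsto -y_6$, $y_8\mapsto -y_9$; and $\theta$ is the automorphism with $x_i\mapsto y_i$, $y_i\mapsto(-1)^{p(x_i)}x_i$, $i=1,2,3$. (b2) For $\mathfrak g=\mathfrak{bj}$ we have $\dim H^2(\mathfrak g)=7$; for a basis one can take the classes of $$c_{-3}^1=2\widehat x_1\wedge\widehat x_4+\widehat x_8\wedge\widehat y_3+\widehat x_{10}\wedge\widehat y_6,\qquad c_{-3}^2=\widehat x_2\wedge\widehat x_4+2\widehat x_9\wedge\widehat y_3+\widehat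 x_{10}\wedge\widehat y_5,$$ their pullbacks $c_{-3}^i\circ(\theta\times\theta)$, $i=1,2$, and $$c_0^1=2\widehat x_1\wedge\widehat y_2+\widehat x_5\wedge\widehat y_6+\widehat x_8\wedge\widehat y_9,$$ $$c_0^2=2\widehat x_1\wedge\widehat y_1+\widehat x_2\wedge\widehat y_2+\widehat x_5\wedge\widehat y_5+2\widehat x_6\wedge\widehat y_6+\widehat x_8\wedge\widehat y_8+2\widehat x_9\wedge\widehat y_9,$$ $$c_0^3=\widehat x_2\wedge\widehat y_1+2\widehat x_6\wedge\widehat y_5+2\widehat x_9\wedge\widehat y_8 .$$
   Context: $\mathfrak g(A)$ for an $n\times n$ matrix $A$ and parities $p_1,\dots,p_n$: let $\mathfrak h$ be an even space of dimension $2n-\operatorname{rk}A$ with linearly independent $h_1,\dots,h_n\in\mathfrak h$ and linearly independent $\alpha_1,\dots,\alpha_n\in\mathfrak h^*$, $\alpha_j(h_i)=A_{ij}$; take the Lie superalgebra generated by $\mathfrak h$ and $x_i,y_i$ of parity $p_i$ with relations $[\mathfrak h,\mathfrak h]=0$, $[h,x_j]=\alpha_j(h)x_j$, $[h,y_j]=-\alpha_j(h)y_j$, $[x_i,y_j]=\delta_{ij}h_i$, and factor out the largest ideal graded with respect to $\deg x_i=e_i=-\deg y_i$ that intersects $\mathfrak h$ trivially. Here $\operatorname{rk}A=2$, and $D_4\in\mathfrak h$ is a grading element with $\mathfrak h=\operatorname{Span}(h_1,h_2,h_3,D_4)$, $\mathfrak g(A)=\mathfrak g(A)^{(1)}\oplus\mathbb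 K D_4$; $\mathfrak g^{(1)}$ is the derived algebra. For $p=3$, Lie superalgebras satisfy also $[x,[x,x]]=0$ for odd $x$. $H^1(\mathfrak g;\mathfrak g)$ is the superspace of all (even and odd) derivations modulo inner ones. $H^2(\mathfrak g)$ (trivial coefficients, both parities): bilinear forms $\omega$ with $\omega(x,y)=-(-1)^{p(x)p(y)}\omega(y,x)$, $\omega([x,y],z)=\omega(x,[y,z])-(-1)^{p(x)p(y)}\omega(y,[x,z])$, $\omega(x,[x,x])=0$ for odd $x$, modulo the forms $f([x,y])$. For distinct root vectors $u,v$ of the basis, $\widehat u\wedge\widehat v$ is the super-antisymmetric form with value $1$ on $(u,v)$ and zero on all pairs of basis elements other than $(u,v)$, $(v,u)$. *)

(* Defs.v *)
From HB Require Import structures.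
From mathcomp Require Import all_boot all_algebra.
From mathcomp Require Import boolp functions.

Set Implicit Arguments.
Unset Strict Implicit.
Unset Printing Implicit Defensive.

Import GRing.Theory.
Local Open Scope ring_scope.

Reserved Notation "⁅ u , v ⁆" (at level 0, u, v at level 99,
  format "⁅ u ,  v ⁆").

(* Parities are booleans, [true] being odd.  The superspace structure is given
   by the two projections [part false] and [part true] onto the even and the
   odd part, so that [part b u = u] says that [u] is homogeneous of parity [b].
   The axioms are the right ones in characteristic different from 2;
   [brk_cube] follows from [brk_jacobi] unless the characteristic is 3. *)
HB.mixin Record Lmodule_isLieSuper (K : fieldType) L of GRing.Lmodule K L := {
  part : bool -> L -> L;
  brk : L -> L -> L;
  part_linear : forall b, linear (part b);
  part_add : forall u, part false u + part true u = u;
  part_part : forall b c u, part b (part c u) = if b == c then part c u else 0;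
  brk_linearl : forall v, linear (brk^~ v);
  brk_linearr : forall u, linear (brk u);
  brk_part : forall b c u v, part b u = u -> part c v = v ->
    part (b (+) c) (brk u v) = brk u v;
  brk_skew : forall b c u v, part b u = u -> part c v = v ->
    brk u v = - (-1) ^+ (b && c) *: brk v u;
  brk_jacobi : forall b c u v w, part b u = u -> part c v = v ->
    brk u (brk v w) = brk (brk u v) w + (-1) ^+ (b && c) *: brk v (brk u w);
  brk_cube : forall u, part true u = u -> brk u (brk u u) = 0
}.

#[short(type="lieSuperType")]
HB.structure Definition LieSuper (K : fieldType) :=
  {L of Lmodule_isLieSuper K L & GRing.Lmodule K L}.

Notation "⁅ u , v ⁆" := (brk u v) : ring_scope.

Arguments part_part {K L} b c u : rename.
Arguments brk_part {K L b c u v} : rename.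
Arguments brk_skew {K L b c u v} : rename.
Arguments brk_jacobi {K L b c u v} w : rename.
Arguments brk_cube {K L u} : rename.

Definition homog (K : fieldType) (L : lieSuperType K) (b : bool) (u : L) :=
  part b u = u.

Section LieSuperTheory.
Variables (K : fieldType) (L : lieSuperType K).
Implicit Types (u v w : L) (a : K) (b c : bool).

Lemma partD b u v : part b (u + v) = part b u + part b v.
Proof. by have := part_linear b 1 u v; rewrite !scale1r. Qed.
Lemma part0 b : part b (0 : L) = 0.
Proof. by apply: (addrI (part b 0)); rewrite -partD !addr0. Qed.
Lemma partZ b a u : part b (a *: u) = a *: part b u.
Proof. by have := part_linear b a u 0; rewrite part0 !addr0. Qed.
Lemma partB b u v : part b (u - v) = part b u - part b v.
Proof. by rewrite partD -scaleN1r partZ scaleN1r. Qed.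
Lemma homog_part b u : homog b (part b u).
Proof. by rewrite /homog part_part eqxx. Qed.

Lemma brkDl u v w : ⁅u + v, w⁆ = ⁅u, w⁆ + ⁅v, w⁆.
Proof. by have := brk_linearl w 1 u v; rewrite !scale1r. Qed.
Lemma brkDr u v w : ⁅u, v + w⁆ = ⁅u, v⁆ + ⁅u, w⁆.
Proof. by have := brk_linearr u 1 v w; rewrite !scale1r. Qed.
Lemma brk0r u : ⁅u, 0⁆ = 0.
Proof. by apply: (addrI ⁅u, 0⁆); rewrite -brkDr !addr0. Qed.
Lemma brk0l u : ⁅0, u⁆ = 0.
Proof. by apply: (addrI ⁅0, u⁆); rewrite -brkDl !addr0. Qed.
Lemma brkZl a u v : ⁅a *: u, v⁆ = a *: ⁅u, v⁆.
Proof. by have := brk_linearl v a u 0; rewrite brk0l !addr0. Qed.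
Lemma brkZr a u v : ⁅u, a *: v⁆ = a *: ⁅u, v⁆.
Proof. by have := brk_linearr u a v 0; rewrite brk0r !addr0. Qed.
Lemma brkBl u v w : ⁅u - v, w⁆ = ⁅u, w⁆ - ⁅v, w⁆.
Proof. by rewrite brkDl -scaleN1r brkZl scaleN1r. Qed.
Lemma brkBr u v w : ⁅u, v - w⁆ = ⁅u, v⁆ - ⁅u, w⁆.
Proof. by rewrite brkDr -scaleN1r brkZr scaleN1r. Qed.

Lemma part_brkl b c u v : homog b u ->
  part c ⁅u, v⁆ = ⁅u, part (b (+) c) v⁆.
Proof.
move=> hu; have hd d : part (b (+) d) ⁅u, part d v⁆ = ⁅u, part d v⁆.
  exact: brk_part hu (homog_part _ _).
rewrite -{1}(part_add v) brkDr partD.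
have E d : part c ⁅u, part d v⁆ = if c == b (+) d then ⁅u, part d v⁆ else 0.
  by rewrite -hd part_part.
by rewrite !E; case: (b); case: (c); rewrite /= ?addr0 ?add0r.
Qed.

End LieSuperTheory.

Record ideal (K : fieldType) (L : lieSuperType K) := Ideal {
  ideal_mem :> L -> Prop;
  ideal0 : ideal_mem 0;
  idealP : forall a u v, ideal_mem u -> ideal_mem v -> ideal_mem (a *: u + v);
  ideal_part : forall b u, ideal_mem u -> ideal_mem (part b u);
  ideal_brk : forall u v, ideal_mem v -> ideal_mem ⁅u, v⁆
}.

Section Quotient.
Variables (K : fieldType) (L : lieSuperType K) (I : ideal L).
Implicit Types (u v w : L) (a : K) (b c : bool).

Lemma idealD u v : I u -> I v -> I (u + v).
Proof. by move=> hu hv; rewrite -[u]scale1r; exact: idealP. Qed.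
Lemma idealZ a u : I u -> I (a *: u).
Proof. by move=> hu; rewrite -[_ *: _]addr0; apply: idealP => //; exact: ideal0. Qed.
Lemma idealB u v : I u -> I v -> I (u - v).
Proof. by move=> hu hv; rewrite -scaleN1r; apply: idealD => //; exact: idealZ. Qed.
Lemma ideal_brkl u v : I u -> I ⁅u, v⁆.
Proof.
move=> hu; rewrite -(part_add u) -(part_add v).
have H b c : I ⁅part b u, part c v⁆.
  rewrite (brk_skew (homog_part b u) (homog_part c v)).
  by apply/idealZ/ideal_brk/ideal_part.
by rewrite !(brkDl, brkDr); do !apply: idealD.
Qed.

Definition qrel u v : bool := `[< I (u - v) >].

Fact qrel_equiv : equiv_class_of qrel.
Proof.
split=> [u|u v|v u w].
- by apply/asboolP; rewrite subrr; exact: ideal0.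
- apply/asboolP/asboolP => h; rewrite -opprB -scaleN1r; exact: idealZ.
- move=> /asboolP h1 /asboolP h2; apply/asboolP.
  by rewrite -(subrKA v); exact: idealD.
Qed.
Canonical qrel_canonical := EquivRelPack qrel_equiv.

Definition quot := {eq_quot qrel}%qT.
HB.instance Definition _ := Choice.on quot.

Definition qpi (u : L) : quot := (\pi_({eq_quot qrel}) u)%qT.
Definition qrepr (x : quot) : L := repr (x : {eq_quot qrel}%qT).

Lemma qpiP u v : qpi u = qpi v <-> I (u - v).
Proof.
split=> [/eqmodP /asboolP //|h]; by apply/eqmodP/asboolP.
Qed.
Lemma qreprK x : qpi (qrepr x) = x.
Proof. exact: reprK. Qed.
Lemma qW (P : quot -> Prop) : (forall u, P (qpi u)) -> forall x, P x.
Proof. by move=> h x; rewrite -(qreprK x). Qed.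
Lemma qrepr_pi u : I (qrepr (qpi u) - u).
Proof. by apply/qpiP; rewrite qreprK. Qed.

Definition qadd (x y : quot) : quot := qpi (qrepr x + qrepr y).
Definition qopp (x : quot) : quot := qpi (- qrepr x).
Definition qscale a (x : quot) : quot := qpi (a *: qrepr x).
Definition qpart b (x : quot) : quot := qpi (part b (qrepr x)).
Definition qbrk (x y : quot) : quot := qpi ⁅qrepr x, qrepr y⁆.

Fact qaddE u v : qadd (qpi u) (qpi v) = qpi (u + v).
Proof. by apply/qpiP; rewrite opprD addrACA; apply: idealD; exact: qrepr_pi. Qed.
Fact qoppE u : qopp (qpi u) = qpi (- u).
Proof.
apply/qpiP; rewrite -opprD -scaleN1r; exact: (idealZ _ (qrepr_pi u)).
Qed.
Fact qscaleE a u : qscale a (qpi u) = qpi (a *: u).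
Proof. by apply/qpiP; rewrite -scalerBr; apply/idealZ/qrepr_pi. Qed.
Fact qpartE b u : qpart b (qpi u) = qpi (part b u).
Proof. by apply/qpiP; rewrite -partB; apply/ideal_part/qrepr_pi. Qed.
Fact qbrkE u v : qbrk (qpi u) (qpi v) = qpi ⁅u, v⁆.
Proof.
apply/qpiP; rewrite -(subrKA ⁅u, qrepr (qpi v)⁆) -brkBl -brkBr.
by apply: idealD; [apply: ideal_brkl | apply: ideal_brk]; exact: qrepr_pi.
Qed.

Fact qaddA : associative qadd.
Proof. by do 3!elim/qW => ?; rewrite !qaddE addrA. Qed.
Fact qaddC : commutative qadd.
Proof. by do 2!elim/qW => ?; rewrite !qaddE addrC. Qed.
Fact qadd0 : left_id (qpi 0) qadd.
Proof. by elim/qW => ?; rewrite !qaddE add0r. Qed.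
Fact qaddN : left_inverse (qpi 0) qopp qadd.
Proof. by elim/qW => ?; rewrite qoppE qaddE addNr. Qed.
HB.instance Definition _ := GRing.isZmodule.Build quot qaddA qaddC qadd0 qaddN.

Lemma qpiD u v : qpi (u + v) = qpi u + qpi v.
Proof. by rewrite [RHS]qaddE. Qed.

Fact qscaleA a a' (x : quot) : qscale a (qscale a' x) = qscale (a * a') x.
Proof. by elim/qW: x => u; rewrite !qscaleE scalerA. Qed.
Fact qscale1 : left_id 1 qscale.
Proof. by elim/qW => u; rewrite !qscaleE scale1r. Qed.
Fact qscaleDr : right_distributive qscale +%R.
Proof.
by move=> a; do 2!elim/qW => ?; rewrite -qpiD !qscaleE scalerDr qpiD.
Qed.
Fact qscaleDl (x : quot) : {morph qscale^~ x : a a' / a + a'}.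
Proof. by elim/qW: x => u a a'; rewrite !qscaleE scalerDl qpiD. Qed.
HB.instance Definition _ :=
  GRing.Zmodule_isLmodule.Build K quot qscaleA qscale1 qscaleDr qscaleDl.

Lemma qpiZ a u : qpi (a *: u) = a *: qpi u.
Proof. by rewrite [RHS]qscaleE. Qed.

Fact qpart_linear b : linear (qpart b).
Proof.
move=> a; do 2!elim/qW => ?.
by rewrite -qpiZ -qpiD !qpartE partD partZ qpiD qpiZ.
Qed.
Fact qpart_add (x : quot) : qpart false x + qpart true x = x.
Proof. by elim/qW: x => u; rewrite !qpartE -qpiD part_add. Qed.
Fact qpart_part b c (x : quot) :
  qpart b (qpart c x) = if b == c then qpart c x else 0.
Proof. by elim/qW: x => u; rewrite !qpartE part_part; case: eqP. Qed.
Fact qbrk_linearl (y : quot) : linear (qbrk^~ y).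
Proof.
elim/qW: y => w a; do 2!elim/qW => ?.
by rewrite -qpiZ -qpiD !qbrkE brkDl brkZl qpiD qpiZ.
Qed.
Fact qbrk_linearr (x : quot) : linear (qbrk x).
Proof.
elim/qW: x => w a; do 2!elim/qW => ?.
by rewrite -qpiZ -qpiD !qbrkE brkDr brkZr qpiD qpiZ.
Qed.
Fact qhomog b (x : quot) : qpart b x = x -> exists2 u, homog b u & x = qpi u.
Proof.
elim/qW: x => u; rewrite qpartE => hu.
by exists (part b u) => //; exact: homog_part.
Qed.
Fact qbrk_part b c (x y : quot) : qpart b x = x -> qpart c y = y ->
  qpart (b (+) c) (qbrk x y) = qbrk x y.
Proof.
move=> /qhomog[u hu ->] /qhomog[v hv ->].
by rewrite !qbrkE qpartE (brk_part hu hv).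
Qed.
Fact qbrk_skew b c (x y : quot) : qpart b x = x -> qpart c y = y ->
  qbrk x y = - (-1) ^+ (b && c) *: qbrk y x.
Proof.
move=> /qhomog[u hu ->] /qhomog[v hv ->].
by rewrite !qbrkE (brk_skew hu hv) qpiZ.
Qed.
Fact qbrk_jacobi b c (x y z : quot) : qpart b x = x -> qpart c y = y ->
  qbrk x (qbrk y z) =
    qbrk (qbrk x y) z + (-1) ^+ (b && c) *: qbrk y (qbrk x z).
Proof.
move=> /qhomog[u hu ->] /qhomog[v hv ->]; elim/qW: z => w.
by rewrite !qbrkE (brk_jacobi w hu hv) qpiD qpiZ.
Qed.
Fact qbrk_cube (x : quot) : qpart true x = x -> qbrk x (qbrk x x) = 0.
Proof. by move=> /qhomog[u hu ->]; rewrite !qbrkE brk_cube. Qed.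
HB.instance Definition _ := Lmodule_isLieSuper.Build K quot
  qpart_linear qpart_add qpart_part qbrk_linearl qbrk_linearr
  qbrk_part qbrk_skew qbrk_jacobi qbrk_cube.

End Quotient.

Section Derived.
Variables (K : fieldType) (L : lieSuperType K).
Implicit Types (u v : L).

Definition derived_mem u :=
  exists s : seq (L * L), u = \sum_(t <- s) ⁅t.1, t.2⁆.

Definition derived_pred : pred L := fun u => `[< derived_mem u >].

Fact derived_submod : submod_closed derived_pred.
Proof.
split=> [|a u v /asboolP[s ->] /asboolP[t ->]]; apply/asboolP.
  by exists [::]; rewrite big_nil.
exists ([seq (a *: x.1, x.2) | x <- s] ++ t).
rewrite big_cat big_map scaler_sumr; congr (_ + _).
by apply: eq_bigr => x _; rewrite brkZl.
Qed.
HB.instance Definition _ :=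
  GRing.isSubmodClosed.Build K L derived_pred derived_submod.

Lemma derived_brk u v : derived_mem ⁅u, v⁆.
Proof. by exists [:: (u, v)]; rewrite big_seq1. Qed.

Lemma derivedD u v : derived_mem u -> derived_mem v -> derived_mem (u + v).
Proof. by case=> s -> [t ->]; exists (s ++ t); rewrite big_cat. Qed.

Lemma derived_part b u : derived_mem u -> derived_mem (part b u).
Proof.
case=> s ->; elim: s => [|[u1 u2] s IHs].
  by rewrite big_nil part0; exists [::]; rewrite big_nil.
rewrite big_cons partD -[u1]part_add /= brkDl partD.
rewrite !(part_brkl _ _ (homog_part _ _)).
by do 2?apply: derivedD => //; exact: derived_brk.
Qed.

Record derived := Derived { dval : L; dvalP : derived_pred dval }.
HB.instance Definition _ := [isSub for dval].
HB.instance Definition _ := [Choice of derived by <:].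
HB.instance Definition _ := [SubChoice_isSubLmodule of derived by <:].

Definition dmk u (h : derived_mem u) : derived := Derived (asboolT h).

Definition dpart b (x : derived) : derived :=
  dmk (derived_part b (asboolW (dvalP x))).
Definition dbrk (x y : derived) : derived := dmk (derived_brk (dval x) (dval y)).

Fact dpart_linear b : linear (dpart b).
Proof. by move=> a x y; apply: val_inj; rewrite /= partD partZ. Qed.
Fact dpart_add (x : derived) : dpart false x + dpart true x = x.
Proof. by apply: val_inj; rewrite /= part_add. Qed.
Fact dpart_part b c (x : derived) :
  dpart b (dpart c x) = if b == c then dpart c x else 0.
Proof. by apply: val_inj; rewrite /= part_part; case: eqP. Qed.
Fact dbrk_linearl (y : derived) : linear (dbrk^~ y).
Proof. by move=> a x z; apply: val_inj; rewrite /= brkDl brkZl. Qed.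
Fact dbrk_linearr (x : derived) : linear (dbrk x).
Proof. by move=> a y z; apply: val_inj; rewrite /= brkDr brkZr. Qed.
Fact dbrk_part b c (x y : derived) : dpart b x = x -> dpart c y = y ->
  dpart (b (+) c) (dbrk x y) = dbrk x y.
Proof.
move=> /(congr1 val) hx /(congr1 val) hy; apply: val_inj.
exact: (brk_part hx hy).
Qed.
Fact dbrk_skew b c (x y : derived) : dpart b x = x -> dpart c y = y ->
  dbrk x y = - (-1) ^+ (b && c) *: dbrk y x.
Proof.
move=> /(congr1 val) hx /(congr1 val) hy; apply: val_inj.
by rewrite /= (brk_skew hx hy).
Qed.
Fact dbrk_jacobi b c (x y z : derived) : dpart b x = x -> dpart c y = y ->
  dbrk x (dbrk y z) =
    dbrk (dbrk x y) z + (-1) ^+ (b && c) *: dbrk y (dbrk x z).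
Proof.
move=> /(congr1 val) hx /(congr1 val) hy; apply: val_inj.
by rewrite /= (brk_jacobi _ hx hy).
Qed.
Fact dbrk_cube (x : derived) : dpart true x = x -> dbrk x (dbrk x x) = 0.
Proof.
by move=> /(congr1 val) hx; apply: val_inj; rewrite /= brk_cube.
Qed.
HB.instance Definition _ := Lmodule_isLieSuper.Build K derived
  dpart_linear dpart_add dpart_part dbrk_linearl dbrk_linearr
  dbrk_part dbrk_skew dbrk_jacobi dbrk_cube.

End Derived.

Section Center.
Variables (K : fieldType) (L : lieSuperType K).

Definition center_mem (z : L) := forall v, ⁅z, v⁆ = 0.

Fact center0 : center_mem 0.
Proof. by move=> v; rewrite brk0l. Qed.
Fact centerP a u v : center_mem u -> center_mem v -> center_mem (a *: u + v).
Proof. by move=> hu hv w; rewrite brkDl brkZl hu hv scaler0 addr0. Qed.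
Fact center_part b u : center_mem u -> center_mem (part b u).
Proof.
move=> hu v; rewrite -(part_add v) brkDr.
have H c : ⁅part b u, part c v⁆ = 0.
  have: part (b (+) c) ⁅part b u + part (~~ b) u, part c v⁆ = 0.
    have -> : part b u + part (~~ b) u = u.
      by rewrite -[RHS]part_add; case: (b) => //=; rewrite addrC.
    by rewrite hu part0.
  rewrite brkDl partD (brk_part (homog_part b u) (homog_part c v)).
  rewrite -(brk_part (homog_part (~~ b) u) (homog_part c v)) part_part.
  by case: (b) (c) => -[] /=; rewrite addr0.
by rewrite !H addr0.
Qed.
Fact center_brk u v : center_mem v -> center_mem ⁅u, v⁆.
Proof.
move=> hv; suff -> : ⁅u, v⁆ = 0 by exact: center0.
rewrite -(part_add u) -(part_add v).
have H b c : ⁅part b u, part c v⁆ = 0.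
  rewrite (brk_skew (homog_part b u) (homog_part c v)).
  by rewrite (center_part c hv) scaler0.
by rewrite !(brkDl, brkDr) !H !addr0.
Qed.
Definition center : ideal L := Ideal center0 centerP center_part center_brk.

End Center.
Arguments center {K} L.

(* the even space h with the h_i ([coroot i]) and the alpha_j ([sroot j]) *)
Record realization (K : fieldType) (n : nat) (A : 'M[K]_n) := Realization {
  rspace :> vectType K;
  coroot : 'I_n -> rspace;
  sroot : 'I_n -> 'Hom(rspace, K^o);
  realization_dim : \dim {:rspace} = (2 * n - \rank A)%N;
  coroot_free : free [seq coroot i | i : 'I_n];
  sroot_free : free [seq sroot j | j : 'I_n];
  sroot_coroot : forall i j, sroot j (coroot i) = A i j
}.

Section CartanMatrix.
Variables (K : fieldType) (n : nat) (A : 'M[K]_n) (R : realization A).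
Variable p : 'I_n -> bool.

Record cartan_rel (L : lieSuperType K) (f : R -> L) (x y : 'I_n -> L) : Prop := {
  cartan_linear : linear f;
  cartan_even : forall u, homog false (f u);
  cartan_parx : forall i, homog (p i) (x i);
  cartan_pary : forall i, homog (p i) (y i);
  cartan_hh : forall u v, ⁅f u, f v⁆ = 0;
  cartan_hx : forall u j, ⁅f u, x j⁆ = (sroot R j u : K) *: x j;
  cartan_hy : forall u j, ⁅f u, y j⁆ = - (sroot R j u : K) *: y j;
  cartan_xy : forall i j, ⁅x i, y j⁆ = if i == j then f (coroot R i) else 0
}.

Record cartan_model := CartanModel {
  cm :> lieSuperType K;
  cmh : R -> cm;
  cmx : 'I_n -> cm;
  cmy : 'I_n -> cm;
  cm_rel : cartan_rel cmh cmx cmy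
}.

(* The Lie superalgebra presented by [cartan_rel] is the quotient of the set of
   all words in the generators and the operations of a Lie superalgebra (the
   parity projections included) by the equalities that hold in every Lie
   superalgebra with elements satisfying [cartan_rel]; this is the universal
   one among those which are generated by such elements. *)
Inductive word :=
  | WH of R | WX of 'I_n | WY of 'I_n
  | W0 | WOpp of word | WAdd of word & word | WScale of K & word
  | WPart of bool & word | WBrk of word & word.

Fixpoint weval (M : cartan_model) (s : word) : M :=
  match s with
  | WH u => cmh M u
  | WX i => cmx M i
  | WY i => cmy M i
  | W0 => 0
  | WOpp s => - weval M s
  | WAdd s t => weval M s + weval M t
  | WScale a s => a *: weval M s
  | WPart b s => part b (weval M s)
  | WBrk s t => ⁅weval M s, weval M t⁆
  end.

HB.instance Definition _ := gen_eqMixin word.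
HB.instance Definition _ := gen_choiceMixin word.

Definition weq (s t : word) : bool :=
  `[< forall M : cartan_model, weval M s = weval M t >].

Fact weq_equiv : equiv_class_of weq.
Proof.
split=> [s|s t|t s u]; first exact/asboolP.
- by apply/asboolP/asboolP => h M; rewrite h.
- by move=> /asboolP h1 /asboolP h2; apply/asboolP => M; rewrite h1 h2.
Qed.
Canonical weq_canonical := EquivRelPack weq_equiv.

Definition gtilde := {eq_quot weq}%qT.
HB.instance Definition _ := Choice.on gtilde.

Definition gword (s : word) : gtilde := (\pi_({eq_quot weq}) s)%qT.
Definition gev (M : cartan_model) (x : gtilde) : M :=
  weval M (repr (x : {eq_quot weq}%qT)).

Lemma gev_word M s : gev M (gword s) = weval M s.
Proof.
rewrite /gev; move: M; apply/asboolP/(@eqmodP _ weq_canonical).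
exact: reprK.
Qed.
Lemma gev_inj (x y : gtilde) : (forall M, gev M x = gev M y) -> x = y.
Proof.
move=> h; rewrite -[x]reprK -[y]reprK.
by apply/(@eqmodP _ weq_canonical)/asboolP.
Qed.

Local Notation wr x := (repr (x : {eq_quot weq}%qT)).

Definition gadd (x y : gtilde) := gword (WAdd (wr x) (wr y)).
Definition gopp (x : gtilde) := gword (WOpp (wr x)).
Definition gscale a (x : gtilde) := gword (WScale a (wr x)).
Definition gpart b (x : gtilde) := gword (WPart b (wr x)).
Definition gbrk (x y : gtilde) := gword (WBrk (wr x) (wr y)).

Fact gevD M x y : gev M (gadd x y) = gev M x + gev M y.
Proof. exact: gev_word. Qed.
Fact gevN M x : gev M (gopp x) = - gev M x.
Proof. exact: gev_word. Qed.
Fact gevZ M a x : gev M (gscale a x) = a *: gev M x.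
Proof. exact: gev_word. Qed.
Fact gev_part M b x : gev M (gpart b x) = part b (gev M x).
Proof. exact: gev_word. Qed.
Fact gev_brk M x y : gev M (gbrk x y) = ⁅gev M x, gev M y⁆.
Proof. exact: gev_word. Qed.
Fact gev0 M : gev M (gword W0) = 0.
Proof. exact: gev_word. Qed.
Let gevE := (gevD, gevN, gevZ, gev_part, gev_brk, gev0).

Fact gaddA : associative gadd.
Proof. by move=> x y z; apply: gev_inj => M; rewrite !gevE addrA. Qed.
Fact gaddC : commutative gadd.
Proof. by move=> x y; apply: gev_inj => M; rewrite !gevE addrC. Qed.
Fact gadd0 : left_id (gword W0) gadd.
Proof. by move=> x; apply: gev_inj => M; rewrite !gevE add0r. Qed.
Fact gaddN : left_inverse (gword W0) gopp gadd.
Proof. by move=> x; apply: gev_inj => M; rewrite !gevE addNr. Qed.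
HB.instance Definition _ :=
  GRing.isZmodule.Build gtilde gaddA gaddC gadd0 gaddN.

Fact gscaleA a b (x : gtilde) : gscale a (gscale b x) = gscale (a * b) x.
Proof. by apply: gev_inj => M; rewrite !gevE scalerA. Qed.
Fact gscale1 : left_id 1 gscale.
Proof. by move=> x; apply: gev_inj => M; rewrite !gevE scale1r. Qed.
Fact gscaleDr : right_distributive gscale +%R.
Proof. by move=> a x y; apply: gev_inj => M; rewrite !gevE scalerDr. Qed.
Fact gscaleDl (x : gtilde) : {morph gscale^~ x : a b / a + b}.
Proof. by move=> a b; apply: gev_inj => M; rewrite !gevE scalerDl. Qed.
HB.instance Definition _ :=
  GRing.Zmodule_isLmodule.Build K gtilde gscaleA gscale1 gscaleDr gscaleDl.

Fact gpart_linear b : linear (gpart b).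
Proof. by move=> a x y; apply: gev_inj => M; rewrite !gevE partD partZ. Qed.
Fact gpart_add (x : gtilde) : gpart false x + gpart true x = x.
Proof. by apply: gev_inj => M; rewrite !gevE part_add. Qed.
Fact gpart_part b c (x : gtilde) :
  gpart b (gpart c x) = if b == c then gpart c x else 0.
Proof. by apply: gev_inj => M; rewrite !gevE part_part; case: eqP; rewrite gevE. Qed.
Fact gbrk_linearl (y : gtilde) : linear (gbrk^~ y).
Proof. by move=> a x z; apply: gev_inj => M; rewrite !gevE brkDl brkZl. Qed.
Fact gbrk_linearr (x : gtilde) : linear (gbrk x).
Proof. by move=> a y z; apply: gev_inj => M; rewrite !gevE brkDr brkZr. Qed.
Fact ghomog M b (x : gtilde) : gpart b x = x -> homog b (gev M x).
Proof. by move=> h; rewrite /homog -gev_part h. Qed.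
Fact gbrk_part b c (x y : gtilde) : gpart b x = x -> gpart c y = y ->
  gpart (b (+) c) (gbrk x y) = gbrk x y.
Proof.
move=> hx hy; apply: gev_inj => M.
by rewrite !gevE (brk_part (ghomog M hx) (ghomog M hy)).
Qed.
Fact gbrk_skew b c (x y : gtilde) : gpart b x = x -> gpart c y = y ->
  gbrk x y = - (-1) ^+ (b && c) *: gbrk y x.
Proof.
move=> hx hy; apply: gev_inj => M.
by rewrite !gevE (brk_skew (ghomog M hx) (ghomog M hy)).
Qed.
Fact gbrk_jacobi b c (x y z : gtilde) : gpart b x = x -> gpart c y = y ->
  gbrk x (gbrk y z) =
    gbrk (gbrk x y) z + (-1) ^+ (b && c) *: gbrk y (gbrk x z).
Proof.
move=> hx hy; apply: gev_inj => M.
by rewrite !gevE (brk_jacobi _ (ghomog M hx) (ghomog M hy)).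
Qed.
Fact gbrk_cube (x : gtilde) : gpart true x = x -> gbrk x (gbrk x x) = 0.
Proof.
by move=> hx; apply: gev_inj => M; rewrite !gevE (brk_cube (ghomog M hx)).
Qed.
HB.instance Definition _ := Lmodule_isLieSuper.Build K gtilde
  gpart_linear gpart_add gpart_part gbrk_linearl gbrk_linearr
  gbrk_part gbrk_skew gbrk_jacobi gbrk_cube.

Lemma gtilde_rel : cartan_rel
  (fun u => gword (WH u)) (fun i => gword (WX i)) (fun i => gword (WY i)).
Proof.
split=> [a u v|u|i|i|u v|u j|u j|i j]; apply: gev_inj => M.
- by rewrite !(gevE, gev_word) /= (cartan_linear (cm_rel M)).
- by rewrite !(gevE, gev_word) (cartan_even (cm_rel M)).
- by rewrite !(gevE, gev_word) (cartan_parx (cm_rel M)).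
- by rewrite !(gevE, gev_word) (cartan_pary (cm_rel M)).
- by rewrite !(gevE, gev_word) (cartan_hh (cm_rel M)).
- by rewrite !(gevE, gev_word) (cartan_hx (cm_rel M)).
- by rewrite !(gevE, gev_word) (cartan_hy (cm_rel M)).
- rewrite !(gevE, gev_word) (cartan_xy (cm_rel M)).
  by case: eqP => _; rewrite ?gevE ?gev_word.
Qed.

(* the component of degree [d] for deg h = 0 and deg x_i = e_i = - deg y_i *)
Inductive gdegree : 'rV[int]_n -> gtilde -> Prop :=
  | gdegree_h u : gdegree 0 (gword (WH u))
  | gdegree_x i : gdegree (delta_mx 0 i) (gword (WX i))
  | gdegree_y i : gdegree (- delta_mx 0 i) (gword (WY i))
  | gdegree_lin d a u v : gdegree d u -> gdegree d v -> gdegree d (a *: u + v)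
  | gdegree_0 d : gdegree d 0
  | gdegree_brk d e u v : gdegree d u -> gdegree e v -> gdegree (d + e) ⁅u, v⁆.

Definition graded_ideal (I : ideal gtilde) := forall u, I u ->
  exists2 s : seq gtilde, u = \sum_(v <- s) v &
    forall v, v \in s -> I v /\ exists d, gdegree d v.

Definition trivial_on_h (I : ideal gtilde) :=
  forall u, I (gword (WH u)) -> gword (WH u) = 0.

(* The largest graded ideal intersecting h trivially, constructed as the sum of
   all of them. *)
Definition radical_mem (u : gtilde) :=
  exists2 s : seq gtilde, u = \sum_(v <- s) v &
    forall v, v \in s ->
      exists I : ideal gtilde, [/\ graded_ideal I, trivial_on_h I & I v].

Fact radical_map (F : gtilde -> gtilde) u :
  F 0 = 0 -> {morph F : v w / v + w} ->
  (forall (I : ideal gtilde) v, I v -> I (F v)) ->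
  radical_mem u -> radical_mem (F u).
Proof.
move=> F0 FD FI [s -> hs]; exists (map F s).
  by rewrite big_map; exact: (big_morph F FD F0).
move=> _ /mapP[v /hs[I [gI tI Iv]] ->].
by exists I; split=> //; exact: FI.
Qed.
Fact radical0 : radical_mem 0.
Proof. by exists [::]; rewrite ?big_nil. Qed.
Fact radicalP a u v :
  radical_mem u -> radical_mem v -> radical_mem (a *: u + v).
Proof.
move=> hu [t -> ht].
have [] := @radical_map (fun w => a *: w) u _ _ _ hu.
- by rewrite scaler0.
- by move=> *; rewrite scalerDr.
- by move=> I w; exact: idealZ.
move=> s -> hs; exists (s ++ t); first by rewrite big_cat.
by move=> w; rewrite mem_cat => /orP[/hs|/ht].
Qed.
Fact radical_part b u : radical_mem u -> radical_mem (part b u).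
Proof.
by apply: radical_map => [|v w|I v]; [exact: part0 | exact: partD | exact: ideal_part].
Qed.
Fact radical_brk u v : radical_mem v -> radical_mem ⁅u, v⁆.
Proof.
by apply: radical_map => [|w w'|I w]; [exact: brk0r | exact: brkDr | exact: ideal_brk].
Qed.
Definition radical : ideal gtilde :=
  Ideal radical0 radicalP radical_part radical_brk.

Definition gA := quot radical.
HB.instance Definition _ := LieSuper.on gA.

Definition gh (u : R) : gA := qpi radical (gword (WH u)).
Definition gx (i : 'I_n) : gA := qpi radical (gword (WX i)).
Definition gy (i : 'I_n) : gA := qpi radical (gword (WY i)).

Lemma gA_rel : cartan_rel gh gx gy.
Proof.
have T := gtilde_rel; split=> [a u v|u|i|i|u v|u j|u j|i j]; rewrite /gh /gx /gy.
- by rewrite (cartan_linear T) qpiD qpiZ.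
- by rewrite /homog [LHS]qpartE (cartan_even T).
- by rewrite /homog [LHS]qpartE (cartan_parx T).
- by rewrite /homog [LHS]qpartE (cartan_pary T).
- by rewrite [LHS]qbrkE (cartan_hh T).
- by rewrite [LHS]qbrkE (cartan_hx T) qpiZ.
- by rewrite [LHS]qbrkE (cartan_hy T) qpiZ.
- by rewrite [LHS]qbrkE (cartan_xy T); case: eqP.
Qed.

Lemma sroot_neq0 j : exists u, (sroot R j u : K) != 0.
Proof.
apply: contrapT => /forallNP h; have : sroot R j != 0.
  apply: (free_not0 (sroot_free R)).
  by apply/imageP; exists j.
case/eqP; apply/lfunP => u; rewrite zero_lfunE.
by apply/eqP/negPn/negP; exact: h.
Qed.

Lemma gx_derived i : derived_mem (gx i).
Proof.
have [u hu] := sroot_neq0 i.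
rewrite -[gx i]scale1r -(mulVf hu) -scalerA -(cartan_hx gA_rel) -brkZl.
exact: derived_brk.
Qed.
Lemma gy_derived i : derived_mem (gy i).
Proof.
have [u hu] := sroot_neq0 i; rewrite -oppr_eq0 in hu.
rewrite -[gy i]scale1r -(mulVf hu) -scalerA -(cartan_hy gA_rel) -brkZl.
exact: derived_brk.
Qed.

Definition gA1c := quot (center (derived gA)).
HB.instance Definition _ := LieSuper.on gA1c.

Definition g1cx (i : 'I_n) : gA1c := qpi (center (derived gA)) (dmk (gx_derived i)).
Definition g1cy (i : 'I_n) : gA1c := qpi (center (derived gA)) (dmk (gy_derived i)).

End CartanMatrix.

(* The classes of the members of [s] form a basis of the quotient of [Z] by
   [B], for subspaces [B] and [Z] of [V] with [B] contained in [Z]. *)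
Definition basis_mod (K : fieldType) (V : lmodType K) (Z B : V -> Prop)
    (s : seq V) : Prop :=
  (forall v, v \in s -> Z v) /\
  (forall z, Z z -> exists! c : 'rV[K]_(size s),
     B (z - \sum_(i < size s) c 0 i *: s`_i)).

Definition dim_mod (K : fieldType) (V : lmodType K) (Z B : V -> Prop) (n : nat) :=
  exists2 s : seq V, size s = n & basis_mod Z B s.

Definition is_basis (K : fieldType) (V : lmodType K) (s : seq V) : Prop :=
  basis_mod (fun=> True) (fun v => v = 0) s.

Section Cohomology.
Variables (K : fieldType) (L : lieSuperType K).

Definition hderivation (b : bool) (D : L -> L) : Prop :=
  [/\ linear D,
      forall c u, homog c u -> homog (b (+) c) (D u) &
      forall c u v, homog c u ->
        D ⁅u, v⁆ = ⁅D u, v⁆ + (-1) ^+ (b && c) *: ⁅u, D v⁆].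

Definition derivation (D : L -> L) : Prop :=
  exists D0 D1, [/\ hderivation false D0, hderivation true D1 & D = D0 + D1].

Definition inner_derivation (D : L -> L) : Prop := exists u, D = brk u.

Definition H1_basis : seq (L -> L) -> Prop :=
  basis_mod derivation inner_derivation.

(* Values are taken in [K^o] so that the forms make up an [lmodType]. *)
Definition cocycle2 (w : L -> L -> K^o) : Prop :=
  (forall u, linear (w u)) /\ (forall v, linear (w^~ v)) /\
  [/\ forall b c u v, homog b u -> homog c v ->
        w u v = - (-1) ^+ (b && c) * w v u,
      forall b c u v z, homog b u -> homog c v ->
        w ⁅u, v⁆ z = w u ⁅v, z⁆ - (-1) ^+ (b && c) * w v ⁅u, z⁆ &
      forall u, homog true u -> w u ⁅u, u⁆ = 0].

Definition coboundary2 (w : L -> L -> K^o) : Prop :=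
  exists2 f : L -> K^o, linear f & w = fun u v => f ⁅u, v⁆.

Definition H2_basis : seq (L -> L -> K^o) -> Prop :=
  basis_mod cocycle2 coboundary2.

Definition H2_dim : nat -> Prop := dim_mod cocycle2 coboundary2.

Definition automorphism (f g : L -> L) : Prop :=
  [/\ linear f, forall b u, homog b u -> homog b (f u),
      forall u v, f ⁅u, v⁆ = ⁅f u, f v⁆, cancel f g & cancel g f].

End Cohomology.
Arguments H2_dim {K} L n.

Definition A23 (K : fieldType) : 'M[K]_3 :=
  \matrix_(i, j) (nth [::] [:: [::  2; -1; -1];
                              [:: -1;  2; -1];
                              [:: -1; -1;  0]] i)`_j.

Definition p23 (i : 'I_3) : bool := i == 2 :> nat.

Notation g23 R := (gA R p23).
Notation bj R := (gA1c R p23).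

Notation i1 := (@Ordinal 3 0 isT).
Notation i2 := (@Ordinal 3 1 isT).
Notation i3 := (@Ordinal 3 2 isT).

(* [X k] and [Y k] stand for x_k and y_k, k = 1, ..., 11 *)
Definition ridx := (bool * nat)%type.
Local Notation X k := ((false, k%N) : ridx).
Local Notation Y k := ((true, k%N) : ridx).
Definition ridxs : seq ridx := [seq X k | k <- iota 1 11] ++ [seq Y k | k <- iota 1 11].
Definition ridx_odd (r : ridx) : bool := r.2 \in [:: 3; 5; 6; 7; 8; 9; 10]%N.

Section Tables.
Variables (K : fieldType) (L : lieSuperType K) (x y : 'I_3 -> L).

Definition rootv0 (x1 x2 x3 : L) (k : nat) : L :=
  match k with
  | 1 => x1
  | 2 => x2
  | 3 => x3
  | 4 => ⁅x1, x2⁆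
  | 5 => ⁅x1, x3⁆
  | 6 => ⁅x2, x3⁆
  | 7 => ⁅x3, ⁅x1, x2⁆⁆
  | 8 => ⁅⁅x1, x2⁆, ⁅x1, x3⁆⁆
  | 9 => ⁅⁅x1, x2⁆, ⁅x2, x3⁆⁆
  | 10 => ⁅⁅x1, x2⁆, ⁅x3, ⁅x1, x2⁆⁆⁆
  | 11 => ⁅⁅x3, ⁅x1, x2⁆⁆, ⁅x3, ⁅x1, x2⁆⁆⁆
  | _ => 0
  end.

Definition rootv (r : ridx) : L :=
  if r.1 then rootv0 (y i1) (y i2) (y i3) r.2
  else rootv0 (x i1) (x i2) (x i3) r.2.

Definition rootvs : seq L := [seq rootv r | r <- ridxs].

Definition hv (i : 'I_3) : L := ⁅x i, y i⁆.

(* An entry [(a, r, s)] of [t] means that [r] is sent to [a] times [s]; basis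
   elements that do not occur are sent to 0. *)
Definition map_table (t : seq (K * ridx * ridx)) (D : L -> L) : Prop :=
  [/\ linear D,
      forall r, r \in ridxs ->
        D (rootv r) = \sum_(e <- t | e.1.2 == r) e.1.1 *: rootv e.2 &
      forall i, D (hv i) = 0].

(* The form that is the sum of a r^ /\ s^ over the entries [(a, r, s)] of [t];
   r^ /\ s^ has the value -(-1)^(p(r)p(s)) on (s, r). *)
Definition form_table (t : seq (K * ridx * ridx)) (w : L -> L -> K^o) : Prop :=
  (forall u, linear (w u)) /\ (forall v, linear (w^~ v)) /\
  [/\ forall r s, r \in ridxs -> s \in ridxs -> w (rootv r) (rootv s) =
        \sum_(e <- t) e.1.1 * (((r == e.1.2) && (s == e.2))%:R
          - (-1) ^+ (ridx_odd r && ridx_odd s) * ((r == e.2) && (s == e.1.2))%:R),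
      forall i v, w (hv i) v = 0 &
      forall i v, w v (hv i) = 0].

End Tables.

Section BjTables.
Variable K : fieldType.
Implicit Type t : seq (K * ridx * ridx).

Definition D3_1 : seq (K * ridx * ridx) :=
  [:: (1, X 1, Y 4); (1, X 4, Y 1); (1, X 8, X 3); (-1, X 10, X 6);
      (1, Y 3, Y 8); (-1, Y 6, Y 10)].
Definition D3_2 : seq (K * ridx * ridx) :=
  [:: (-1, X 2, Y 4); (-1, X 4, Y 2); (-1, X 9, X 3); (-1, X 10, X 5);
      (-1, Y 3, Y 9); (-1, Y 5, Y 10)].
Definition D0_1 : seq (K * ridx * ridx) :=
  [:: (1, X 1, X 2); (1, X 5, X 6); (1, X 8, X 9);
      (-1, Y 2, Y 1); (-1, Y 6, Y 5); (-1, Y 9, Y 8)].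
Definition D0_2 : seq (K * ridx * ridx) :=
  [:: (1, X 1, X 1); (-1, X 2, X 2); (1, X 5, X 5); (-1, X 6, X 6);
      (1, X 8, X 8); (-1, X 9, X 9);
      (-1, Y 1, Y 1); (1, Y 2, Y 2); (-1, Y 5, Y 5); (1, Y 6, Y 6);
      (-1, Y 8, Y 8); (1, Y 9, Y 9)].
Definition D0_3 : seq (K * ridx * ridx) :=
  [:: (1, X 2, X 1); (1, X 6, X 5); (1, X 9, X 8);
      (-1, Y 1, Y 2); (-1, Y 5, Y 6); (-1, Y 8, Y 9)].

Definition c3_1 : seq (K * ridx * ridx) :=
  [:: (2, X 1, X 4); (1, X 8, Y 3); (1, X 10, Y 6)].
Definition c3_2 : seq (K * ridx * ridx) :=
  [:: (1, X 2, X 4); (2, X 9, Y 3); (1, X 10, Y 5)].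
Definition c0_1 : seq (K * ridx * ridx) :=
  [:: (2, X 1, Y 2); (1, X 5, Y 6); (1, X 8, Y 9)].
Definition c0_2 : seq (K * ridx * ridx) :=
  [:: (2, X 1, Y 1); (1, X 2, Y 2); (1, X 5, Y 5); (2, X 6, Y 6);
      (1, X 8, Y 8); (2, X 9, Y 9)].
Definition c0_3 : seq (K * ridx * ridx) :=
  [:: (1, X 2, Y 1); (2, X 6, Y 5); (2, X 9, Y 8)].

End BjTables.

(* Main.v *)
Require Import Defs.
From HB Require Import structures.
From mathcomp Require Import all_boot all_algebra.
From mathcomp Require Import boolp functions ring zify.

Set Implicit Arguments.
Unset Strict Implicit.
Unset Printing Implicit Defensive.

Import GRing.Theory.
Local Open Scope ring_scope.

(* In the basis of root vectors and Cartan elements, the structure constants of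
   g(2,3) lie in the prime field.  The 26-dimensional algebra with these constants
   satisfies the Cartan relations, and in it no nonzero element of positive
   (negative) height is killed by all y_i (all x_i).  In the algebra presented by
   the Cartan relations the elements of height 0 form h, so by descending to height
   0 every graded ideal intersecting h trivially is mapped to 0; hence the ideal that
   is factored out is the kernel of the map to the 26-dimensional algebra.

   Derivations and cocycles are the solutions of linear systems with coefficients in
   the prime field whose unknowns are their matrix entries.  Subtracting a
   combination of the given classes and of inner derivations (coboundaries) makes
   suitable entries vanish.  After that, the equations can be ordered in such a way
   that each of them contains only one unknown not yet known to be 0, so that all
   entries vanish. *)

(** * Sparse linear combinations with coefficients in the prime field *)

(** Modulo 3 the first two rows of A are both (-1, -1, -1). Hence h_1 - h_2 is central in g(2,3),
    and h_1 = h_2 in bj. Three classes come from this: the outer derivation of g(2,3) maps the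
    quotient by g^(1) into the center; D_0^2 is the action on bj of the Cartan element D on which
    the simple roots take the values 1, -1, 0; and c_0^2(u, v) is the coefficient of h_2 minus that
    of h_1 in the bracket of u and v computed in g(2,3), which is the cocycle of the central
    extension g(2,3)^(1) of bj.

    The given D_4 is an arbitrary complement, so the tables use the normalized D, and D_4 is brought
    back at the end by a rescaling. One linear system serves both parities, because the indices of a
    matrix entry determine the parity of the component to which it belongs.

    An elimination with 576 or 676 unknowns is replaced by unit propagation, whose correctness is
    immediate; it only needs a few functionals as certificate. *)

Notation F3 := (option bool).

(** [None] is 0 and [Some b] is (-1)^b. Parity signs are thus coefficients as they stand, and
    multiplying signs is an exclusive or. *)
Definition f3add (a b : F3) : F3 :=
  match a, b with
  | None, _ => b
  | _, None => a
  | Some s, Some t => if s == t then Some (~~ s) else None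
  end.
Definition f3mul (a b : F3) : F3 :=
  match a, b with Some s, Some t => Some (s (+) t) | _, _ => None end.

Definition comb (I : Type) := seq (F3 * I).

Section Comb.
Variables (I J : eqType).
Implicit Types (r s : comb I).

Definition cscale (T : Type) (a : F3) (r : comb T) : comb T :=
  [seq (f3mul a t.1, t.2) | t <- r].

Definition cbind (T T' : Type) (r : comb T) (f : T -> comb T') : comb T' :=
  flatten [seq cscale t.1 (f t.2) | t <- r].

(** Keeps the indices distinct and the coefficients nonzero, so that two combinations can be
    compared by testing whether their normalized difference is empty. *)
Fixpoint cinsert (a : F3) (i : I) r : comb I :=
  match r with
  | [::] => if a is None then [::] else [:: (a, i)]
  | (b, j) :: r' =>
      if i == j then
        let c := f3add a b in if c is None then r' else (c, j) :: r'
      else (b, j) :: cinsert a i r'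
  end.

Definition cnorm r : comb I := foldr (fun t => cinsert t.1 t.2) [::] r.

Definition ceq r s : bool := nilp (cnorm (r ++ cscale (Some true) s)).

Definition coef r (i : I) : F3 :=
  foldr (fun t a => if t.2 == i then f3add t.1 a else a) None r.

Definition cdot (T : Type) (r : comb T) (g : T -> F3) : F3 :=
  foldr (fun t a => f3add (f3mul t.1 (g t.2)) a) None r.

End Comb.

Section Eval.
Variables (K : fieldType) (charK : 3%N \in [pchar K]).

Definition f3 (a : F3) : K := if a is Some b then (-1) ^+ b else 0.

Lemma two_char3 : 2%:R = -1 :> K.
Proof.
have /eqP := pcharf0 charK.
by rewrite -[3%N]/(2 + 1)%N natrD addr_eq0 => /eqP.
Qed.

Lemma f3D a b : f3 (f3add a b) = f3 a + f3 b.
Proof.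
case: a b => [s|] [t|] //=; rewrite ?addr0 ?add0r //.
by case: s t => -[] /=; rewrite !(expr0, expr1) ?subrr ?addNr //
  -?opprD -(natrD _ 1 1) two_char3 ?opprK.
Qed.

Lemma f3M a b : f3 (f3mul a b) = f3 a * f3 b.
Proof.
by case: a b => [s|] [t|] //=; rewrite ?mul0r ?mulr0 // signr_addb.
Qed.

Definition ev (V : lmodType K) (I : Type) (x : I -> V) (r : comb I) : V :=
  \sum_(t <- r) f3 t.1 *: x t.2.

Section EvalTheory.
Variables (V : lmodType K).

Lemma ev_nil I (x : I -> V) : ev x [::] = 0.
Proof. exact: big_nil. Qed.

Lemma ev_cons I (x : I -> V) t r : ev x (t :: r) = f3 t.1 *: x t.2 + ev x r.
Proof. exact: big_cons. Qed.

Lemma ev_cat I (x : I -> V) r s : ev x (r ++ s) = ev x r + ev x s.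
Proof. exact: big_cat. Qed.

Lemma ev1 I (x : I -> V) i : ev x [:: (Some false, i)] = x i.
Proof. by rewrite ev_cons ev_nil addr0 /= expr0 scale1r. Qed.

Lemma ev_scale I (x : I -> V) a r : ev x (cscale a r) = f3 a *: ev x r.
Proof.
rewrite /ev big_map scaler_sumr; apply: eq_bigr => t _ /=.
by rewrite f3M scalerA.
Qed.

Lemma ev_map I J (x : J -> V) (f : I -> J) r :
  ev x [seq (t.1, f t.2) | t <- r] = ev (x \o f) r.
Proof. by rewrite /ev big_map. Qed.

Lemma ev_bind I J (x : J -> V) r (f : I -> comb J) :
  ev x (cbind r f) = ev (fun i => ev x (f i)) r.
Proof.
rewrite /cbind; elim: r => [|t r IHr] /=; first by rewrite !ev_nil.
by rewrite ev_cat ev_cons ev_scale IHr.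
Qed.

Lemma eq_ev I (x y : I -> V) r : x =1 y -> ev x r = ev y r.
Proof. by move=> brk_xy; apply: eq_bigr => t _; rewrite brk_xy. Qed.

Lemma ev_norm (I : eqType) (x : I -> V) r : ev x (cnorm r) = ev x r.
Proof.
have ins a i s : ev x (cinsert a i s) = f3 a *: x i + ev x s.
  elim: s => [|[b j] s IHs] /=.
    by case: a => [a|]; rewrite ?ev_cons //= scale0r add0r.
  have [-> | _] := eqVneq i j; last by rewrite !ev_cons IHs addrCA.
  rewrite !ev_cons addrA -scalerDl -f3D /=.
  case: (f3add a b) => [c|]; first by rewrite ev_cons.
  by rewrite /= scale0r add0r.
by elim: r => [|t r IHr] //=; rewrite ins IHr ev_cons.
Qed.

Lemma ceqP (I : eqType) (x : I -> V) r s : ceq r s -> ev x r = ev x s.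
Proof.
move=> /nilP rs; apply/eqP; rewrite -subr_eq0; apply/eqP.
transitivity (ev x (cnorm (r ++ cscale (Some true) s))); last by rewrite rs ev_nil.
by rewrite ev_norm ev_cat ev_scale /= expr1 scaleN1r.
Qed.

End EvalTheory.

Lemma ev_linear (V W : lmodType K) (f : V -> W) I (x : I -> V) r :
  linear f -> f (ev x r) = ev (f \o x) r.
Proof.
move=> fl; have f0 : f 0 = 0.
  by apply: (addrI (f 0)); rewrite addr0 -{3}[0](addr0 0) -{3}[0](scale1r 0) fl scale1r.
elim: r => [|t r IHr]; first by rewrite !ev_nil.
by rewrite !ev_cons fl IHr.
Qed.

Lemma ev_coef (I : eqType) (r : comb I) i :
  ev (fun j => (i == j)%:R : K^o) r = f3 (coef r i).
Proof.
elim: r => [|t r IHr] /=; first by rewrite ev_nil.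
rewrite ev_cons IHr eq_sym; case: eqP => _; last by rewrite scaler0 add0r.
by rewrite f3D /GRing.scale /= mulr1.
Qed.

Lemma ev_dot I (r : comb I) (g : I -> F3) :
  ev (fun i => f3 (g i) : K^o) r = f3 (cdot r g).
Proof.
elim: r => [|t r IHr] /=; first by rewrite ev_nil.
by rewrite ev_cons IHr f3D f3M.
Qed.

End Eval.

(** * Unit propagation for linear systems *)

Definition unknown := (nat * nat)%type.
Section UnitPropagation.
Implicit Types u : unknown.

(** The unknowns already shown to vanish are marked in a table of booleans with default [false],
    which grows on demand. *)
Definition is_known (s : seq (seq bool)) u : bool := nth false (nth [::] s u.1) u.2.
Definition set_known u (s : seq (seq bool)) : seq (seq bool) :=
  set_nth [::] s u.1 (set_nth false (nth [::] s u.1) u.2 true).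

(** A row with a single surviving unknown forces it to vanish; any other row is left for the next
    sweep. *)
Definition propagate_row (s : seq (seq bool)) (r : comb unknown) : seq (seq bool) :=
  if cnorm [seq t <- r | ~~ is_known s t.2] is [:: (Some _, u)] then set_known u s else s.

Definition propagate (n : nat) (rows : seq (comb unknown)) (s : seq (seq bool)) :=
  iter n (fun s => foldl propagate_row s rows) s.

Definition square m : seq unknown := [seq (i, j) | i <- iota 0 m, j <- iota 0 m].

Lemma mem_square m u : (u \in square m) = (u.1 < m)%N && (u.2 < m)%N.
Proof.
case: u => i j; apply/allpairsP/andP => [[[k l]] [/=] | [im jm]].
  by rewrite !mem_iota => km lm [-> ->].
by exists (i, j); rewrite !mem_iota.
Qed.

Lemma is_known_set u s v : is_known (set_known u s) v = (v == u) || is_known s v.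
Proof.
case: u v => [i j] [k l]; rewrite /is_known /set_known /= nth_set_nth /= xpair_eqE.
by have [->|//] := eqVneq k i; rewrite nth_set_nth /=; case: eqVneq.
Qed.

Section Propagate.
Variables (K : fieldType) (charK : 3%N \in [pchar K]) (x : unknown -> K^o).

Lemma propagateP n rows s :
  (forall r, r \in rows -> ev x r = 0) -> (forall u, is_known s u -> x u = 0) ->
  forall u, is_known (propagate n rows s) u -> x u = 0.
Proof.
move=> hr; rewrite /propagate; elim: n s => [|n IHn] s hs //; rewrite iterSr.
apply: IHn => {n}; elim: rows s hs hr => [|r rows IHr] s hs hr //=.
apply: IHr => [|r' r'rows]; last by apply: hr; rewrite inE r'rows orbT.
rewrite /propagate_row; case E: (cnorm _) => [|[[b|] u] [|t r']] //=.
have: ev x r = f3 K (Some b) *: x u.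
  transitivity (ev x [seq t <- r | ~~ is_known s t.2]).
    rewrite /ev big_filter [RHS]big_mkcond; apply: eq_bigr => t _.
    by case: ifPn => // /negPn/hs ->; rewrite scaler0.
  by rewrite -(ev_norm charK) E ev_cons ev_nil addr0.
rewrite hr ?mem_head // => /esym/eqP; rewrite scaler_eq0 signr_eq0 /= => /eqP xu.
by move=> v; rewrite is_known_set => /orP[/eqP->|/hs].
Qed.

End Propagate.

(* [psi] are functionals dual to [s] and vanishing on [b], [chi] are functionals
   such that every coordinate [F] in their supports is a combination of
   [psi] and [chi]; then the coordinates in [F] of a class can be cleared, after
   which the equations [rows] leave nothing. *)
Definition basis_check m (rows : seq (comb unknown)) (gs gb : seq (unknown -> F3))
    (psi chi : seq (comb unknown)) : bool :=
  let F := flatten (map (map snd) (psi ++ chi)) in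
  let g i := nth (fun=> None) (gs ++ gb) i in
  [&& size psi == size gs,
      all (fun i => all (fun j => cdot (nth [::] psi i) (g j)
             == if i == j then Some false else None) (iota 0 (size gs + size gb)))
        (iota 0 (size gs)),
      all (fun u => (u.1 < m)%N && (u.2 < m)%N &&
             ceq [:: (Some false, u)]
               (cbind [seq (g k u, k) | k <- iota 0 (size gs + size gb)]
                  (nth [::] (psi ++ chi)))) F &
      let s := propagate 3 rows (foldr set_known [::] F) in all (is_known s) (square m)].

Section BasisCheck.
Variables (K : fieldType) (charK : 3%N \in [pchar K]) (V : lmodType K).
Variables (Z B : V -> Prop) (X : V -> unknown -> K^o) (m : nat).
Hypothesis Xlinear : forall u, linear (X^~ u).
Hypothesis Zlinear : forall a z z', Z z -> Z z' -> Z (a *: z + z').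
Hypothesis X_inj : forall z, Z z ->
  (forall u, (u.1 < m)%N -> (u.2 < m)%N -> X z u = 0) -> z = 0.
Variables (rows : seq (comb unknown)) (s b : seq V).
Hypothesis Zrows : forall z r, Z z -> r \in rows -> ev (X z) r = 0.
Variables (gs gb : seq (unknown -> F3)) (psi chi : seq (comb unknown)).
Hypothesis gs_size : size gs = size s.
Hypothesis gb_size : size gb = size b.
Hypothesis Zsb : forall i, (i < size (s ++ b))%N -> Z (s ++ b)`_i.
Hypothesis Xsb : forall i u, (i < size (s ++ b))%N -> (u.1 < m)%N -> (u.2 < m)%N ->
  X (s ++ b)`_i u = f3 K (nth (fun=> None) (gs ++ gb) i u).
Hypothesis BP : forall v, B v <-> exists c : nat -> K, v = \sum_(k < size b) c k *: b`_k.

(** Existence: the combination of [s ++ b] with coefficients [phi k z] agrees with z in all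
    coordinates of the supports, so propagation shows that the difference is 0. Uniqueness: the
    first functionals are dual to [s] and vanish on B, hence they read off the coefficients. *)
Lemma basis_mod_check : basis_check m rows gs gb psi chi -> basis_mod Z B s.
Proof.
case/and4P=> /eqP psi_size dual /allP clear /allP left0.
pose N := (size s + size b)%N.
pose g := nth (fun=> None) (gs ++ gb).
pose phi k z : K^o := ev (X z) (nth [::] (psi ++ chi) k).
have supp_lt u : u \in flatten (map (map snd) (psi ++ chi)) ->
  (u.1 < m)%N && (u.2 < m)%N by case/clear/andP.
have supp k t : t \in nth [::] (psi ++ chi) k ->
    t.2 \in flatten (map (map snd) (psi ++ chi)).
  have [kl tk | kl] := ltnP k (size (psi ++ chi)); last by rewrite nth_default.
  apply/flattenP; exists (map snd (nth [::] (psi ++ chi) k)).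
    by rewrite map_f ?mem_nth.
  exact: map_f.
have phiD k a v w : phi k (a *: v + w) = a * phi k v + phi k w.
  rewrite /phi /ev mulr_sumr -big_split; apply: eq_bigr => t _ /=.
  by rewrite Xlinear scalerDr /GRing.scale /= mulrCA.
have phi0 k : phi k 0 = 0.
  by have := phiD k (-1) 0 0; rewrite scaleN1r addr0 oppr0 mulN1r addNr.
have phi_sum k n (c : 'I_n -> K) (v : 'I_n -> V) :
    phi k (\sum_i c i *: v i) = \sum_i c i * phi k (v i).
  elim/big_rec2: _ => [|i y w _ IH]; first exact: phi0.
  by rewrite phiD IH.
have Zsum z n (c : 'I_n -> K) (v : 'I_n -> V) :
    Z z -> (forall i, Z (v i)) -> Z (\sum_i c i *: v i + z).
  move=> Zz Zv; elim/big_rec: _ => [|i w _ IH]; first by rewrite add0r.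
  by rewrite -addrA; exact: Zlinear.
have sum_cat (f : nat -> K) : \sum_(k < N) f k *: (s ++ b)`_k =
    \sum_(i < size s) f i *: s`_i + \sum_(k < size b) f (size s + k)%N *: b`_k.
  rewrite big_split_ord /=; congr (_ + _); apply: eq_bigr => i _.
    by rewrite nth_cat ltn_ord.
  by rewrite nth_cat -ltn_subRL subnn ltn0 addKn.
have phi_dual i j : (i < size s)%N -> (j < N)%N ->
    phi i (s ++ b)`_j = (i == j)%:R.
  move=> si jN; have iN : (i < size (psi ++ chi))%N.
    by rewrite size_cat psi_size gs_size ltn_addr.
  move: (allP dual i); rewrite mem_iota gs_size => /(_ si)/allP/(_ j).
  rewrite mem_iota gb_size => /(_ jN)/eqP; rewrite -[nth [::] psi i](_ : nth [::] (psi ++ chi) i = _);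
    last by rewrite nth_cat psi_size gs_size si.
  rewrite -/(g j) => phig; transitivity (f3 K (if i == j then Some false else None)).
    rewrite -phig -(ev_dot charK) /phi /ev !big_seq; apply: eq_bigr => t /supp tF.
    by have /andP[t1 t2] := supp_lt _ tF; rewrite Xsb // size_cat.
  by case: eqP.
split=> [v vs | z Zz].
  have vi : (index v s < size s)%N by rewrite index_mem.
  have := Zsb (i := index v s); rewrite nth_cat vi nth_index //; apply.
  by rewrite size_cat ltn_addr.
have zE : z = \sum_(k < N) phi k z *: (s ++ b)`_k.
  apply/eqP; rewrite -subr_eq0; apply/eqP; rewrite -sumrN addrC.
  under eq_bigr do rewrite -scaleNr.
  apply: X_inj => [|u u1 u2]; first by apply: Zsum => // i; apply: Zsb; rewrite size_cat.
  set z' := _ + z.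
  have /left0 : u \in square m by rewrite mem_square u1.
  apply: (propagateP charK) => {u u1 u2} [r rrows | u].
    by apply: Zrows => //; apply: Zsum => // i; apply: Zsb; rewrite size_cat.
  have mem_mark F : is_known (foldr set_known [::] F) u -> u \in F.
    elim: F => [|v F IHF] /=; first by rewrite /is_known !nth_nil.
    by rewrite is_known_set inE => /orP[->//|/IHF ->]; rewrite orbT.
  move=> /mem_mark /[dup] /supp_lt/andP[u1 u2] /clear/andP[_].
  move=> /(ceqP charK (X z)); rewrite ev1 ev_bind /ev big_map.
  have -> : iota 0 (size gs + size gb) = index_iota 0 N.
    by rewrite /index_iota subn0 gs_size gb_size.
  rewrite big_mkord => uE.
  have Xsum n (c : 'I_n -> K) (v : 'I_n -> V) w :
      X (\sum_i c i *: v i + w) u = \sum_i c i * X (v i) u + X w u.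
    elim/big_rec2: _ => [|i y v' _ IH]; first by rewrite !add0r.
    by rewrite -!addrA Xlinear IH.
  rewrite Xsum uE -big_split big1 // => k _ /=.
  by rewrite Xsb ?size_cat // /GRing.scale /= mulNr mulrC addNr.
exists (\row_i phi i z); split.
  apply/BP; exists (fun k => phi (size s + k)%N z).
  rewrite {1}zE (sum_cat (phi^~ z)) addrC addrA (eq_bigr (fun i : 'I__ => phi i z *: s`_i)).
    by rewrite addNr add0r.
  by move=> i _; rewrite mxE.
move=> c /BP[d dE]; apply/rowP => i; rewrite mxE.
(* A competing choice of coefficients gives another expansion of z over [s ++ b]; applying [phi i]
   to it must return [c 0 i]. *)
pose cd k := if insub k is Some i then c 0 i else d (k - size s)%N.
have -> : z = \sum_(k < N) cd k *: (s ++ b)`_k.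
  rewrite sum_cat -[LHS](subrK (\sum_(i < size s) c 0 i *: s`_i)) dE addrC.
  congr (_ + _); apply: eq_bigr => j _; first by rewrite /cd valK.
  by rewrite /cd insubF ?addKn // -ltn_subRL subnn.
rewrite phi_sum (bigD1 (widen_ord (leq_addr _ _) i)) //= phi_dual ?ltn_addr //.
rewrite eqxx mulr1 /cd valK big1 ?addr0 // => k ki.
rewrite phi_dual //; case: eqP => [ik|]; last by rewrite mulr0.
by case/eqP: ki; apply: val_inj.
Qed.

End BasisCheck.

End UnitPropagation.

(** * Lie superalgebras given by a table of structure constants *)

Record coord_system (K : fieldType) (V : lmodType K) (m : nat)
    (e : nat -> V) (co : nat -> V -> K^o) : Prop := {
  cb_linear : forall i, linear (co i);
  cb_expand : forall u, u = \sum_(i < m) (co i u : K) *: e i;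
  cb_dual : forall i j, co i (e j) = ((i == j) && (i < m)%N)%:R
}.

(* The functions [e], [co] and [tab] vanish outside of the range of indices
   below [m], so that no statement below has to restrict indices. *)
Record table_basis (K : fieldType) (L : lieSuperType K) (m : nat)
    (tab : nat -> nat -> comb nat) (par : nat -> bool)
    (e : nat -> L) (co : nat -> L -> K^o) : Prop := {
  tb_coord :> coord_system m e co;
  tb_homog : forall i, homog (par i) (e i);
  tb_brk : forall i j, ⁅e i, e j⁆ = ev e (tab i j)
}.

Section Tables.
Variables (m : nat) (tab : nat -> nat -> comb nat) (par : nat -> bool).

Definition tbrk (r s : comb nat) : comb nat :=
  cbind r (fun i => cbind s (tab i)).

Definition csign (b : bool) (T : Type) (r : comb T) := cscale (Some b) r.

(** The unknown (a, b) is the coefficient of e_b in D e_a; the terms are those of D[e_i, e_j] minus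
    the Leibniz expansion, each tagged with its basis vector. A component of D of parity q has an
    entry (j, k) only if q = p_j + p_k, so the sign in front of [e_i, D e_j] depends on the indices
    alone. *)
Definition der_terms i j : comb (unknown * nat) :=
  [seq (t.1, (t.2, k, k)) | t <- tab i j, k <- iota 0 m] ++
  [seq (f3mul (Some true) t.1, (i, k, t.2)) | k <- iota 0 m, t <- tab k j] ++
  [seq (f3mul (Some (~~ (par i && (par j (+) par k)))) t.1, (j, k, t.2))
     | k <- iota 0 m, t <- tab i k].

Definition components (r : comb (unknown * nat)) : seq (comb unknown) :=
  [seq [seq (t.1, t.2.1) | t <- r & t.2.2 == k] | k <- iota 0 m].

Definition der_rows (S : seq nat) : seq (comb unknown) :=
  flatten [seq components (der_terms i j) | i <- S, j <- iota 0 m].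

Definition even_der_check (d : nat -> comb nat) : bool :=
  all (fun i => all (fun t => par t.2 == par i) (d i) &&
    all (fun j => ceq (cbind (tab i j) d)
      (tbrk (d i) [:: (Some false, j)] ++ tbrk [:: (Some false, i)] (d j)))
    (iota 0 m)) (iota 0 m).

Definition coc_row i j k : comb unknown :=
  [seq (t.1, (t.2, k)) | t <- tab i j] ++
  csign true [seq (t.1, (i, t.2)) | t <- tab j k] ++
  csign (par i && par j) [seq (t.1, (j, t.2)) | t <- tab i k].

Definition skew_row i j : comb unknown :=
  [:: (Some false, (i, j)); (Some (par i && par j), (j, i))].

Definition coc_rows (S : seq nat) : seq (comb unknown) :=
  [seq skew_row u.1 u.2 | u <- square m] ++
  [seq coc_row i u.1 u.2 | i <- S, u <- square m].

Definition coc_check (g : unknown -> F3) : bool :=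
  all (fun r => cdot r g == None) (coc_rows (iota 0 m)) &&
  all (fun i => ~~ par i ||
    (cdot [seq (t.1, (i, t.2)) | t <- tab i i] g == None)) (iota 0 m).

End Tables.

Section CoordBasis.
Variables (K : fieldType) (charK : 3%N \in [pchar K]) (L : lmodType K).
Variables (m : nat) (e : nat -> L) (co : nat -> L -> K^o).
Hypothesis cb : coord_system m e co.

Lemma linear_map0 (V W : lmodType K) (f : V -> W) : linear f -> f 0 = 0.
Proof.
by move=> fl; have := fl (-1) 0 0; rewrite scaleN1r addNr scaleN1r addNr.
Qed.

Lemma linear_map_sum (V W : lmodType K) (f : V -> W) : linear f ->
  forall n (c : 'I_n -> K) v, f (\sum_i c i *: v i) = \sum_i c i *: f (v i).
Proof.
move=> fl n c v; elim/big_rec2: _ => [|i y w _ <-]; [exact: linear_map0 | exact: fl].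
Qed.

Lemma linear_ext (V : lmodType K) (f g : L -> V) : linear f -> linear g ->
  (forall i, (i < m)%N -> f (e i) = g (e i)) -> f =1 g.
Proof.
move=> fl gl fg u; rewrite (cb_expand cb u) !linear_map_sum //.
by apply: eq_bigr => i _; rewrite fg.
Qed.

Lemma bilinear_ext (V : lmodType K) (f g : L -> L -> V) :
  (forall u, linear (f u)) -> (forall v, linear (f^~ v)) ->
  (forall u, linear (g u)) -> (forall v, linear (g^~ v)) ->
  (forall i j, (i < m)%N -> (j < m)%N -> f (e i) (e j) = g (e i) (e j)) ->
  forall u v, f u v = g u v.
Proof.
move=> fr fl gr gl fg u v; apply: (linear_ext (fl v) (gl v)) => i im.
by apply: linear_ext => // j jm; exact: fg.
Qed.

Lemma co_sum k n (c : 'I_n -> K) v : co k (\sum_i c i *: v i) = \sum_i c i * co k (v i).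
Proof. exact: (linear_map_sum (cb_linear cb k)). Qed.

Lemma co_out k u : (m <= k)%N -> co k u = 0.
Proof.
move=> mk; rewrite (cb_expand cb u) co_sum big1 // => i _.
by rewrite (cb_dual cb) [(k < m)%N]ltnNge mk andbF mulr0.
Qed.

Lemma basis_out k : (m <= k)%N -> e k = 0.
Proof.
move=> mk; rewrite (cb_expand cb (e k)) big1 // => i _.
by rewrite (cb_dual cb) ltn_eqF ?scale0r // (leq_trans (ltn_ord i)).
Qed.

Lemma co_eq u v : (forall k, (k < m)%N -> co k u = co k v) -> u = v.
Proof.
move=> uv; rewrite (cb_expand cb u) (cb_expand cb v).
by apply: eq_bigr => i _; rewrite uv.
Qed.

Lemma co_ev k r : (k < m)%N -> co k (ev e r) = f3 K (coef r k).
Proof.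
move=> km; rewrite (ev_linear _ _ (cb_linear cb k)) -(ev_coef charK); apply: eq_ev => i.
by rewrite /= (cb_dual cb) km andbT.
Qed.

(** Induction over the span of the basis vectors selected by [Q]; it reduces identities for
    homogeneous elements to basis vectors. *)
Lemma supp_ind (Q : pred nat) (P : L -> Prop) : P 0 ->
  (forall a u v, P u -> P v -> P (a *: u + v)) ->
  (forall i, (i < m)%N -> Q i -> P (e i)) ->
  forall u, (forall i, (i < m)%N -> ~~ Q i -> co i u = 0) -> P u.
Proof.
move=> P0 PD Pe u Qu; rewrite (cb_expand cb u); elim/big_rec: _ => // i v _ Pv.
have [Qi | Qi] := boolP (Q i); first by apply: PD => //; apply: Pe.
by rewrite (Qu _ (ltn_ord i) Qi) scale0r add0r.
Qed.

End CoordBasis.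

Section Bilinear.
Variables (K : fieldType) (L : lieSuperType K).
Variables (m : nat) (tab : nat -> nat -> comb nat) (par : nat -> bool).
Variables (e : nat -> L) (co : nat -> L -> K^o).
Hypothesis tb : table_basis m tab par e co.

Lemma part_basis c i : part c (e i) = if c == par i then e i else 0.
Proof. by rewrite -{1}[e i](tb_homog tb i) part_part; case: eqP => [_|//]; exact: (tb_homog tb). Qed.

Lemma co_part k c u : co k (part c u) = if c == par k then co k u else 0.
Proof.
rewrite (cb_expand tb u) (linear_map_sum (part_linear c)) !(co_sum tb).
case: ifP => [/eqP ck|ck]; last rewrite big1 //.
  apply: eq_bigr => i _; congr (_ * _); rewrite part_basis.
  case: eqP => // cpi; rewrite (cb_dual tb) (linear_map0 (cb_linear tb k)).
  by case: eqP => // ki; case: cpi; rewrite ck ki.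
move=> i _; rewrite part_basis; case: eqP => cpi; last by rewrite (linear_map0 (cb_linear tb k)) mulr0.
rewrite (cb_dual tb); case: eqP => [ki|]; last by rewrite mulr0.
by rewrite ki -cpi eqxx in ck.
Qed.

Lemma co_homog k c u : homog c u -> c != par k -> co k u = 0.
Proof. by move=> <- /negbTE ck; rewrite co_part ck. Qed.

Lemma homog_ind b (P : L -> Prop) : P 0 ->
  (forall a u v, P u -> P v -> P (a *: u + v)) ->
  (forall i, (i < m)%N -> par i = b -> P (e i)) -> forall u, homog b u -> P u.
Proof.
move=> P0 PD Pe u bu; apply: (supp_ind tb (Q := fun i => b == par i)) => //.
  by move=> i im /eqP/esym; exact: Pe.
by move=> i im; exact: co_homog.
Qed.

Lemma brk_ev r s : ⁅ev e r, ev e s⁆ = ev e (tbrk tab r s).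
Proof.
rewrite (ev_linear _ _ (brk_linearl _)) ev_bind; apply: eq_ev => i /=.
rewrite (ev_linear _ _ (brk_linearr _)) ev_bind; apply: eq_ev => j /=.
exact: (tb_brk tb).
Qed.

Lemma brk_sumr u v : ⁅u, v⁆ = \sum_(k < m) (co k v : K) *: ⁅u, e k⁆.
Proof. by rewrite {1}(cb_expand tb v) (linear_map_sum (brk_linearr u)). Qed.

Lemma brk_suml u v : ⁅u, v⁆ = \sum_(k < m) (co k u : K) *: ⁅e k, v⁆.
Proof. by rewrite {1}(cb_expand tb u) (linear_map_sum (brk_linearl v)). Qed.

End Bilinear.

(** * Derivations and linear equations *)

Lemma big_iota (V : nmodType) n (F : nat -> V) :
  \sum_(k <- iota 0 n) F k = \sum_(k < n) F k.
Proof. by rewrite -(big_mkord xpredT F) /index_iota subn0. Qed.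

Section Cohomology.
Variables (K : fieldType) (charK : 3%N \in [pchar K]) (L : lieSuperType K).
Variables (m : nat) (tab : nat -> nat -> comb nat) (par : nat -> bool).
Variables (e : nat -> L) (co : nat -> L -> K^o).
Hypothesis tb : table_basis m tab par e co.

Implicit Types D : L -> L.

Definition mapt (d : nat -> comb nat) (u : L) : L :=
  \sum_(i < m) (co i u : K) *: ev e (d i).

Lemma mapt_linear d : linear (mapt d).
Proof.
move=> a u v; rewrite /mapt scaler_sumr -big_split; apply: eq_bigr => i _ /=.
by rewrite (cb_linear tb) scalerDl scalerA.
Qed.

Lemma mapt_basis d i : (forall i, (m <= i)%N -> d i = [::]) ->
  mapt d (e i) = ev e (d i).
Proof.
move=> d0; have [mi | im] := leqP m i.
  by rewrite (basis_out tb mi) (linear_map0 (mapt_linear d)) d0 // ev_nil.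
 rewrite /mapt (bigD1 (Ordinal im)) //= (cb_dual tb) eqxx im scale1r.
rewrite big1 ?addr0 // => j ji; rewrite (cb_dual tb) ltn_ord andbT.
by case: eqP => [jE|]; [case/eqP: ji; apply: val_inj | rewrite scale0r].
Qed.

Definition der_coord (D : L -> L) (u : unknown) : K^o := co u.2 (D (e u.1)).

Lemma derivation_linear D : derivation D -> linear D.
Proof.
move=> [D0 [D1 [[l0 _ _] [l1 _ _] ->]]] a u v.
by rewrite !addrfctE l0 l1 scalerDr addrACA.
Qed.

Lemma derivation_brk D i j : derivation D -> D ⁅e i, e j⁆ = ⁅D (e i), e j⁆ +
  \sum_(k < m) ((-1) ^+ (par i && (par j (+) par k)) * co k (D (e j)) : K) *: ⁅e i, e k⁆.
Proof.
move=> [D0 [D1 [h0 h1 ->]]].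
have H b F : hderivation b F -> F ⁅e i, e j⁆ = ⁅F (e i), e j⁆ +
    \sum_(k < m) ((-1) ^+ (par i && (par j (+) par k)) * co k (F (e j)) : K) *: ⁅e i, e k⁆.
  move=> [Fl Fp Fb]; rewrite (Fb _ _ (e j) (tb_homog tb i)); congr (_ + _).
  rewrite (brk_sumr tb _ (F _)) scaler_sumr; apply: eq_bigr => k _; rewrite scalerA.
  (* Only coordinates with this parity survive, and for them the sign written with [par k] is that
     of a derivation of parity [b]. *)
  have [<- | bk] := eqVneq (b (+) par j) (par k).
    by rewrite addbC -addbA addbb addbF andbC.
  by rewrite (co_homog tb (Fp _ _ (tb_homog tb j)) bk) !mulr0 scale0r.
rewrite !addrfctE (H _ _ h0) (H _ _ h1) brkDl addrACA -big_split; congr (_ + _).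
apply: eq_bigr => k _ /=; rewrite -scalerDl -mulrDr.
by have := cb_linear tb k 1 (D0 (e j)) (D1 (e j)); rewrite !scale1r => ->.
Qed.

Lemma componentsP (x : unknown -> K^o) r s :
  ev (fun p : unknown * nat => (x p.1 : K) *: e p.2) r = 0 ->
  s \in components m r -> ev x s = 0.
Proof.
move=> r0 /mapP[k]; rewrite mem_iota /= add0n => km ->.
transitivity (co k (ev (fun p : unknown * nat => (x p.1 : K) *: e p.2) r)).
  rewrite (ev_linear _ _ (cb_linear tb k)) /ev big_map big_filter big_mkcond /=.
  apply: eq_bigr => t _; have := cb_linear tb k (x t.2.1) (e t.2.2) 0.
  rewrite !(linear_map0 (cb_linear tb k)) !addr0 => ->.
  rewrite (cb_dual tb) km andbT eq_sym.
  by case: eqP; rewrite /GRing.scale /= ?mulr1 ?mulr0.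
by rewrite r0 (linear_map0 (cb_linear tb k)).
Qed.

Lemma der_rowsP S D r : derivation D -> r \in der_rows m tab par S ->
  ev (der_coord D) r = 0.
Proof.
move=> hD /flattenP[rs /allpairsP[[i j] /= [_ _ ->]]]; apply: componentsP.
rewrite /der_terms !ev_cat /ev !big_allpairs_dep.
have Dl := derivation_linear hD.
transitivity (D ⁅e i, e j⁆ - (⁅D (e i), e j⁆ +
  \sum_(k < m) ((-1) ^+ (par i && (par j (+) par k)) * co k (D (e j)) : K) *: ⁅e i, e k⁆)).
  rewrite opprD; congr (_ + (_ + _)).
  - rewrite (tb_brk tb) (ev_linear _ _ Dl); apply: eq_bigr => t _.
    by rewrite /= {1}(cb_expand tb (D _)) scaler_sumr big_iota.
  - rewrite (brk_suml tb) big_iota -sumrN; apply: eq_bigr => k _.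
    rewrite (tb_brk tb) /ev scaler_sumr -sumrN; apply: eq_bigr => t _.
    by rewrite f3M /= expr1 mulN1r scaleNr !scalerA mulrC.
  rewrite big_iota -sumrN; apply: eq_bigr => k _.
  rewrite (tb_brk tb) /ev scaler_sumr -sumrN; apply: eq_bigr => t _.
  rewrite f3M /= signrN mulNr scaleNr !scalerA; congr (- (_ *: _)).
  by rewrite mulrAC.
by rewrite -(derivation_brk _ _ hD) subrr.
Qed.

Lemma der_inj D : derivation D ->
  (forall u, (u.1 < m)%N -> (u.2 < m)%N -> der_coord D u = 0) -> D = 0.
Proof.
move=> hD h0; apply/funext => u.
apply: (linear_ext tb (derivation_linear hD) (g := fun=> 0)) => [a v w|i im].
  by rewrite scaler0 addr0.
by apply: (co_eq tb) => k km; rewrite -[LHS]/(der_coord D (i, k)) h0 // (linear_map0 (cb_linear tb k)).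
Qed.

Lemma hderivation_lin b a D D' :
  hderivation b D -> hderivation b D' -> @hderivation K L b (a *: D + D').
Proof.
move=> [l1 p1 b1] [l2 p2 b2].
have E u : (a *: D + D') u = a *: D u + D' u by [].
split=> [c u v|c u hu|c u v hu]; rewrite !E.
- by rewrite l1 l2 !scalerDr !scalerA [c * a]mulrC addrACA.
- by rewrite /homog partD partZ (p1 _ _ hu) (p2 _ _ hu).
rewrite (b1 _ _ v hu) (b2 _ _ v hu) brkDl brkDr brkZl brkZr !scalerDr !scalerA.
by rewrite [a * _]mulrC addrACA.
Qed.

Lemma derivation_lin a D D' :
  derivation D -> derivation D' -> @derivation K L (a *: D + D').
Proof.
move=> [D0 [D1 [h0 h1 ->]]] [D0' [D1' [h0' h1' ->]]].
exists (a *: D0 + D0'), (a *: D1 + D1'); split; try exact: hderivation_lin.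
by rewrite scalerDr addrACA.
Qed.

Lemma hderivation0 b : @hderivation K L b 0.
Proof.
split=> [a u v|c u _|c u v _] /=.
- by rewrite scaler0 addr0.
- exact: part0.
by rewrite brk0l brk0r scaler0 addr0.
Qed.

Lemma hderivation_derivation b D : @hderivation K L b D -> derivation D.
Proof.
case: b => hD; [exists 0, D | exists D, 0]; split; rewrite ?add0r ?addr0 //;
  exact: hderivation0.
Qed.

Lemma inner_basis_derivation i : derivation (brk (e i)).
Proof.
apply: (@hderivation_derivation (par i)); split=> [|c u hu|c u v hu].
- exact: brk_linearr.
- exact: (brk_part (tb_homog tb i) hu).
exact: (brk_jacobi _ (tb_homog tb i) hu).
Qed.

Lemma even_derP D (d : nat -> comb nat) : linear D ->
  (forall i, D (e i) = ev e (d i)) ->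
  even_der_check m tab par d -> derivation D.
Proof.
move=> Dl De /allP ok; apply: (@hderivation_derivation false).
split=> [//|c u|c u v _] /=.
  move: u; apply: (homog_ind tb (P := fun u => homog c (D u))) => [|a v w hv hw|i im <-].
  - by rewrite (linear_map0 Dl); exact: part0.
  - by rewrite /homog Dl partD partZ hv hw.
  rewrite De //; have := ok i; rewrite mem_iota => /(_ im)/andP[/allP pd _].
  rewrite /homog (ev_linear _ _ (part_linear _)) /ev !big_seq.
  by apply: eq_bigr => t /pd /eqP <-; rewrite /= (tb_homog tb).
rewrite expr0 scale1r.
apply: (bilinear_ext tb (f := fun u v => D ⁅u, v⁆)
                        (g := fun u v => ⁅D u, v⁆ + ⁅u, D v⁆)).
- by move=> w a w1 w2; rewrite brk_linearr Dl.
- by move=> w a w1 w2; rewrite brk_linearl Dl.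
- by move=> w a w1 w2; rewrite brk_linearr Dl brk_linearr scalerDr addrACA.
- by move=> w a w1 w2; rewrite Dl !brk_linearl scalerDr addrACA.
move=> i j im jm; have := ok i; rewrite mem_iota => /(_ im)/andP[_ /allP/(_ j)].
rewrite mem_iota => /(_ jm)/(ceqP charK e); rewrite ev_bind ev_cat -!(brk_ev tb) !ev1.
rewrite (tb_brk tb) (ev_linear _ _ Dl) !De => <-.
by apply: eq_ev => k /=.
Qed.

Lemma inner_derivationP D : inner_derivation D <->
  exists c : nat -> K, D = \sum_(k < size (map (fun k => brk (e k)) (iota 0 m)))
    c k *: (map (fun k => brk (e k)) (iota 0 m))`_k.
Proof.
have E (c : nat -> K) : \sum_(k < size (map (fun k => brk (e k)) (iota 0 m)))
    c k *: (map (fun k => brk (e k)) (iota 0 m))`_k =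
    brk (\sum_(k < m) c k *: e k).
  rewrite size_map size_iota; apply/funext => v.
  rewrite (linear_map_sum (brk_linearl v)) fct_sumE; apply: eq_bigr => k _.
  by rewrite (nth_map 0%N) ?size_iota // nth_iota.
split=> [[u ->] | [c ->]]; last by rewrite E; eexists.
by exists (fun k => co k u : K); rewrite (E (fun k => co k u : K)) -(cb_expand tb).
Qed.

Definition ad_table (k : nat) : unknown -> F3 := fun u => coef (tab k u.1) u.2.

(** The rows enter as necessary conditions on a derivation, so [S] may be any list for which
    propagation succeeds. That the given maps are derivations is verified separately on all pairs of
    basis vectors. *)
Theorem H1_basis_check S (s : seq (L -> L)) (ds : seq (nat -> comb nat)) psi chi :
  size ds = size s ->
  (forall i, (i < size s)%N -> linear s`_i) ->
  (forall i j, (i < size s)%N -> s`_i (e j) = ev e (nth (fun=> [::]) ds i j)) ->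
  all (even_der_check m tab par) ds ->
  basis_check m (der_rows m tab par S)
    [seq (fun u => coef (d u.1) u.2) | d <- ds] (map ad_table (iota 0 m)) psi chi ->
  H1_basis s.
Proof.
move=> dss sl sd /allP dsok.
apply: (@basis_mod_check K charK _ (@derivation K L) (@inner_derivation K L)
  der_coord m _ _ _ _ s
  (map (fun k => brk (e k)) (iota 0 m))).
- by move=> u a D D'; exact: (cb_linear tb).
- exact: derivation_lin.
- exact: der_inj.
- exact: der_rowsP.
- by rewrite size_map.
- by rewrite !size_map.
- move=> i; rewrite nth_cat size_cat size_map size_iota; case: (ltnP i (size s)) => [si _|si im].
    apply: (even_derP (sl i si) (sd i ^~ si)).
    by apply: dsok; rewrite mem_nth ?dss.
  rewrite (nth_map 0%N) ?size_iota ?ltn_subLR //; exact: inner_basis_derivation.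
- move=> i u; rewrite !nth_cat size_cat !size_map size_iota dss.
  case: (ltnP i (size s)) => [si _|si im] u1 u2.
    by rewrite (nth_map (fun=> [::])) ?dss // /der_coord sd // (co_ev charK tb).
  rewrite !(nth_map 0%N) ?size_iota ?ltn_subLR //.
  by rewrite /der_coord (tb_brk tb) (co_ev charK tb).
- exact: inner_derivationP.
Qed.

End Cohomology.

(** * Cocycles and linear equations *)

(* With [q] the bracket, the two last hypotheses follow from the Jacobi identity;
   hence the identity for [x, [x, x]] only has to be checked on a basis. *)
Lemma cube_additive (U W V : zmodType) (q : U -> U -> W) (f : U -> W -> V) u v :
  (forall x, {morph q x : y z / y + z}) -> (forall x, {morph q^~ x : y z / y + z}) ->
  (forall x, {morph f x : y z / y + z}) -> (forall x, {morph f^~ x : y z / y + z}) ->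
  q v u = q u v ->
  f v (q u u) + (f u (q u v) + f u (q u v)) = 0 ->
  f u (q v v) + (f v (q v u) + f v (q v u)) = 0 ->
  f (u + v) (q (u + v) (u + v)) = f u (q u u) + f v (q v v).
Proof.
move=> qr ql fr fl vu; rewrite vu qr !ql vu !fr !fl => cu cv.
(* Of the eight terms of the expansion, the two bracketed groups of three are the cross terms killed
   by the hypotheses. *)
by rewrite !addrA [LHS](ACl (1*8*(2*(3*5))*(7*(4*6)))%AC) /= cu cv !addr0.
Qed.

Section Cocycles.
Variables (K : fieldType) (charK : 3%N \in [pchar K]) (L : lieSuperType K).
Variables (m : nat) (tab : nat -> nat -> comb nat) (par : nat -> bool).
Variables (e : nat -> L) (co : nat -> L -> K^o).
Hypothesis tb : table_basis m tab par e co.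
Implicit Types (w : L -> L -> K^o).

Definition formt (g : unknown -> F3) (u v : L) : K^o :=
  (\sum_(i < m) \sum_(j < m) (co i u : K) * (co j v : K) * f3 K (g (i : nat, j : nat)) : K).

Lemma formt_linearr g u : linear (formt g u).
Proof.
move=> a v w; rewrite /formt scaler_sumr -big_split; apply: eq_bigr => i _ /=.
rewrite scaler_sumr -big_split; apply: eq_bigr => j _ /=.
by rewrite (cb_linear tb) mulrDr mulrDl /GRing.scale /= !mulrA [_ * a]mulrC.
Qed.

Lemma formt_linearl g v : linear (formt g ^~ v).
Proof.
move=> a u w; rewrite /formt scaler_sumr -big_split; apply: eq_bigr => i _ /=.
rewrite scaler_sumr -big_split; apply: eq_bigr => j _ /=.
by rewrite (cb_linear tb) !mulrDl /GRing.scale /= !mulrA.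
Qed.

Lemma formt_basis g i j : (forall u, ~~ ((u.1 < m)%N && (u.2 < m)%N) -> g u = None) ->
  formt g (e i) (e j) = f3 K (g (i, j)).
Proof.
move=> g0; have [im | mi] := ltnP i m; last first.
  rewrite (basis_out tb mi) g0 /= ?[(i < m)%N]ltnNge ?mi //.
  exact: (linear_map0 (formt_linearl g (e j))).
have [jm | mj] := ltnP j m; last first.
  rewrite (basis_out tb mj) g0 /= ?[(j < m)%N]ltnNge ?mj ?andbF //.
  exact: (linear_map0 (formt_linearr g (e i))).
rewrite /formt (bigD1 (Ordinal im)) //= (bigD1 (Ordinal jm)) //=.
rewrite !(cb_dual tb) !eqxx im jm !mul1r !big1 ?addr0 // => [k ki|k kj].
  rewrite big1 // => l _; rewrite (cb_dual tb).
  by case: eqP => [kE|]; [case/eqP: ki; apply: val_inj | rewrite /= mulr0n !mul0r].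
rewrite (cb_dual tb).
by case: eqP => [kE|]; [case/eqP: kj; apply: val_inj | rewrite /= mulr0n mulr0 mul0r].
Qed.

Definition form_coord w (u : unknown) : K^o := w (e u.1) (e u.2).

Section CocycleOfForm.
Variable w : L -> L -> K^o.
Hypotheses (wr : forall u, linear (w u)) (wl : forall v, linear (w^~ v)).

Lemma form_evl r k :
  ev (form_coord w) [seq (t.1, (t.2, k)) | t <- r] = w (ev e r) (e k).
Proof. by rewrite (ev_linear _ _ (wl (e k))) /ev big_map. Qed.

Lemma form_evr i r :
  ev (form_coord w) [seq (t.1, (i, t.2)) | t <- r] = w (e i) (ev e r).
Proof. by rewrite (ev_linear _ _ (wr (e i))) /ev big_map. Qed.

Lemma coc_rowE i j k : ev (form_coord w) (coc_row tab par i j k) =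
  w ⁅e i, e j⁆ (e k) -
  (w (e i) ⁅e j, e k⁆ - (-1) ^+ (par i && par j) * w (e j) ⁅e i, e k⁆).
Proof.
rewrite /coc_row !ev_cat !ev_scale form_evl !form_evr !(tb_brk tb) /= expr1 scaleN1r.
by rewrite opprB addrA addrAC -addrA.
Qed.

Lemma skew_rowE i j : ev (form_coord w) (skew_row par i j) =
  w (e i) (e j) + (-1) ^+ (par i && par j) * w (e j) (e i).
Proof. by rewrite /skew_row !ev_cons ev_nil addr0 /= expr0 scale1r. Qed.

(** The first two identities extend from the basis by linearity in each argument; the third is cubic
    and extends by polarization. *)
Lemma cocycle_of_form g : (forall i j, w (e i) (e j) = f3 K (g (i, j))) ->
  coc_check m tab par g -> cocycle2 w.
Proof.
move=> wE /andP[/allP rows_ok /allP cube_ok].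
have dot r : cdot r g == None -> ev (form_coord w) r = 0.
  move=> /eqP r0; transitivity (f3 K (cdot r g)); last by rewrite r0.
  by rewrite -(ev_dot charK); apply: eq_ev => -[i j]; exact: wE.
have row0 r : r \in coc_rows m tab par (iota 0 m) -> ev (form_coord w) r = 0.
  by move/rows_ok/dot.
have mem_sq i j : (i < m)%N -> (j < m)%N -> (i, j) \in square m.
  by rewrite mem_square => -> ->.
have wskew b c u v : homog b u -> homog c v -> w u v = - (-1) ^+ (b && c) * w v u.
  move=> hu hv; move: v hv; apply: (homog_ind tb (P := fun v => w u v = _ * w v u)).
  - by rewrite (linear_map0 (wr u)) (linear_map0 (wl u)) mulr0.
  - move=> a v1 v2 IH1 IH2; rewrite (wr u) (wl u) IH1 IH2 mulrDr /GRing.scale /=.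
    by rewrite mulrCA.
  move=> j jm <-; move: u hu.
  apply: (homog_ind tb (P := fun u => w u (e j) = _ * w (e j) u)).
  - by rewrite (linear_map0 (wr _)) (linear_map0 (wl _)) mulr0.
  - move=> a v1 v2 IH1 IH2; rewrite (wr _) (wl _) IH1 IH2 mulrDr /GRing.scale /=.
    by rewrite mulrCA.
  move=> i im <-; apply/eqP; rewrite mulNr -addr_eq0; apply/eqP.
  rewrite -skew_rowE; apply: row0; rewrite mem_cat; apply/orP; left.
  by apply/mapP; exists (i, j) => //; exact: mem_sq.
have wcoc b c u v z : homog b u -> homog c v ->
    w ⁅u, v⁆ z = w u ⁅v, z⁆ - (-1) ^+ (b && c) * w v ⁅u, z⁆.
  move=> hu hv; apply/eqP; rewrite -subr_eq0; apply/eqP.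
  move: v hv; apply: (homog_ind tb (P := fun v => w ⁅u, v⁆ z -
      (w u ⁅v, z⁆ - (-1) ^+ (b && c) * w v ⁅u, z⁆) = 0)).
  - by rewrite brk0l brk0r (linear_map0 (wr u)) !(linear_map0 (wl _)) mulr0 !subr0.
  - move=> a v1 v2 /eqP; rewrite subr_eq0 => /eqP IH1 /eqP; rewrite subr_eq0 => /eqP IH2.
    rewrite brk_linearr brk_linearl (wr u) !(wl _) IH1 IH2; apply/eqP.
    rewrite subr_eq0 mulrDr /GRing.scale /= mulrBr opprD addrACA.
    by rewrite [a * (_ * _)]mulrCA.
  move=> j jm <-; move: u hu; apply: (homog_ind tb (P := fun u => w ⁅u, e j⁆ z -
      (w u ⁅e j, z⁆ - (-1) ^+ (b && par j) * w (e j) ⁅u, z⁆) = 0)).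
  - by rewrite !brk0l (linear_map0 (wr _)) !(linear_map0 (wl _)) mulr0 !subr0.
  - move=> a v1 v2 /eqP; rewrite subr_eq0 => /eqP IH1 /eqP; rewrite subr_eq0 => /eqP IH2.
    rewrite !brk_linearl (wr _) !(wl _) IH1 IH2; apply/eqP.
    rewrite subr_eq0 mulrDr /GRing.scale /= mulrBr opprD addrACA.
    by rewrite [a * (_ * _)]mulrCA.
  move=> i im <-; apply: (linear_ext tb (f := fun z => _ - (_ - _ * _)) (g := fun=> 0)) z.
  - move=> a z1 z2 /=; rewrite !brk_linearr !(wr _).
    have E (x1 x2 y1 y2 z1' z2' t : K) : a * x1 + x2 - (a * y1 + y2 - t * (a * z1' + z2')) =
      a * (x1 - (y1 - t * z1')) + (x2 - (y2 - t * z2')) by ring.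
    exact: E.
  - by move=> a ? ?; rewrite scaler0 addr0.
  move=> k km; rewrite -coc_rowE; apply: row0; rewrite mem_cat; apply/orP; right.
  apply/allpairsP; exists (i, (j, k)); split=> //=; last exact: mem_sq.
  by rewrite mem_iota.
split=> //; split=> //; split=> // u.
have odd_skew x y : homog true x -> homog true y -> ⁅y, x⁆ = ⁅x, y⁆ :> L.
  by move=> hx hy; rewrite (brk_skew hy hx) /= expr1 opprK scale1r.
(* The cocycle identity for x, x, y gives w([x, x], y) = 2 w(x, [x, y]), and w(y, [x, x]) is the
   negative of its left side, [x, x] being even. *)
have cross x y : homog true x -> homog true y ->
    w y ⁅x, x⁆ + (w x ⁅x, y⁆ + w x ⁅x, y⁆) = 0.
  move=> hx hy; have := wcoc _ _ _ _ y hx hx; rewrite /= expr1 mulN1r opprK => <-.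
  rewrite (wskew true false _ _ hy (brk_part hx hx)) /= expr0 mulN1r.
  exact: addNr.
(* Oddness is carried through the induction because the cross terms cancel only for odd
   arguments. *)
move=> hu; suff [] : homog true u /\ w u ⁅u, u⁆ = 0 by [].
apply: (homog_ind tb (P := fun u => homog true u /\ w u ⁅u, u⁆ = 0)) hu.
- by rewrite /homog part0 (linear_map0 (wl _)).
- move=> a x y [hx wx] [hy wy].
  have hax : homog true (a *: x) by rewrite /homog partZ hx.
  split; first by rewrite /homog partD hax hy.
  rewrite (cube_additive (q := brk) (f := w)) //.
  + rewrite wy addr0 brkZl brkZr; have := wl (a *: (a *: ⁅x, x⁆)) a x 0.
    rewrite addr0 (linear_map0 (wl _)) addr0 => ->.
    have := wr x a (a *: ⁅x, x⁆) 0; rewrite addr0 (linear_map0 (wr _)) addr0 => ->.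
    have := wr x a ⁅x, x⁆ 0; rewrite addr0 (linear_map0 (wr _)) addr0 => ->.
    by rewrite wx !scaler0.
  + by move=> ? ? ?; exact: brkDr.
  + by move=> ? ? ?; exact: brkDl.
  + by move=> z x1 x2; have := wr z 1 x1 x2; rewrite !scale1r.
  + by move=> z x1 x2; have := wl z 1 x1 x2; rewrite !scale1r.
  + exact: odd_skew.
  + exact: cross.
  exact: cross.
move=> i im pi; split; first by rewrite -pi; exact: (tb_homog tb).
rewrite (tb_brk tb) -form_evr; apply: dot.
by have := cube_ok i; rewrite mem_iota pi => /(_ im).
Qed.
End CocycleOfForm.

Lemma coc_rowsP S w r : cocycle2 w -> r \in coc_rows m tab par S ->
  ev (form_coord w) r = 0.
Proof.
move=> [wr [wl [wskew wcoc _]]]; rewrite mem_cat => /orP[/mapP[u _ ->]|].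
  rewrite skew_rowE (wskew _ _ _ _ (tb_homog tb u.1) (tb_homog tb u.2)) mulNr.
  exact: addNr.
move=> /allpairsP[[i u] /= [_ _ ->]].
rewrite (coc_rowE wr wl) (wcoc _ _ _ _ _ (tb_homog tb i) (tb_homog tb u.1)).
exact: subrr.
Qed.

Lemma cocycle_lin a w w' : cocycle2 w -> cocycle2 w' -> cocycle2 (a *: w + w').
Proof.
move=> [r1 [l1 [s1 c1 q1]]] [r2 [l2 [s2 c2 q2]]].
have E u v : (a *: w + w') u v = a *: w u v + w' u v by [].
split=> [u b v z|]; last split=> [v b u z|].
- by rewrite !E r1 r2 !scalerDr !scalerA [b * a]mulrC addrACA.
- by rewrite !E l1 l2 !scalerDr !scalerA [b * a]mulrC addrACA.
split=> [b c u v hu hv|b c u v z hu hv|u hu]; rewrite !E.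
- by rewrite (s1 _ _ _ _ hu hv) (s2 _ _ _ _ hu hv) mulrDr /GRing.scale /= mulrCA.
- rewrite (c1 _ _ _ _ _ hu hv) (c2 _ _ _ _ _ hu hv) mulrDr /GRing.scale /= mulrBr.
  by rewrite opprD addrACA [a * (_ * _)]mulrCA.
by rewrite q1 // q2 // scaler0 addr0.
Qed.

Lemma cocycle_inj w : cocycle2 w ->
  (forall u, (u.1 < m)%N -> (u.2 < m)%N -> form_coord w u = 0) -> w = 0.
Proof.
move=> [wr [wl _]] w0; apply/funext => u; apply/funext => v.
apply: (bilinear_ext tb wr wl (g := fun _ _ => 0)) => [x a y z|x a y z|i j im jm].
- by rewrite scaler0 addr0.
- by rewrite scaler0 addr0.
exact: (w0 (i, j)).
Qed.

Lemma coboundary_cocycle w : @coboundary2 K L w -> cocycle2 w.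
Proof.
move=> [f fl ->]; have fZ a u : f (a *: u) = a * f u.
  by have := fl a u 0; rewrite addr0 (linear_map0 fl) addr0.
split=> [u a v z|]; first by rewrite brk_linearr fl.
split=> [v a u z|]; first by rewrite brk_linearl fl.
split=> [b c u v hu hv|b c u v z hu hv|u hu].
- by rewrite (brk_skew hu hv) fZ.
- rewrite (brk_jacobi z hu hv) -fZ; apply/eqP; rewrite eq_sym subr_eq; apply/eqP.
  by have := fl 1 ⁅⁅u, v⁆, z⁆ ((-1) ^+ (b && c) *: ⁅v, ⁅u, z⁆⁆); rewrite !scale1r.
by rewrite (brk_cube hu) (linear_map0 fl).
Qed.

Definition cob k : L -> L -> K^o := fun u v => co k ⁅u, v⁆.

Lemma coboundary2P w : coboundary2 w <->
  exists c : nat -> K, w = \sum_(k < size (map cob (iota 0 m)))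
    c k *: (map cob (iota 0 m))`_k.
Proof.
have E (c : nat -> K) : \sum_(k < size (map cob (iota 0 m)))
    c k *: (map cob (iota 0 m))`_k =
    fun u v => \sum_(k < m) c k * co k ⁅u, v⁆.
  rewrite size_map size_iota; apply/funext => u; apply/funext => v.
  rewrite !fct_sumE; apply: eq_bigr => k _.
  by rewrite (nth_map 0%N) ?size_iota // nth_iota.
split=> [[f fl ->] | [c ->]].
  exists (fun k => f (e k)); rewrite (E (fun k => f (e k))).
  apply/funext => u; apply/funext => v; rewrite {1}(cb_expand tb ⁅u, v⁆) (linear_map_sum fl).
  by apply: eq_bigr => k _; rewrite mulrC.
exists (fun u => \sum_(k < m) c k * co k u); last exact: E.
move=> a u v; rewrite scaler_sumr -big_split; apply: eq_bigr => k _ /=.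
by rewrite (cb_linear tb) mulrDr /GRing.scale /= mulrCA.
Qed.

Definition cob_table (k : nat) : unknown -> F3 := fun u => coef (tab u.1 u.2) k.

Theorem H2_basis_check S (s : seq (L -> L -> K^o)) (gs : seq (unknown -> F3)) psi chi :
  size gs = size s ->
  (forall i u, (i < size s)%N -> linear (s`_i u)) ->
  (forall i v, (i < size s)%N -> linear (s`_i ^~ v)) ->
  (forall k i j, (k < size s)%N -> s`_k (e i) (e j) = f3 K (nth (fun=> None) gs k (i, j))) ->
  all (coc_check m tab par) gs ->
  basis_check m (coc_rows m tab par S) gs (map cob_table (iota 0 m)) psi chi ->
  H2_basis s.
Proof.
move=> gss sr sl sg /allP gsok.
apply: (@basis_mod_check K charK _ (@cocycle2 K L) (@coboundary2 K L)
  form_coord m _ _ _ _ s (map cob (iota 0 m))).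
- by [].
- exact: cocycle_lin.
- exact: cocycle_inj.
- by move=> w r; exact: coc_rowsP.
- by [].
- by rewrite !size_map.
- move=> i; rewrite nth_cat size_cat size_map size_iota.
  case: (ltnP i (size s)) => [si _|si im].
    apply: (cocycle_of_form (sr i ^~ si) (sl i ^~ si) (fun k j => sg i k j si)).
    by apply: gsok; rewrite mem_nth ?gss.
  rewrite (nth_map 0%N) ?size_iota ?ltn_subLR //; apply: coboundary_cocycle.
  by exists (co (nth 0%N (iota 0 m) (i - size s))) => //; exact: (cb_linear tb).
- move=> i u; rewrite !nth_cat size_cat !size_map size_iota gss.
  case: (ltnP i (size s)) => [si _|si im] u1 u2; first by case: u {u1 u2} => k j; exact: sg.
  have im' : (i - size s < m)%N by rewrite ltn_subLR.
  rewrite !(nth_map 0%N) ?size_iota // nth_iota //.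
  by rewrite /form_coord /cob (tb_brk tb) (co_ev charK tb).
- exact: coboundary2P.
Qed.

End Cocycles.

(** * The table of g(2,3) *)

(* Basis elements of g(2,3) are numbered as follows: 0, ..., 10 are the x_k,
   11, ..., 21 the y_k, and 22, 23, 24, 25 are h_1, h_3, h_2, D, where the
   simple roots take the values 1, -1, 0 on D.  The first 24 give a basis of bj. *)
Definition pos_roots : seq (seq nat) :=
  [:: [:: 1; 0; 0]; [:: 0; 1; 0]; [:: 0; 0; 1]; [:: 1; 1; 0]; [:: 1; 0; 1];
      [:: 0; 1; 1]; [:: 1; 1; 1]; [:: 2; 1; 1]; [:: 1; 2; 1]; [:: 2; 2; 1];
      [:: 2; 2; 2]]%N.

(** From 22 on, [i - 11] runs past the end of [pos_roots], so the Cartan elements get degree 0. *)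
Definition rdeg (i c : nat) : int :=
  if (i < 11)%N then (nth 0 (nth [::] pos_roots i) c)%N%:Z
  else - (nth 0 (nth [::] pos_roots (i - 11)) c)%N%:Z.

Definition g_par (i : nat) : bool := odd `|rdeg i 2|.

Definition f3_of_int (a : int) : F3 :=
  nth None [:: None; Some false; Some true] `|(a %% 3)%Z|.

(** Modulo 3 the simple roots take the values -1, -1, -1 on h_1 and on h_2, and -1, -1, 0 on h_3. *)
Definition root_weight (k i : nat) : F3 :=
  let n := rdeg i in
  f3_of_int (nth 0 [:: - (n 0%N + n 1%N + n 2); - (n 0%N + n 1%N);
                       - (n 0%N + n 1%N + n 2); n 0%N - n 1%N] k).

Definition bracket_data := seq (nat * nat * seq (bool * nat)).

(* The nonzero [x_i, x_j], resp. [x_i, y_j], with i <= j; [(b, k)] stands for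
   (-1)^b times the basis element k.  The other brackets are obtained by means of
   skew symmetry and theta. *)
Definition xx_bracket_data : bracket_data :=
  [:: (0, 1, [:: (false, 3)]); (0, 2, [:: (false, 4)]);
      (0, 5, [:: (false, 6)]); (0, 6, [:: (true, 7)]);
      (0, 8, [:: (false, 9)]); (1, 2, [:: (false, 5)]);
      (1, 4, [:: (true, 6)]); (1, 6, [:: (true, 8)]); (1, 7, [:: (true, 9)]);
      (2, 3, [:: (false, 6)]); (2, 9, [:: (false, 10)]);
      (3, 4, [:: (false, 7)]); (3, 5, [:: (false, 8)]);
      (3, 6, [:: (false, 9)]); (4, 8, [:: (true, 10)]);
      (5, 7, [:: (false, 10)]); (6, 6, [:: (false, 10)])].
Definition xy_bracket_data : bracket_data :=
  [:: (0, 0, [:: (false, 22)]); (0, 3, [:: (false, 12)]);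
      (0, 4, [:: (false, 13)]); (0, 6, [:: (true, 16)]);
      (0, 7, [:: (false, 17)]); (0, 9, [:: (false, 19)]);
      (1, 1, [:: (false, 24)]); (1, 3, [:: (true, 11)]);
      (1, 5, [:: (false, 13)]); (1, 6, [:: (false, 15)]);
      (1, 8, [:: (false, 17)]); (1, 9, [:: (true, 18)]);
      (2, 2, [:: (false, 23)]); (2, 4, [:: (true, 11)]);
      (2, 5, [:: (true, 12)]); (2, 6, [:: (true, 14)]);
      (2, 10, [:: (false, 20)]); (3, 3, [:: (true, 22); (true, 24)]);
      (3, 6, [:: (true, 13)]); (3, 7, [:: (true, 15)]);
      (3, 8, [:: (true, 16)]); (3, 9, [:: (false, 17)]);
      (4, 4, [:: (true, 22); (true, 23)]); (4, 6, [:: (false, 12)]);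
      (4, 7, [:: (false, 14)]); (4, 10, [:: (false, 19)]);
      (5, 5, [:: (true, 23); (true, 24)]); (5, 6, [:: (true, 11)]);
      (5, 8, [:: (false, 14)]); (5, 10, [:: (true, 18)]);
      (6, 6, [:: (true, 22); (true, 23); (true, 24)]);
      (6, 7, [:: (false, 11)]); (6, 8, [:: (false, 12)]);
      (6, 9, [:: (true, 14)]); (6, 10, [:: (true, 17)]);
      (7, 7, [:: (false, 22); (true, 23); (true, 24)]);
      (7, 9, [:: (true, 12)]); (7, 10, [:: (true, 16)]);
      (8, 8, [:: (true, 22); (true, 23); (false, 24)]);
      (8, 9, [:: (false, 11)]); (8, 10, [:: (false, 15)]);
      (9, 9, [:: (true, 22); (false, 23); (true, 24)]);
      (9, 10, [:: (false, 13)]);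
      (10, 10, [:: (true, 22); (true, 23); (true, 24)])].

Definition lookup (s : bracket_data) (i j : nat) : comb nat :=
  flatten [seq [seq (Some t.1, t.2) | t <- d.2] | d <- s & d.1 == (i, j)].

Definition brk_xx i j : comb nat :=
  if (i <= j)%N then lookup xx_bracket_data i j
  else csign (~~ (g_par i && g_par j)) (lookup xx_bracket_data j i).

(** As the y_k are given by the same expressions as the x_k, x_k goes to y_k for all eleven k, not
    just for the generators; h_i goes to -h_i. *)
Definition theta (i : nat) : comb nat :=
  if (i < 11)%N then [:: (Some false, i + 11)%N]
  else if (i < 22)%N then [:: (Some (g_par i), i - 11)%N]
  else if (i < 25)%N then [:: (Some true, i)] else [::].

Definition brk_xy i j : comb nat :=
  if (i <= j)%N then lookup xy_bracket_data i j
  (* Applying theta to [x_j, y_i] gives (-1)^(p_i) [y_j, x_i], and skew symmetry turns this into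
     -(-1)^(p_i + p_i p_j) [x_i, y_j]. *)
  else csign (~~ (g_par i && ~~ g_par j)) (cbind (lookup xy_bracket_data j i) theta).

Definition g_brk (i j : nat) : comb nat :=
  let hx k i := if root_weight k i is Some s then [:: (Some s, i)] else [::] in
  if (j < 11)%N then
    if (i < 11)%N then brk_xx i j
    else if (i < 22)%N then csign (~~ (g_par i && g_par j)) (brk_xy j (i - 11))
    else hx (i - 22)%N j
  else if (j < 22)%N then
    if (i < 11)%N then brk_xy i (j - 11)
    else if (i < 22)%N then [seq (t.1, t.2 + 11)%N | t <- brk_xx (i - 11) (j - 11)]
    else hx (i - 22)%N j
  else if (i < 22)%N then csign true (hx (j - 22)%N i) else [::].

(** Evaluated once and for all, so that the checks only look up entries. *)
Definition g_rows : seq (seq (comb nat)) :=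
  Eval vm_compute in mkseq (fun i => mkseq (g_brk i) 26) 26.

Definition g_tab (i j : nat) : comb nat := nth [::] (nth [::] g_rows i) j.

Definition lie_check m (tab : nat -> nat -> comb nat) (par : nat -> bool) : bool :=
  all (fun i => all (fun j =>
    [&& all (fun t => (t.2 < m)%N && (par t.2 == par i (+) par j)) (tab i j),
        ceq (tab i j) (csign (~~ (par i && par j)) (tab j i)) &
        all (fun k => ceq (cbind (tab j k) (tab i))
          (cbind (tab i j) (tab^~ k) ++
           csign (par i && par j) (cbind (tab i k) (tab j)))) (iota 0 m)])
    (iota 0 m) && (~~ par i || ceq (cbind (tab i i) (tab i)) [::])) (iota 0 m).

Lemma g_lie_check : lie_check 26 g_tab g_par.
Proof. by vm_compute. Qed.

(** * The four cohomology spaces over the prime field *)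

(** Factoring out the central element h_1 - h_2 renames h_2, number 24, into h_1, number 22. *)
Definition bj_rows : seq (seq (comb nat)) :=
  Eval vm_compute in mkseq (fun i => mkseq (fun j =>
    [seq (t.1, if t.2 == 24 then 22 else t.2) | t <- g_tab i j]) 24) 24.

Definition bj_tab (i j : nat) : comb nat := nth [::] (nth [::] bj_rows i) j.

(** On h_1 a root equals minus its height modulo 3, so it vanishes there just for x_7, x_11, y_7 and
    y_11; these roots do not vanish on h_3. *)
Definition root_chi (gb : nat -> unknown -> F3) (k : nat) : comb unknown :=
  if gb k (22, k)%N is Some s then [:: (Some s, (22, k)%N)]
  else [:: (gb k (23, k)%N, (23, k)%N)].

Definition pos_ridx (r : ridx) : nat := r.2.-1 + 11 * r.1.

(** The tables of the statement are polymorphic in the field; their instances over ['F_3] can be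
    evaluated and turned into data for the checks. *)
Definition f3_of_F3 (a : 'F_3) : F3 :=
  match val a with 0%N => None | 1%N => Some false | _ => Some true end.

Definition f3_entries (t : seq ('F_3 * ridx * ridx)) : seq (F3 * ridx * ridx) :=
  [seq (f3_of_F3 e.1.1, e.1.2, e.2) | e <- t].

Definition map_rows (t : seq (F3 * ridx * ridx)) : seq (comb nat) :=
  mkseq (fun i => [seq (e.1.1, pos_ridx e.2) | e <- t & pos_ridx e.1.2 == i]) 24.

Definition form_rows (t : seq (F3 * ridx * ridx)) : seq (seq F3) :=
  let f (e : F3 * ridx * ridx) i j :=
    f3add (if (pos_ridx e.1.2 == i) && (pos_ridx e.2 == j) then e.1.1 else None)
      (if (pos_ridx e.1.2 == j) && (pos_ridx e.2 == i)
       then f3mul (Some (~~ (g_par i && g_par j))) e.1.1 else None) in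
  mkseq (fun i => mkseq (fun j => foldr (fun e => f3add (f e i j)) None t) 24) 24.

Definition theta_inv (i : nat) : comb nat :=
  if (i < 11)%N then [:: (Some (g_par i), i + 11)%N]
  else if (i < 22)%N then [:: (Some false, i - 11)%N]
  else [:: (Some true, i)].

Definition conj_rows (d : seq (comb nat)) : seq (comb nat) :=
  mkseq (fun i => cnorm (cbind (cbind (theta_inv i) (nth [::] d)) theta)) 24.

Definition form_nth (g : seq (seq F3)) (u : unknown) : F3 :=
  nth None (nth [::] g u.1) u.2.

Definition pullback_rows (g : seq (seq F3)) : seq (seq F3) :=
  mkseq (fun i => mkseq (fun j =>
    cdot [seq (f3mul s.1 t.1, (s.2, t.2)) | s <- theta i, t <- theta j] (form_nth g)) 24) 24.

Definition bj_ders : seq (seq (comb nat)) :=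
  Eval vm_compute in
    let d31 := map_rows (f3_entries (D3_1 'F_3)) in
    let d32 := map_rows (f3_entries (D3_2 'F_3)) in
    [:: d31; d32; conj_rows d31; conj_rows d32;
        map_rows (f3_entries (D0_1 'F_3)); map_rows (f3_entries (D0_2 'F_3));
        map_rows (f3_entries (D0_3 'F_3))].

Definition bj_forms : seq (seq (seq F3)) :=
  Eval vm_compute in
    let c31 := form_rows (f3_entries (c3_1 'F_3)) in
    let c32 := form_rows (f3_entries (c3_2 'F_3)) in
    [:: c31; c32; pullback_rows c31; pullback_rows c32;
        form_rows (f3_entries (c0_1 'F_3)); form_rows (f3_entries (c0_2 'F_3));
        form_rows (f3_entries (c0_3 'F_3))].

Local Notation pl u := (Some false, u%N).
Local Notation mi u := (Some true, u%N).

Definition outer_rows : seq (comb nat) := rcons (nseq 25 [::]) [:: mi 22; pl 24].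

(* In the next four checks the equations involving one of the h_i, D or the
   generators are enough.  On ad x, resp. on the coboundary of the dual basis
   vector of x, for a root vector x, it is the entry with index h_1 or h_3 and x
   that does not vanish; the entries with equal indices (resp. with the indices of
   x_i and y_i) separate the remaining classes of degree 0. *)
Lemma g_der_check : basis_check 26
  (der_rows 26 g_tab g_par [:: 22; 23; 25; 0; 1; 2; 11; 12; 13]%N)
  [:: fun u => coef (nth [::] outer_rows u.1) u.2]
  (map (ad_table g_tab) (iota 0 26))
  [:: [:: mi (25, 22)]]
  ([seq root_chi (ad_table g_tab) k | k <- iota 0 22] ++
   (* These combinations of diagonal entries are dual to ad h_1, ad h_3 and ad D; the empty one
      belongs to h_2, since ad h_2 = ad h_1. *)
   [:: [:: mi (2, 2)]; [:: pl (0, 0); pl (1, 1); pl (2, 2)]; [::];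
       [:: mi (0, 0); pl (1, 1)]]).
Proof. by vm_compute. Qed.

Lemma g_coc_check : basis_check 26
  (coc_rows 26 g_tab g_par [:: 0; 1; 2; 11; 12; 13]%N)
  [::] (map (cob_table g_tab) (iota 0 26))
  [::]
  ([seq root_chi (cob_table g_tab) k | k <- iota 0 22] ++
   (* The last functional is empty because D occurs in no bracket, so that the coboundary of its
      dual vector is 0. *)
   [:: [:: pl (0, 11)]; [:: pl (2, 13)]; [:: pl (1, 12)]; [::]]).
Proof. by vm_compute. Qed.

Lemma bj_der_check : basis_check 24
  (der_rows 24 bj_tab g_par [:: 22; 23; 0; 1; 2; 11; 12; 13]%N)
  [seq (fun u => coef (d u.1) u.2) | d <- map (nth [::]) bj_ders]
  (map (ad_table bj_tab) (iota 0 24))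
  [:: [:: pl (0, 14)]; [:: mi (1, 14)]; [:: pl (11, 3)]; [:: mi (12, 3)];
      (* D_0^2 is detected by the difference of the eigenvalues on x_2 and x_1, which vanishes for
         ad h_1 and ad h_3; a single entry suffices for each of the other six classes. *)
      [:: pl (0, 1)]; [:: mi (0, 0); pl (1, 1)]; [:: pl (1, 0)]]
  ([seq root_chi (ad_table bj_tab) k | k <- iota 0 22] ++
   [:: [:: mi (2, 2)]; [:: pl (0, 0); pl (1, 1); pl (2, 2)]]).
Proof. by vm_compute. Qed.

Lemma bj_coc_check : basis_check 24
  (coc_rows 24 bj_tab g_par [:: 0; 1; 2; 11; 12; 13]%N)
  (map form_nth bj_forms) (map (cob_table bj_tab) (iota 0 24))
  [:: [:: mi (0, 3)]; [:: pl (1, 3)]; [:: mi (11, 14)]; [:: pl (12, 14)];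
      [:: mi (0, 12)]; [:: pl (0, 11); mi (1, 12)]; [:: pl (1, 11)]]
  ([seq root_chi (cob_table bj_tab) k | k <- iota 0 22] ++
   [:: [:: mi (0, 11); mi (1, 12)]; [:: pl (2, 13)]]).
Proof. by vm_compute. Qed.

Lemma bj_even_der_check : all (even_der_check 24 bj_tab g_par) (map (nth [::]) bj_ders).
Proof. by vm_compute. Qed.

Lemma bj_forms_check : all (coc_check 24 bj_tab g_par) (map form_nth bj_forms).
Proof. by vm_compute. Qed.

(** * A model of g(2,3) *)

Lemma lie_checkP m tab par i : lie_check m tab par -> (i < m)%N ->
  [/\ forall j, (j < m)%N -> all (fun t => (t.2 < m)%N && (par t.2 == par i (+) par j)) (tab i j),
      forall j, (j < m)%N -> ceq (tab i j) (csign (~~ (par i && par j)) (tab j i)),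
      forall j k, (j < m)%N -> (k < m)%N -> ceq (cbind (tab j k) (tab i))
          (cbind (tab i j) (tab^~ k) ++ csign (par i && par j) (cbind (tab i k) (tab j))) &
      par i -> ceq (cbind (tab i i) (tab i)) [::]].
Proof.
move=> /allP/(_ i); rewrite mem_iota => /[apply] /andP[/allP ok cube].
have H j : (j < m)%N -> j \in iota 0 m by rewrite mem_iota.
split=> [j /H/ok/and3P[]|j /H/ok/and3P[]|j k /H/ok/and3P[_ _ /allP jac] /H/jac|pi] //.
by move: cube; rewrite pi.
Qed.

Lemma g_tab_out i j : ~~ ((i < 26)%N && (j < 26)%N) -> g_tab i j = [::].
Proof.
rewrite /g_tab negb_and -!leqNgt => ij; have [iM|iM] := leqP 26 i.
  by rewrite [nth [::] g_rows i]nth_default ?nth_nil.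
rewrite nth_default //; move: ij; rewrite leqNgt iM /=; apply: leq_trans.
have /allP/(_ i) : all (fun i => size (nth [::] g_rows i) <= 26)%N (iota 0 26) by [].
by rewrite mem_iota; apply.
Qed.

Section Model.
Variables (K : fieldType) (charK : 3%N \in [pchar K]).

(** The hypothesis on the characteristic is an argument of the type because the Lie superalgebra
    structure attached to it depends on that hypothesis. *)
Definition model of 3%N \in [pchar K] := 'rV[K]_26.
Local Notation M := (model charK).
HB.instance Definition _ := GRing.Lmodule.on M.
Implicit Types (u v w : M) (i j k : nat).

Definition model_e i : M := if (i < 26)%N then delta_mx 0 (inord i) else 0.
Definition model_co i u : K^o := if (i < 26)%N then (u : 'rV__) 0 (inord i) else 0.
Local Notation e := model_e.
Local Notation co := model_co.

Lemma model_coord : coord_system 26 e co.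
Proof.
split=> [i a u v|u|i j]; rewrite /co.
- by case: ifP => _; rewrite ?mxE // scaler0 addr0.
- apply/rowP => k; rewrite summxE (bigD1 k) //= ltn_ord mxE /e ltn_ord mxE inord_val !eqxx /=.
  rewrite mulr1 big1 ?addr0 // => i ik; rewrite (ltn_ord i) inord_val.
  by rewrite !mxE eqxx eq_sym (negbTE ik) mulr0.
rewrite /e; case: ltnP => im; rewrite ?andbF // andbT; case: ltnP => jm.
  rewrite mxE eqxx /= -val_eqE /= !inordK //.
by rewrite mxE ltn_eqF // (leq_trans im).
Qed.
Let cb := model_coord.

Definition model_part (b : bool) u : M := \row_k (if b == g_par k then (u : 'rV__) 0 k else 0).
Definition model_brk u v : M :=
  \sum_(i < 26) \sum_(j < 26) ((co i u : K) * (co j v : K)) *: ev e (g_tab i j).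
Local Notation brk := model_brk.

Lemma model_part_linear b : linear (model_part b).
Proof.
move=> a u v; apply/rowP => k; rewrite !mxE.
by case: ifP; rewrite ?mulr0 ?addr0.
Qed.
Lemma model_part_add u : model_part false u + model_part true u = u.
Proof. by apply/rowP => k; rewrite !mxE; case: (g_par k); rewrite ?addr0 ?add0r. Qed.
Lemma model_part_part b c u :
  model_part b (model_part c u) = if b == c then model_part c u else 0.
Proof.
case: eqP => [<-|bc]; apply/rowP => k; rewrite !mxE; first by case: (b == _).
by case: eqP => // bk; case: eqP => // ck; case: bc; rewrite bk ck.
Qed.

Lemma model_brk_linearl v : linear (brk^~ v).
Proof.
move=> a u w; rewrite /brk scaler_sumr -big_split; apply: eq_bigr => i _ /=.
rewrite scaler_sumr -big_split; apply: eq_bigr => j _ /=.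
by rewrite (cb_linear cb) mulrDl scalerDl scalerA mulrA.
Qed.
Lemma model_brk_linearr u : linear (brk u).
Proof.
move=> a v w; rewrite /brk scaler_sumr -big_split; apply: eq_bigr => i _ /=.
rewrite scaler_sumr -big_split; apply: eq_bigr => j _ /=.
by rewrite (cb_linear cb) mulrDr scalerDl scalerA mulrCA.
Qed.
Let brkr := model_brk_linearr.
Let brkl := model_brk_linearl.

Lemma model_brk_basis i j : brk (e i) (e j) = ev e (g_tab i j).
Proof.
have [im | mi] := ltnP i 26; last first.
  by rewrite (basis_out cb mi) (linear_map0 (brkl _)) g_tab_out ?ev_nil // [(i < _)%N]ltnNge mi.
have [jm | mj] := ltnP j 26; last first.
  by rewrite (basis_out cb mj) (linear_map0 (brkr _)) g_tab_out ?ev_nil // [(j < _)%N]ltnNge mj andbF.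
rewrite /brk (bigD1 (Ordinal im)) //= (bigD1 (Ordinal jm)) //=.
rewrite !(cb_dual cb) !eqxx im jm !mul1r scale1r !big1 ?addr0 // => [k ki|k kj].
  rewrite big1 // => l _; rewrite (cb_dual cb).
  by case: eqP => [kE|]; [case/eqP: ki; apply: val_inj | rewrite /= mulr0n mul0r scale0r].
rewrite (cb_dual cb).
by case: eqP => [kE|]; [case/eqP: kj; apply: val_inj | rewrite /= mulr0n mulr0 scale0r].
Qed.

Lemma model_brk_evr i r : brk (e i) (ev e r) = ev e (cbind r (g_tab i)).
Proof.
rewrite (ev_linear _ _ (brkr (e i))) ev_bind; apply: eq_ev => k.
exact: model_brk_basis.
Qed.
Lemma model_brk_evl k r : brk (ev e r) (e k) = ev e (cbind r (g_tab^~ k)).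
Proof.
rewrite (ev_linear _ _ (brkl (e k))) ev_bind; apply: eq_ev => i.
exact: model_brk_basis.
Qed.

Lemma model_homog_ind b (P : M -> Prop) : P 0 ->
  (forall a u v, P u -> P v -> P (a *: u + v)) ->
  (forall i, (i < 26)%N -> g_par i = b -> P (e i)) ->
  forall u, model_part b u = u -> P u.
Proof.
move=> P0 PD Pe u <-; apply: (supp_ind cb (Q := fun i => b == g_par i)) => //.
  by move=> i im /eqP/esym; exact: Pe.
by move=> i im /negbTE bi; rewrite /co im mxE inordK // bi.
Qed.

Lemma model_part_basis b i : (i < 26)%N ->
  model_part b (e i) = if b == g_par i then e i else 0.
Proof.
move=> im; apply/rowP => k; rewrite /e im.
rewrite [RHS](fun_if (fun w : 'rV[K]_26 => w 0 k)) !mxE eqxx /=.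
by have [->|] := eqVneq k (inord i); rewrite ?inordK //= !if_same.
Qed.

Lemma model_brk_part b c u v : model_part b u = u -> model_part c v = v ->
  model_part (b (+) c) (brk u v) = brk u v.
Proof.
move=> hu hv; move: u hu.
apply: (model_homog_ind (P := fun u => model_part _ (brk u v) = brk u v)).
- by rewrite (linear_map0 (brkl v)) (linear_map0 (model_part_linear _)).
- by move=> a u w hu hw; rewrite brkl model_part_linear hu hw.
move=> i im <-; move: v hv.
apply: (model_homog_ind (P := fun v => model_part _ (brk (e i) v) = brk (e i) v)).
- by rewrite (linear_map0 (brkr (e i))) (linear_map0 (model_part_linear _)).
- by move=> a u w hu hw; rewrite brkr model_part_linear hu hw.
move=> j jm <-; rewrite model_brk_basis (ev_linear _ _ (model_part_linear _)) /ev !big_seq.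
have [/(_ j jm)/allP ok _ _ _] := lie_checkP g_lie_check im.
by apply: eq_bigr => t /ok /andP[tm /eqP tp]; rewrite /= model_part_basis // tp eqxx.
Qed.

Lemma model_brk_skew b c u v : model_part b u = u -> model_part c v = v ->
  brk u v = - (-1) ^+ (b && c) *: brk v u.
Proof.
move=> hu hv; move: u hu; apply: (model_homog_ind (P := fun u => brk u v = _ *: brk v u)).
- by rewrite (linear_map0 (brkl v)) (linear_map0 (brkr v)) scaler0.
- by move=> a u w hu hw; rewrite brkl brkr hu hw scalerDr !scalerA [a * _]mulrC.
move=> i im <-; move: v hv.
apply: (model_homog_ind (P := fun v => brk (e i) v = _ *: brk v (e i))).
- by rewrite (linear_map0 (brkl _)) (linear_map0 (brkr _)) scaler0.
- by move=> a u w hu hw; rewrite brkl brkr hu hw scalerDr !scalerA [a * _]mulrC.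
move=> j jm <-; have [_ /(_ j jm)/(ceqP charK e) ok _ _] := lie_checkP g_lie_check im.
by rewrite !model_brk_basis ok ev_scale /= signrN.
Qed.

Lemma model_brk_jacobi b c u v w : model_part b u = u -> model_part c v = v ->
  brk u (brk v w) = brk (brk u v) w + (-1) ^+ (b && c) *: brk v (brk u w).
Proof.
move=> hu hv; move: u hu.
apply: (model_homog_ind (P := fun u => brk u (brk v w) = brk (brk u v) w + _ *: brk v (brk u w))).
- by rewrite !(linear_map0 (brkl _)) (linear_map0 (brkr v)) scaler0 addr0.
- move=> a u u' hu hu'; rewrite !brkl brkr hu hu' !scalerDr !scalerA.
  by rewrite [a * _]mulrC addrACA.
move=> i im <-; move: v hv.
apply: (model_homog_ind (P := fun v => brk (e i) (brk v w) =
  brk (brk (e i) v) w + _ *: brk v (brk (e i) w))).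
- by rewrite (linear_map0 (brkl w)) !(linear_map0 (brkr (e i))) !(linear_map0 (brkl _)) scaler0 addr0.
- move=> a u u' hu hu'; rewrite (brkl w) !(brkr (e i)) !brkl hu hu' !scalerDr !scalerA.
  by rewrite [a * _]mulrC addrACA.
move=> j jm <-.
apply: (linear_ext cb (f := fun w => brk (e i) (brk (e j) w))
  (g := fun w => brk (brk (e i) (e j)) w + _ *: brk (e j) (brk (e i) w))).
- by move=> a x y; rewrite !brkr.
- move=> a x y; rewrite !brkr !scalerDr !scalerA [_ * a]mulrC.
  exact: addrACA.
move=> k km; have [_ _ /(_ j k jm km)/(ceqP charK e) ok _] := lie_checkP g_lie_check im.
by rewrite !model_brk_basis !model_brk_evr model_brk_evl ok ev_cat ev_scale.
Qed.

Lemma model_brk_cube u : model_part true u = u -> brk u (brk u u) = 0.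
Proof.
have brkD x : {morph brk x : y z / y + z}.
  by move=> y z; have := brkr x 1 y z; rewrite !scale1r.
have brkDl x : {morph brk^~ x : y z / y + z}.
  by move=> y z; have := brkl x 1 y z; rewrite !scale1r.
have skew x y : model_part true x = x -> model_part true y = y -> brk y x = brk x y.
  by move=> hx hy; rewrite (model_brk_skew hy hx) /= expr1 opprK scale1r.
(* The Jacobi identity for the odd elements y, x, x; it lets [cube_additive] extend the cubic
   identity from the basis. *)
have cross x y : model_part true x = x -> model_part true y = y ->
    brk y (brk x x) + (brk x (brk x y) + brk x (brk x y)) = 0.
  move=> hx hy; rewrite (model_brk_jacobi _ hy hx) /= expr1 scaleN1r !(skew x y) //.
  rewrite (model_brk_skew (model_brk_part hx hy) hx) /= expr0 scaleN1r.
  by rewrite -opprD addNr.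
move=> hu; suff [] : model_part true u = u /\ brk u (brk u u) = 0 by [].
move: u hu; apply: (model_homog_ind (P := fun u => model_part true u = u /\ brk u (brk u u) = 0)).
- by rewrite (linear_map0 (model_part_linear _)) (linear_map0 (brkl _)).
- move=> a x y [hx xc] [hy yc].
  have brkZ z x' y' : brk z (a *: x') = a *: brk z x' /\ brk (a *: x') y' = a *: brk x' y'.
    have := brkr z a x' 0; have := brkl y' a x' 0.
    by rewrite !addr0 (linear_map0 (brkr z)) (linear_map0 (brkl y')) !addr0.
  have hax : model_part true (a *: x) = a *: x.
    by have := model_part_linear true a x 0; rewrite (linear_map0 (model_part_linear _)) !addr0 hx.
  split; first by rewrite model_part_linear hx hy.
  have zx := skew x x hx hx.
  rewrite (cube_additive (q := brk) (f := brk)) //;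
    [|exact: skew | exact: cross | exact: cross].
  rewrite yc addr0 (brkZ 0 x (brk (a *: x) (a *: x))).2 (brkZ 0 x (a *: x)).2.
  by rewrite (brkZ x x 0).1 !(brkZ x _ 0).1 xc !scaler0.
move=> i im ip; have [_ _ _ /(_ ip)/(ceqP charK e) ok] := lie_checkP g_lie_check im.
split; first by rewrite model_part_basis // ip.
by rewrite model_brk_basis model_brk_evr ok ev_nil.
Qed.

HB.instance Definition _ := Lmodule_isLieSuper.Build K M
  model_part_linear model_part_add model_part_part model_brk_linearl
  model_brk_linearr model_brk_part model_brk_skew model_brk_jacobi model_brk_cube.

Lemma model_basis : table_basis 26 g_tab g_par e co.
Proof.
split; [exact: cb | | exact: model_brk_basis].
move=> i; have [im | mi] := ltnP i 26; first by rewrite /homog [LHS]model_part_basis ?eqxx.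
by rewrite (basis_out cb mi) /homog part0.
Qed.

End Model.

(** * The largest graded ideal intersecting h trivially *)

Section Triangular.
Variables (K : fieldType) (n : nat) (A : 'M[K]_n) (R : realization A).
Variable p : 'I_n -> bool.
Local Notation G := (gtilde R p).
Local Notation gH u := (gword p (WH u) : G).
Local Notation relG := (gtilde_rel R p).
Implicit Types (s : bool) (u v : G) (k : nat).

Definition generator s (i : 'I_n) : G := if s then gword p (WY R i) else gword p (WX R i).
Local Notation gen := generator.

Lemma generator_homog s i : homog (p i) (gen s i).
Proof. by case: s; [exact: (cartan_pary relG) | exact: (cartan_parx relG)]. Qed.

Lemma brk_h_generator s (h : R) i : exists a : K, ⁅gH h, gen s i⁆ = a *: gen s i.
Proof.
by case: s; eexists; [exact: (cartan_hy relG) | exact: (cartan_hx relG)].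
Qed.

Lemma brk_generator_h s (h : R) i : exists a : K, ⁅gen s i, gH h⁆ = a *: gen s i.
Proof.
have [a E] := brk_h_generator s h i.
exists (- a); rewrite (brk_skew (generator_homog s i) (cartan_even relG h)) E.
by rewrite andbF expr0 scaleN1r scaleNr.
Qed.

Lemma brk_opposite_generators s i j : exists h : R, ⁅gen (~~ s) i, gen s j⁆ = gH h.
Proof.
have h0 : gH 0 = 0 by exact: (linear_map0 (cartan_linear relG)).
have E i' j' : exists h : R, ⁅gen false i', gen true j'⁆ = gH h.
  rewrite /gen (cartan_xy relG); case: eqP => _; last by exists 0.
  by eexists.
case: s => /=; first exact: E.
have [h hE] := E j i; rewrite (brk_skew (generator_homog true i) (generator_homog false j)) hE.
exists (- (-1) ^+ (p i && p j) *: h).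
by have := cartan_linear relG (- (-1) ^+ (p i && p j)) h 0; rewrite h0 !addr0.
Qed.

(* The components of height [k + 1] or [- (k + 1)] of the subalgebras generated
   by the x_i, resp. by the y_i. *)
Inductive nil_part s : nat -> G -> Prop :=
  | nil_part_gen i : nil_part s 0 (gen s i)
  | nil_part_lin k a u v : nil_part s k u -> nil_part s k v -> nil_part s k (a *: u + v)
  | nil_part_0 k : nil_part s k 0
  | nil_part_ad k i u : nil_part s k u -> nil_part s k.+1 ⁅gen s i, u⁆.

Lemma nil_partD s k u v : nil_part s k u -> nil_part s k v -> nil_part s k (u + v).
Proof. by move=> hu; rewrite -[u]scale1r; exact: nil_part_lin. Qed.

Lemma nil_partZ s k a u : nil_part s k u -> nil_part s k (a *: u).
Proof. by move=> hu; rewrite -[_ *: _]addr0; apply: nil_part_lin => //; exact: nil_part_0. Qed.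

Lemma nil_part_h s k (h : R) v : nil_part s k v -> nil_part s k ⁅gH h, v⁆.
Proof.
elim=> {k v} [i|k a u v _ IHu _ IHv|k|k i u hu IHu].
- by have [a ->] := brk_h_generator s h i; apply/nil_partZ/nil_part_gen.
- by rewrite brkDr brkZr; exact: nil_part_lin.
- by rewrite brk0r; exact: nil_part_0.
rewrite (brk_jacobi u (cartan_even relG h) (generator_homog s i)) expr0 scale1r.
have [a ->] := brk_h_generator s h i.
by apply: nil_partD; [rewrite brkZl; apply/nil_partZ|]; exact: nil_part_ad.
Qed.

(** By the Jacobi identity [y_i, [x_j, u]] is [[y_i, x_j], u] plus a sign times [x_j, [y_i, u]]: in
    the first term [y_i, x_j] is in h, which preserves every component, and the second falls under
    the induction hypothesis. The lowest level is sent to h, whence the case distinction. *)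
Lemma nil_part_lower s k i v : nil_part s k v ->
  if k is k'.+1 then nil_part s k' ⁅gen (~~ s) i, v⁆
  else exists h : R, ⁅gen (~~ s) i, v⁆ = gH h.
Proof.
have T := cartan_linear relG.
elim=> {k v} [j|[|k] a u v _ IHu _ IHv|[|k]|k j u hu IHu].
- exact: brk_opposite_generators.
- rewrite brkDr brkZr; case: IHu IHv => [h ->] [h' ->].
  by exists (a *: h + h'); rewrite T.
- by rewrite brkDr brkZr; exact: nil_part_lin.
- by rewrite brk0r; exists 0; rewrite (linear_map0 T).
- by rewrite brk0r; exact: nil_part_0.
rewrite (brk_jacobi u (generator_homog (~~ s) i) (generator_homog s j)).
have [h ->] := brk_opposite_generators s i j.
apply: nil_partD; first exact: nil_part_h.
apply: nil_partZ; case: k hu IHu => [|k] hu IHu; last exact: nil_part_ad.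
have [h' ->] := IHu; have [a ->] := brk_generator_h s h' j.
exact/nil_partZ/nil_part_gen.
Qed.

Definition height_part (d : int) (v : G) : Prop :=
  match d with
  | Posz 0 => exists h : R, v = gH h
  | Posz k.+1 => nil_part false k v
  | Negz k => nil_part true k v
  end.

Lemma height_part_lin d a u v :
  height_part d u -> height_part d v -> height_part d (a *: u + v).
Proof.
case: d => [[|k]|k] /=; try exact: nil_part_lin.
by move=> [h ->] [h' ->]; exists (a *: h + h'); rewrite (cartan_linear relG).
Qed.

Lemma height_part0 d : height_part d 0.
Proof.
case: d => [[|k]|k] /=; try exact: nil_part_0.
by exists 0; rewrite (linear_map0 (cartan_linear relG)).
Qed.

Lemma height_partD d u v : height_part d u -> height_part d v -> height_part d (u + v).
Proof. by move=> hu; rewrite -[u]scale1r; exact: height_part_lin. Qed.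

Lemma height_partZ d a u : height_part d u -> height_part d (a *: u).
Proof. by move=> hu; rewrite -[_ *: _]addr0; apply: height_part_lin => //; exact: height_part0. Qed.

Lemma height_part_gen s i d v : height_part d v ->
  height_part (d + (-1) ^+ s) ⁅gen s i, v⁆.
Proof.
case: s d => -[[|k]|k] hv.
- case: hv => h ->; have [a ->] := brk_generator_h true h i.
  exact/nil_partZ/nil_part_gen.
- have := nil_part_lower i hv; have -> : k.+1%:Z + (-1) ^+ true = k by rewrite expr1; lia.
  by case: k hv.
- have -> : Negz k + (-1) ^+ true = Negz k.+1 by rewrite expr1; lia.
  exact: nil_part_ad.
- case: hv => h ->; have [a ->] := brk_generator_h false h i.
  exact/nil_partZ/nil_part_gen.
- have -> : k.+1%:Z + (-1) ^+ false = k.+2%:Z by rewrite expr0; lia.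
  exact: nil_part_ad.
have := nil_part_lower i hv; case: k hv => [|k] hv //.
by have -> : Negz k.+1 + (-1) ^+ false = Negz k by rewrite expr0; lia.
Qed.

Lemma height_part_h (h : R) d v : height_part d v -> height_part d ⁅gH h, v⁆.
Proof.
case: d => [[|k]|k] /=; try exact: nil_part_h.
by case=> h' ->; exists 0; rewrite (cartan_hh relG) (linear_map0 (cartan_linear relG)).
Qed.

(** The Jacobi identity requires homogeneous elements, while members of [nil_part] may mix parities;
    therefore the induction is about [part b u]. *)
Lemma height_part_nil s k u d v : nil_part s k u -> height_part d v ->
  height_part (d + (-1) ^+ s * k.+1%:Z) ⁅u, v⁆.
Proof.
move=> hu hv; suff H b : height_part (d + (-1) ^+ s * k.+1%:Z) ⁅part b u, v⁆.
  by rewrite -(part_add u) brkDl; exact: height_partD.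
elim: hu d v hv b => {k u} [i|k a u u' _ IHu _ IHu'|k|k i u _ IHu] d v hv b.
- rewrite mulr1 -(generator_homog s i) part_part; case: eqP => _.
    by rewrite generator_homog; exact: height_part_gen.
  by rewrite brk0l; exact: height_part0.
- by rewrite partD partZ brkDl brkZl; apply: height_part_lin; [exact: IHu | exact: IHu'].
- by rewrite part0 brk0l; exact: height_part0.
(* With x the generator, [[x, u], v] is [x, [u, v]] minus a sign times [u, [x, v]]; the induction
   hypothesis for u applies to both v and [x, v]. *)
rewrite (part_brkl _ _ (generator_homog s i)); move: (p i (+) b) => {}b.
have := brk_jacobi v (generator_homog s i) (homog_part b u).
move/eqP; rewrite -subr_eq => /eqP <-; rewrite -scaleNr.
have -> : d + (-1) ^+ s * k.+2%:Z = d + (-1) ^+ s * k.+1%:Z + (-1) ^+ s.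
  by case: (s); rewrite ?expr0 ?expr1; lia.
apply: height_partD; first by apply: height_part_gen; exact: IHu.
apply: height_partZ; rewrite -addrA [_ * _ + _]addrC addrA; apply: IHu.
exact: height_part_gen.
Qed.

Lemma height_part_brk d e u v : height_part d u -> height_part e v ->
  height_part (d + e) ⁅u, v⁆.
Proof.
case: d => [[|k]|k] hu hv.
- by rewrite add0r; case: hu => h ->; exact: height_part_h.
- by rewrite addrC -[k.+1%:Z]mul1r -(expr0 (-1)); exact: height_part_nil hu hv.
by rewrite addrC NegzE -mulN1r -[-1](expr1 (-1)); exact: height_part_nil hu hv.
Qed.

Definition height (d : 'rV[int]_n) : int := \sum_i d 0 i.

Lemma heightD d e : height (d + e) = height d + height e.
Proof. by rewrite /height -big_split; apply: eq_bigr => i _; rewrite mxE. Qed.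

Lemma heightN d : height (- d) = - height d.
Proof. by rewrite /height -sumrN; apply: eq_bigr => i _; rewrite mxE. Qed.

Lemma height_delta i : height (delta_mx 0 i) = 1.
Proof.
rewrite /height (bigD1 i) //= mxE !eqxx big1 ?addr0 // => j ji.
by rewrite mxE (negbTE ji).
Qed.

(** In height 0 this says that nothing but h is left, which is where the descent for graded ideals
    ends. *)
Lemma gdegree_height d v : gdegree d v -> height_part (height d) v.
Proof.
elim=> {d v} [h|i|i|d a u v _ IHu _ IHv|d|d e u v _ IHu _ IHv].
- rewrite /height big1; first by exists h.
  by move=> i _; rewrite mxE.
- by rewrite height_delta; exact: (nil_part_gen false i).
- by rewrite heightN height_delta; exact: (nil_part_gen true i).
- exact: height_part_lin.
- exact: height_part0.
by rewrite heightD; exact: height_part_brk.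
Qed.

Lemma gdegreeD d u v : gdegree d u -> gdegree d v -> gdegree d (u + v).
Proof. by move=> hu hv; rewrite -[u]scale1r; exact: gdegree_lin. Qed.

Lemma gdegree_homog_part d b c v : homog c v -> gdegree d v -> gdegree d (part b v).
Proof.
move=> hv dv; rewrite -hv part_part; case: eqP => _; last exact: gdegree_0.
by rewrite hv.
Qed.

Lemma gdegree_part d b v : gdegree d v -> gdegree d (part b v).
Proof.
move=> dv; elim: dv b => {d v} [h|i|i|d a u v _ IHu _ IHv|d|d e u v _ IHu _ IHv] b.
- exact: gdegree_homog_part (cartan_even relG h) (gdegree_h _ h).
- exact: gdegree_homog_part (cartan_parx relG i) (gdegree_x _ _ i).
- exact: gdegree_homog_part (cartan_pary relG i) (gdegree_y _ _ i).
- by rewrite partD partZ; exact: gdegree_lin.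
- by rewrite part0; exact: gdegree_0.
rewrite -(part_add u) brkDl partD !(part_brkl _ _ (homog_part _ _)).
by apply: gdegreeD; exact: gdegree_brk.
Qed.

Inductive homog_span : G -> Prop :=
  | homog_span_deg d v : gdegree d v -> homog_span v
  | homog_span_add u v : homog_span u -> homog_span v -> homog_span (u + v).

(** Sums of elements having a degree are stable under all operations from which words are built, so
    induction on a representing word applies. For the parity projections this uses that the
    generators have a parity. *)
Lemma homog_spanP v : homog_span v.
Proof.
have gZ d a u : gdegree d u -> gdegree d (a *: u).
  by move=> hu; rewrite -[_ *: _]addr0; apply: gdegree_lin => //; exact: gdegree_0.
have hZ a u : homog_span u -> homog_span (a *: u).
  elim=> {u} [d u hu|u u' _ IHu _ IHu']; last by rewrite scalerDr; exact: homog_span_add.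
  exact: homog_span_deg (gZ _ a _ hu).
have hP b u : homog_span u -> homog_span (part b u).
  elim=> {u} [d u hu|u u' _ IHu _ IHu']; last by rewrite partD; exact: homog_span_add.
  exact: homog_span_deg (gdegree_part b hu).
have hB u u' : homog_span u -> homog_span u' -> homog_span ⁅u, u'⁆.
  elim=> {u} [d u hu|u1 u2 _ IH1 _ IH2] hu'; last first.
    by rewrite brkDl; apply: homog_span_add; [exact: IH1 | exact: IH2].
  elim: hu' => {u'} [e u' hu'|u1 u2 _ IH1 _ IH2]; last first.
    by rewrite brkDr; exact: homog_span_add.
  exact: homog_span_deg (gdegree_brk hu hu').
suff H w : homog_span (gword p w) by rewrite -[v]reprK; exact: H.
elim: w => [h|i|i| |w IHw|w IHw w' IHw'|a w IHw|b w IHw|w IHw w' IHw'].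
- exact: homog_span_deg (gdegree_h _ h).
- exact: homog_span_deg (gdegree_x _ _ i).
- exact: homog_span_deg (gdegree_y _ _ i).
- exact: homog_span_deg (gdegree_0 _ _ 0).
- have -> : gword p (WOpp w) = -1 *: (gword p w : G).
    by rewrite scaleN1r; apply: gev_inj => M; rewrite [RHS]gevN !gev_word.
  exact: hZ.
- have -> : gword p (WAdd w w') = (gword p w : G) + gword p w'.
    by apply: gev_inj => M; rewrite [RHS]gevD !gev_word.
  exact: homog_span_add.
- have -> : gword p (WScale a w) = a *: (gword p w : G).
    by apply: gev_inj => M; rewrite [RHS]gevZ !gev_word.
  exact: hZ.
- have -> : gword p (WPart b w) = part b (gword p w : G).
    by apply: gev_inj => M; rewrite [RHS]gev_part !gev_word.
  exact: hP.
have -> : gword p (WBrk w w') = ⁅gword p w : G, gword p w'⁆.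
  by apply: gev_inj => M; rewrite [RHS]gev_brk !gev_word.
exact: hB.
Qed.

Lemma homog_decomp v : exists2 s : seq G, v = \sum_(x <- s) x &
  forall x, x \in s -> exists d, gdegree d x.
Proof.
elim: (homog_spanP v) => {v} [d v hv|u v _ [s -> hs] _ [t -> ht]].
  by exists [:: v]; [rewrite big_seq1 | move=> x; rewrite inE => /eqP->; exists d].
by exists (s ++ t); [rewrite big_cat | move=> x; rewrite mem_cat => /orP[/hs|/ht]].
Qed.

End Triangular.

(** * The largest ideal as the kernel of evaluation in a model *)

Lemma coef_notin (I : eqType) (r : comb I) i : i \notin map snd r -> coef r i = None.
Proof.
elim: r => [|t r IHr] //=; rewrite inE negb_or eq_sym => /andP[/negbTE -> /IHr].
by [].
Qed.

Section Radical.
Variables (K : fieldType) (charK : 3%N \in [pchar K]).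
Variables (n : nat) (A : 'M[K]_n) (R : realization A) (p : 'I_n -> bool).
Variables (M : cartan_model R p) (m : nat) (tab : nat -> nat -> comb nat).
Variables (par : nat -> bool) (e : nat -> M) (co : nat -> M -> K^o).
Hypothesis tb : table_basis m tab par e co.
Variables (rdeg : nat -> 'rV[int]_n) (lift_basis : nat -> gtilde R p).
Local Notation G := (gtilde R p).

Definition in_degree (d : 'rV[int]_n) (u : M) := forall k, rdeg k != d -> co k u = 0.

Hypothesis cmh_inj : forall h, cmh M h = 0 -> h = 0.
Hypothesis cmh_deg : forall h, in_degree 0 (cmh M h).
Hypothesis cmx_deg : forall i, in_degree (delta_mx 0 i) (cmx M i).
Hypothesis cmy_deg : forall i, in_degree (- delta_mx 0 i) (cmy M i).
Hypothesis tab_deg : forall i j t, t \in tab i j -> rdeg t.2 = rdeg i + rdeg j.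
Hypothesis lift_deg : forall i, gdegree (rdeg i) (lift_basis i).
Hypothesis liftE : forall i, gev M (lift_basis i) = e i.
Hypothesis no_singular : forall (s : bool) d u, in_degree d u -> 0 < (-1) ^+ s * height d ->
  (forall j : 'I_n, ⁅if s then cmx M j else cmy M j, u⁆ = 0) -> u = 0.

Lemma gev_linear : linear (gev M).
Proof. by move=> a u v; rewrite [LHS]gevD [X in X + _]gevZ. Qed.

Lemma gdegree_in_degree d v : gdegree d v -> in_degree d (gev M v).
Proof.
elim=> {d v} [h|i|i|d a u v _ IHu _ IHv|d|d f u v _ IHu _ IHv] k.
- by rewrite gev_word; exact: cmh_deg.
- by rewrite gev_word; exact: cmx_deg.
- by rewrite gev_word; exact: cmy_deg.
- by move=> kd; rewrite gev_linear (cb_linear tb) IHu // IHv // scaler0 addr0.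
- by rewrite (linear_map0 gev_linear) (linear_map0 (cb_linear tb k)).
move=> kd; have [km | mk] := ltnP k m; last exact: (co_out tb).
rewrite [gev M _]gev_brk (brk_suml tb) (co_sum tb) big1 // => i _.
have [di | di] := eqVneq (rdeg i) d; last by rewrite IHu // mul0r.
rewrite (brk_sumr tb) (co_sum tb) big1 ?mulr0 // => j _.
have [fj | fj] := eqVneq (rdeg j) f; last by rewrite IHv // mul0r.
rewrite (tb_brk tb) (co_ev charK tb) // coef_notin ?mulr0 //.
by apply/mapP => -[t /tab_deg tE kt]; case/eqP: kd; rewrite kt tE di fj.
Qed.

Fact kernel0 : gev M 0 = 0. Proof. exact: linear_map0 gev_linear. Qed.
Fact kernelP a u v : gev M u = 0 -> gev M v = 0 -> gev M (a *: u + v) = 0.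
Proof. by move=> u0 v0; rewrite gev_linear u0 v0 scaler0 addr0. Qed.
Fact kernel_part b u : gev M u = 0 -> gev M (part b u) = 0.
Proof. by move=> u0; rewrite [LHS]gev_part u0 part0. Qed.
Fact kernel_brk u v : gev M v = 0 -> gev M ⁅u, v⁆ = 0.
Proof. by move=> v0; rewrite [LHS]gev_brk v0 brk0r. Qed.
Definition kernel : ideal G := Ideal kernel0 kernelP kernel_part kernel_brk.

(** Each homogeneous component v of u is corrected by the lift of its image. The corrected element
    lies in the kernel and keeps its degree, since only basis vectors of that degree occur in the
    image; the corrections add up to 0 because u itself has image 0. *)
Lemma kernel_graded : graded_ideal kernel.
Proof.
move=> u u0; have [s uE hs] := homog_decomp u.
pose fix_ v := v - \sum_(k < m) (co k (gev M v) : K) *: lift_basis k.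
exists (map fix_ s).
  rewrite big_map sumrB -uE exchange_big /= [X in _ - X]big1 ?subr0 // => k _.
  rewrite -scaler_suml -[X in X *: _](_ : co k (gev M u) = _).
    by rewrite u0 (linear_map0 (cb_linear tb k)) scale0r.
  rewrite uE; elim: s {uE hs} => [|v s IHs].
    by rewrite !big_nil (linear_map0 gev_linear) (linear_map0 (cb_linear tb k)).
  have := cb_linear tb k 1 (gev M v) (gev M (\sum_(x <- s) x)).
  by rewrite !big_cons -IHs -[v in gev M (v + _)]scale1r gev_linear !scale1r.
move=> _ /mapP[v /hs[d dv] ->]; split.
  rewrite /= /fix_ -scaleN1r addrC gev_linear (linear_map_sum gev_linear).
  rewrite {2}(cb_expand tb (gev M v)) scaleN1r addrC; apply/eqP; rewrite subr_eq0.
  by apply/eqP; apply: eq_bigr => k _; rewrite liftE.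
exists d; rewrite /fix_ -scaleN1r addrC; apply: gdegree_lin => //.
elim/big_rec: _ => [|k w _ hw]; first exact: gdegree_0.
have [kd | kd] := eqVneq (rdeg k) d; last first.
  by rewrite (gdegree_in_degree dv) // scale0r add0r.
by apply: gdegree_lin => //; rewrite -kd.
Qed.

Lemma kernel_trivial_on_h : trivial_on_h kernel.
Proof.
move=> h; rewrite /= gev_word /= => /cmh_inj ->.
exact: (linear_map0 (cartan_linear (gtilde_rel R p))).
Qed.

Lemma graded_ideal_in_kernel (I : ideal G) d v :
  trivial_on_h I -> gdegree d v -> I v -> gev M v = 0.
Proof.
move=> trivI; have [N] := ubnP `|height d|%N; elim: N d v => // N IHN d v dN dv Iv.
have [d0 | d0] := eqVneq (height d) 0.
  have := gdegree_height dv; rewrite d0 /= => -[h vE]; rewrite vE in Iv *.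
  by rewrite (trivI _ Iv) (linear_map0 gev_linear).
pose s := (height d < 0).
(* Brackets of v with the generators of opposite sign stay in the ideal and lie one step closer to
   height 0, so their images vanish by induction. *)
apply: (@no_singular s d _ (gdegree_in_degree dv)).
  by rewrite /s; case hd: (height d < 0) => /=; rewrite ?expr1 ?expr0; lia.
move=> j; transitivity (gev M ⁅generator R p (~~ s) j, v⁆).
  by rewrite [RHS]gev_brk; case: (s); rewrite /= gev_word.
have dj : gdegree (d + (if s then delta_mx 0 j else - delta_mx 0 j))
    ⁅generator R p (~~ s) j, v⁆.
  rewrite addrC; case: (s); apply: gdegree_brk => //; [exact: gdegree_x | exact: gdegree_y].
apply: (IHN _ _ _ dj); last exact: ideal_brk.
by rewrite heightD; move: dN d0; rewrite /s; case hd: (height d < 0) => /=;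
  rewrite ?heightN height_delta; lia.
Qed.

Theorem radicalE v : radical R p v <-> gev M v = 0.
Proof.
split=> [[s -> hs] | v0].
  elim: s hs => [|u s IHs] hs; first by rewrite big_nil (linear_map0 gev_linear).
  rewrite big_cons -[u]scale1r gev_linear IHs ?addr0; last first.
    by move=> x xs; apply: hs; rewrite inE xs orbT.
  have [I [grI trivI /grI[t -> ht]]] := hs u (mem_head _ _).
  rewrite scale1r; elim: t ht => [|w t IHt] ht; first by rewrite big_nil (linear_map0 gev_linear).
  rewrite big_cons -[w]scale1r gev_linear IHt ?addr0 ?scale1r; last first.
    by move=> x xt; apply: ht; rewrite inE xt orbT.
  have [Iw [d dw]] := ht w (mem_head _ _).
  exact: graded_ideal_in_kernel dw Iw.
exists [:: v]; first by rewrite big_seq1.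
move=> _ /[!inE] /eqP ->; exists kernel; split=> //.
  exact: kernel_graded.
exact: kernel_trivial_on_h.
Qed.

End Radical.

(** * The realization *)

Lemma ord3_seq (T : Type) (f : 'I_3 -> T) : [seq f i | i : 'I_3] = [:: f i1; f i2; f i3].
Proof.
rewrite /image_mem /= !enum_ordSl enum_ord0 /=.
by do 3?congr (_ :: _); congr f; apply: val_inj.
Qed.

Lemma ord3P (P : 'I_3 -> Prop) : P i1 -> P i2 -> P i3 -> forall i, P i.
Proof.
move=> P1 P2 P3 [[|[|[|//]]] lt_i3]; [have -> : Ordinal lt_i3 = i1 |
  have -> : Ordinal lt_i3 = i2 | have -> : Ordinal lt_i3 = i3] => //; exact: val_inj.
Qed.

Section Realization.
Variables (K : fieldType) (charK : 3%N \in [pchar K]) (R : realization (A23 K)).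
Local Notation alpha j u := (sroot R j u : K).

Lemma coroot_roots :
  [/\ forall j, alpha j (coroot R i1) = -1,
      forall j, alpha j (coroot R i2) = -1 &
      forall j, alpha j (coroot R i3) = if j == i3 then 0 else -1].
Proof.
split; apply: ord3P; rewrite sroot_coroot mxE //=; exact: two_char3.
Qed.

(** The functional alpha_1 - alpha_2 vanishes on all h_i, the first two columns of A being equal
    modulo 3. It cannot vanish on [d4], since otherwise alpha_1 = alpha_2; so [d4] can be scaled and
    shifted by Cartan elements to the normalized D. *)
Lemma realization_coord (d4 : R)
    (hd4 : <<d4 :: [seq coroot R i | i : 'I_3]>>%VS = fullv) :
  exists (d : R) (f : nat -> R -> K^o),
  [/\ coord_system 4 (nth 0 [:: coroot R i1; coroot R i3; coroot R i2; d]) f,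
      [/\ alpha i1 d = 1, alpha i2 d = -1 & alpha i3 d = 0] & f 3 d4 != 0].
Proof.
have [h1E h2E h3E] := coroot_roots.
pose D := sroot R i1 - sroot R i2.
have Dh : {subset [:: coroot R i1; coroot R i2; coroot R i3] <= lker D}.
  move=> h; rewrite !inE memv_ker => hE; apply/eqP; rewrite add_lfunE opp_lfunE.
  by case/or3P: hE => /eqP ->; apply/eqP; rewrite subr_eq0; apply/eqP;
    rewrite ?h1E ?h2E ?h3E.
have tau0 : D d4 != 0.
  apply/negP => D0; have : (fullv <= lker D)%VS.
    rewrite -hd4 ord3_seq; apply/span_subvP => v; rewrite inE => /orP[/eqP->|/Dh //].
    by rewrite memv_ker.
  move/subvP => Dk; have : D == 0.
    by apply/eqP/lfunP => u; apply/eqP; rewrite zero_lfunE -memv_ker Dk ?memvf.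
  rewrite subr_eq0 => /eqP s12; have := free_uniq (sroot_free R).
  by rewrite ord3_seq /= !inE s12 eqxx.
(* The required value of alpha_1 - alpha_2 is 1 - (-1) = 2 = -1. *)
pose s := - (D d4 : K)^-1.
pose q := alpha i2 (s *: d4); pose r := alpha i3 (s *: d4).
(* All simple roots are -1 on h_1, which cancels [r] in alpha_3; alpha_3 vanishes on h_3, so the
   coefficient of h_3 is free to bring alpha_2 from [q - r] to -1. *)
pose d := s *: d4 + (r *: coroot R i1 + (q + 1 - r) *: coroot R i3).
have dE j : alpha j d = alpha j (s *: d4) + (- r + (q + 1 - r) * alpha j (coroot R i3)).
  rewrite /d !linearD /= [in X in _ + (X + _)]linearZ [in X in _ + (_ + X)]linearZ /=.
  by rewrite h1E /GRing.scale /= mulrN1.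
have q1 : alpha i1 (s *: d4) = q - 1.
  have : D (s *: d4) = -1.
    by rewrite linearZ /= -[LHS]/(s * (D d4 : K)) /s mulNr mulVf.
  by rewrite add_lfunE opp_lfunE -/q => /eqP; rewrite subr_eq addrC => /eqP.
have d1 : alpha i1 d = 1.
  transitivity (- 2%:R : K); last by rewrite (two_char3 charK) opprK.
  by rewrite dE q1 h3E /=; ring.
have d2 : alpha i2 d = -1 by rewrite dE -/q h3E /=; ring.
have d3 : alpha i3 d = 0 by rewrite dE -/r h3E /=; ring.
pose X := [tuple coroot R i1; coroot R i3; coroot R i2; d].
have perm_X : perm_eq X [:: d; coroot R i1; coroot R i2; coroot R i3].
  by apply/permP => P /=; lia.
have freeX : free X.
  rewrite (perm_free perm_X) free_cons; apply/andP; split; last first.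
    by have := coroot_free R; rewrite ord3_seq.
  (* A combination of the h_i is killed by alpha_1 - alpha_2, whereas this functional takes the
     value 2 on [d]. *)
  apply/negP => dh; have /subvP/(_ d dh) :
    (<<[:: coroot R i1; coroot R i2; coroot R i3]>> <= lker D)%VS by exact/span_subvP.
  rewrite memv_ker add_lfunE opp_lfunE => /eqP E.
  have : (1 : K) + 1 = 0 by rewrite -[X in X + _]d1 -[1]opprK -d2.
  by rewrite -(natrD _ 1 1) (two_char3 charK) => /eqP; rewrite oppr_eq0 oner_eq0.
have d4X : d4 \in <<X>>%VS.
  have hX i : (i < 4)%N -> X`_i \in <<X>>%VS by move=> i4; rewrite memv_span ?mem_nth ?size_tuple.
  have s0 : s != 0 by rewrite oppr_eq0 invr_eq0.
  have -> : d4 = s^-1 *: (d - (r *: X`_0 + (q + 1 - r) *: X`_1)).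
    by rewrite addrK scalerA mulVf ?scale1r.
  by rewrite rpredZ // rpredB ?(hX 3) // rpredD ?rpredZ ?hX.
have spanX v : v \in <<X>>%VS.
  suff /subvP/(_ v (memvf v)) : (fullv <= <<X>>)%VS by [].
  rewrite -hd4 ord3_seq; apply/span_subvP => w; rewrite inE => /orP[/eqP-> //|].
  by rewrite !inE => /or3P[] /eqP ->; apply: memv_span; rewrite !inE eqxx ?orbT.
exists d, (fun i u => if insub i is Some k then coord X k u else 0).
split=> //; last first.
  have dX : coord X (@Ordinal 4 3 isT) d = 1.
    by rewrite -[d in coord _ _ d]/(X`_(@Ordinal 4 3 isT)) coord_free // eqxx.
  have hX i : i != 3 :> nat -> coord X (@Ordinal 4 3 isT) X`_i = 0.
    have [i4 i3 | i4 _] := ltnP i 4; last by rewrite nth_default ?linear0 ?size_tuple.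
    rewrite -[i in X`_i]/(val (Ordinal i4)) coord_free //.
    by case: eqP => // /(congr1 val) /= i3'; case/eqP: i3.
  (* Since [d] differs from [s *: d4] by a combination of h_1 and h_3, a zero last coordinate of
     [d4] would make that of [d] zero instead of 1. *)
  rewrite insubT /=; apply/eqP => d40; move/eqP: dX; rewrite eq_sym /d !linearD !linearZ /=.
  rewrite d40 (hX 0%N) // (hX 1%N) // ?mulr0 ?scaler0 !addr0.
  by rewrite oner_eq0.
split=> [i a u v|u|i j].
- by case: insubP => [k _ _|_]; rewrite ?linearP // scaler0 addr0.
- rewrite {1}(coord_span (spanX u)); apply: eq_bigr => i _.
  by rewrite valK.
case: insubP => [k -> kE|/negbTE ->]; last by rewrite andbF.
rewrite andbT; have [j4 | j4] := ltnP j 4.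
  by rewrite -[nth _ _ j]/(X`_(Ordinal j4)) coord_free // -kE -val_eqE /= eq_sym.
rewrite [nth _ _ j]nth_default // linear0; case: eqP => // ij.
by have := ltn_ord k; rewrite kE ij ltnNge j4.
Qed.
End Realization.

(** * The basis of g(2,3) *)

Lemma rootv0_morph (K : fieldType) (L L' : lieSuperType K) (f : L -> L') x1 x2 x3 k :
  f 0 = 0 -> (forall u v, f ⁅u, v⁆ = ⁅f u, f v⁆) ->
  f (rootv0 x1 x2 x3 k) = rootv0 (f x1) (f x2) (f x3) k.
Proof. by move=> f0 fB; do 12?[case: k => [|k] /=; first by rewrite ?fB]. Qed.

Definition ridx_of (i : nat) : ridx := nth (false, 1%N) ridxs i.

Definition rootv_check (tab : nat -> nat -> comb nat) : bool :=
  all (fun t => (tab t.1.1 t.1.2 == [:: (Some false, t.2)]) &&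
      (tab (t.1.1 + 11) (t.1.2 + 11) == [:: (Some false, t.2 + 11)])%N)
    [:: (0, 1, 3); (0, 2, 4); (1, 2, 5); (2, 3, 6); (3, 4, 7); (3, 5, 8); (3, 6, 9);
        (6, 6, 10)]%N.

Lemma rootv_basis (K : fieldType) (L : lieSuperType K) m tab par (e : nat -> L) co r :
  table_basis m tab par e co -> rootv_check tab -> r \in ridxs ->
  rootv (fun j : 'I_3 => e j) (fun j : 'I_3 => e (j + 11)%N) r = e (pos_ridx r).
Proof.
move=> tb /allP ok.
have H s k : (forall t, t \in [:: (0, 1, 3); (0, 2, 4); (1, 2, 5); (2, 3, 6); (3, 4, 7);
      (3, 5, 8); (3, 6, 9); (6, 6, 10)]%N ->
      ⁅e (t.1.1 + s)%N, e (t.1.2 + s)%N⁆ = e (t.2 + s)%N) -> (0 < k <= 11)%N ->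
    rootv0 (e (0 + s)%N) (e (1 + s)%N) (e (2 + s)%N) k = e (k.-1 + s)%N.
  move=> hs; have {hs}hs a b c : (a, b, c) \in _ -> _ := hs (a, b, c).
  have h4 := hs 0%N 1%N 3 isT; have h5 := hs 0%N 2 4 isT; have h6 := hs 1%N 2 5 isT.
  have h7 := hs 2 3 6 isT; have h8 := hs 3 4 7 isT; have h9 := hs 3 5 8 isT.
  have h10 := hs 3 6 9 isT; have h11 := hs 6 6 10 isT; rewrite /= in h4 h5 h6 h7 h8 h9 h10 h11.
  do 12?[case: k => [|k] //=]; first [by [] | by rewrite h4 | by rewrite h5 | by rewrite h6
    | by rewrite h4 h7 | by rewrite h4 h5 h8 | by rewrite h4 h6 h9
    | by rewrite h4 h7 h10 | by rewrite h4 h7 h11].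
case: r => b k; rewrite mem_cat /rootv /pos_ridx => rk.
have k11 : (0 < k <= 11)%N.
  by case/orP: rk => /mapP[k']; rewrite mem_iota => k'E [_ ->].
case: b {rk} => /=; last rewrite muln0 addn0.
  by rewrite muln1; apply: (H 11) => // t /ok /andP[_ /eqP tE]; rewrite (tb_brk tb) tE ev1.
have := H 0%N k _ k11; rewrite !addn0; apply => t /ok /andP[/eqP tE _].
by rewrite !addn0 (tb_brk tb) tE ev1.
Qed.

(** Nonzero degrees have multiplicity one, which reduces the search for singular vectors to single
    root vectors; for these the last condition exhibits a nonzero bracket with a generator of
    opposite sign. *)
Definition rdeg_check : bool :=
  [&& all (fun i => all (fun j => all (fun t => all (fun c =>
          rdeg t.2 c == rdeg i c + rdeg j c) (iota 0 3)) (g_tab i j)) (iota 0 26)) (iota 0 26),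
      all (fun i => all (fun k => all (fun c => rdeg i c == rdeg k c) (iota 0 3) ==>
          (i == k)) (iota 0 26)) (iota 0 22),
      all (fun i => let h := rdeg i 0 + rdeg i 1%N + rdeg i 2 in
          ((0 < h) == (i < 11)%N) && ((h < 0) == (11 <= i < 22)%N)) (iota 0 26) &
      all (fun i => has (fun j => has (fun l => coef (g_tab j i) l != None) (iota 0 26))
          (if (i < 11)%N then [:: 11; 12; 13]%N else [:: 0; 1; 2]%N)) (iota 0 22)].

Lemma rdeg_checked : rdeg_check. Proof. by vm_compute. Qed.

Definition rv (i : nat) : 'rV[int]_3 := \row_c rdeg i c.

Lemma rv_out i : (22 <= i)%N -> rv i = 0.
Proof.
move=> i22; apply/rowP => c; rewrite !mxE /rdeg ltnNge (leq_trans _ i22) //=.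
by rewrite [nth [::] _ _]nth_default ?nth_nil ?oppr0 //= leq_subRL // (leq_trans _ i22).
Qed.

Lemma height_rv i : height (rv i) = rdeg i 0 + rdeg i 1%N + rdeg i 2.
Proof. by rewrite /height !big_ord_recl big_ord0 !mxE addr0 addrA. Qed.

Lemma rv_brk i j t : t \in g_tab i j -> rv t.2 = rv i + rv j.
Proof.
have [ij | ij] := boolP ((i < 26)%N && (j < 26)%N); last by rewrite g_tab_out.
case/andP: ij => i26 j26 tij; apply/rowP => c; rewrite !mxE.
have /and4P[/allP/(_ i) + _ _ _] := rdeg_checked; rewrite mem_iota => /(_ i26)/allP/(_ j).
by rewrite mem_iota => /(_ j26)/allP/(_ t tij)/allP/(_ c); rewrite mem_iota ltn_ord => /(_ isT)/eqP.
Qed.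

Section ConcreteG.
Variables (K : fieldType) (charK : 3%N \in [pchar K]) (R : realization (A23 K)).
Variables (d : R) (f : nat -> R -> K^o).
Local Notation hb := (nth 0 [:: coroot R i1; coroot R i3; coroot R i2; d]).
Hypothesis cb : coord_system 4 hb f.
Local Notation alpha j u := (sroot R j u : K).
Hypotheses (d1 : alpha i1 d = 1) (d2 : alpha i2 d = -1) (d3 : alpha i3 d = 0).
Local Notation M := (model charK).
Local Notation e := (@model_e K charK).
Local Notation co := (@model_co K charK).
Let tb := model_basis charK.

Definition model_h (u : R) : M := \sum_(k < 4) (f k u : K) *: e (22 + k)%N.

Lemma model_h_linear : linear model_h.
Proof.
move=> a u v; rewrite /model_h scaler_sumr -big_split; apply: eq_bigr => k _ /=.
by rewrite (cb_linear cb) scalerDl scalerA.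
Qed.

Lemma model_h_basis k : model_h (hb k) = e (22 + k)%N.
Proof.
have [k4 | k4] := ltnP k 4; last first.
  by rewrite nth_default // (linear_map0 model_h_linear) (basis_out tb) // leq_add.
rewrite /model_h (bigD1 (Ordinal k4)) //= (cb_dual cb) eqxx k4 scale1r big1 ?addr0 // => j ji.
rewrite (cb_dual cb) ltn_ord andbT.
by case: eqP => [jE|]; [case/eqP: ji; apply: val_inj | rewrite scale0r].
Qed.

Lemma model_cartan : cartan_rel p23 model_h
  (fun j : 'I_3 => e j) (fun j : 'I_3 => e (j + 11)%N).
Proof.
have [h1E h2E h3E] := coroot_roots charK R.
have hx (c : bool) (j : 'I_3) u :
    ⁅model_h u, e (j + c * 11)%N⁆ = ((-1) ^+ c * alpha j u) *: e (j + c * 11)%N.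
  apply: (linear_ext cb (f := fun u => ⁅model_h u, e (j + c * 11)%N⁆)
    (g := fun u => ((-1) ^+ c * alpha j u) *: e (j + c * 11)%N)) => {u}.
  - by move=> a u v; rewrite model_h_linear brk_linearl.
  - move=> a u v; rewrite linearP /= scalerA -scalerDl; congr (_ *: _).
    by rewrite mulrDr /GRing.scale /= mulrCA.
  move=> k; rewrite model_h_basis (tb_brk tb).
  move: j; apply: ord3P; case: c; case: k => [|[|[|[|//]]]] _;
    rewrite /= ?h1E ?h2E ?h3E ?d1 ?d2 ?d3 /= ?ev_cons ev_nil /= ?addr0 ?expr0 ?expr1;
    by rewrite ?mulr0 ?scale0r ?mulN1r ?mul1r ?opprK.
split.
- exact: model_h_linear.
- move=> u; rewrite /homog (linear_map_sum (part_linear _)); apply: eq_bigr => k _.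
  congr (_ *: _); case: k => [[|[|[|[|//]]]] ?]; exact: (tb_homog tb).
- by apply: ord3P; exact: (tb_homog tb).
- by apply: ord3P; exact: (tb_homog tb).
- move=> u v; rewrite /model_h (linear_map_sum (brk_linearl _)) big1 // => k _.
  rewrite (linear_map_sum (brk_linearr _)) big1 ?scaler0 // => l _.
  rewrite (tb_brk tb); case: k l => [[|[|[|[|//]]]] ?] [[|[|[|[|//]]]] ?];
    by rewrite /= ev_nil scaler0.
- by move=> u j; have := hx false j u; rewrite mul0n addn0 expr0 mul1r.
- by move=> u j; have := hx true j u; rewrite mul1n expr1 mulN1r.
have h1 : model_h (coroot R i1) = e 22 := model_h_basis 0.
have h2 : model_h (coroot R i2) = e 24 := model_h_basis 2.
have h3 : model_h (coroot R i3) = e 23 := model_h_basis 1.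
by apply: ord3P; apply: ord3P; rewrite (tb_brk tb) /= ?h1 ?h2 ?h3 /= ?ev1 ?ev_nil.
Qed.

Definition model_cm : cartan_model R p23 := CartanModel model_cartan.

Definition lift_basis (i : nat) : gtilde R p23 :=
  if (i < 22)%N then rootv (fun j => gword p23 (WX R j)) (fun j => gword p23 (WY R j)) (ridx_of i)
  else gword p23 (WH (hb (i - 22))).

Lemma ridx_of_mem i : (i < 22)%N -> ridx_of i \in ridxs.
Proof. by move=> i22; rewrite mem_nth. Qed.

Lemma pos_ridx_of i : (i < 22)%N -> pos_ridx (ridx_of i) = i.
Proof.
move=> i22; have /allP/(_ i) : all (fun i => pos_ridx (ridx_of i) == i) (iota 0 22) by [].
by rewrite mem_iota => /(_ i22)/eqP.
Qed.

Lemma gev_lift i : gev model_cm (lift_basis i) = e i.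
Proof.
rewrite /lift_basis; case: ltnP => i22.
  rewrite -[in RHS](pos_ridx_of i22).
  rewrite -(rootv_basis tb (r := ridx_of i)) ?ridx_of_mem //.
  have f0 := linear_map0 (gev_linear model_cm); have fB := gev_brk model_cm.
  rewrite /rootv; case: ifP => _;
    by rewrite (rootv0_morph (f := gev model_cm)) // !gev_word.
by rewrite gev_word /= model_h_basis subnKC.
Qed.

Lemma gdegree_cast (v : gtilde R p23) c c' : gdegree c v -> c = c' -> gdegree c' v.
Proof. by move=> + <-. Qed.

Lemma lift_deg i : gdegree (rv i) (lift_basis i).
Proof.
rewrite /lift_basis; case: ltnP => i22; last by rewrite rv_out //; exact: gdegree_h.
have gx := gdegree_x R p23; have gy := gdegree_y R p23.
do 22?[case: i i22 => [|i] i22 /=; first by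
  apply: gdegree_cast; [do ?[exact: gx | exact: gy | apply: gdegree_brk] |
    apply/rowP; apply: ord3P; rewrite !mxE]].
by [].
Qed.

Lemma model_no_singular (s : bool) c (u : model_cm) :
  in_degree (M := model_cm) co rv c u -> 0 < (-1) ^+ s * height c ->
  (forall j : 'I_3, ⁅if s then cmx model_cm j else cmy model_cm j, u⁆ = 0) -> u = 0.
Proof.
move=> uc hc u0; apply: (co_eq tb) => k k26; rewrite (linear_map0 (cb_linear tb k)).
have [kc | kc] := eqVneq (rv k) c; last exact: uc.
have /and4P[_ /allP inj /allP ht /allP low] := rdeg_checked.
have := ht k; rewrite mem_iota => /(_ k26)/andP[/eqP pos_k /eqP neg_k].
rewrite -height_rv kc in pos_k neg_k.
have k22 : (k < 22)%N.
  rewrite ltnNge; apply/negP => k22; move: hc; rewrite -kc rv_out // /height big1 ?mulr0 //.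
  by move=> i _; rewrite mxE.
have sE : (if (k < 11)%N then [:: 11; 12; 13]%N else [:: 0; 1; 2]%N) =
          (if s then [:: 0; 1; 2]%N else [:: 11; 12; 13]%N).
  rewrite -pos_k; move: hc; case: (s); rewrite ?expr0 ?expr1 ?mul1r ?mulN1r => hc.
    by rewrite ifF //; lia.
  by rewrite hc.
have := low k; rewrite mem_iota sE => /(_ k22)/hasP[j js /hasP[l]].
rewrite mem_iota => l26 jkl.
(* Multiplicity one of the degree c: [e k] is the only basis vector that can occur in u. *)
have uE : u = (co k u : K) *: e k.
  rewrite {1}(cb_expand tb u) (bigD1 (Ordinal k26)) //= big1 ?addr0 // => i ik.
  rewrite uc ?scale0r // -kc; apply: contra ik => /eqP ik.
  have := inj k; rewrite mem_iota => /(_ k22)/allP/(_ i); rewrite mem_iota ltn_ord.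
  move=> /(_ isT)/implyP kiE; rewrite -val_eqE /= eq_sym kiE //.
  apply/allP => c'; rewrite mem_iota => c3.
  by have /rowP/(_ (Ordinal c3)) := ik; rewrite !mxE => ->.
have : ⁅e j, (co k u : K) *: e k⁆ = 0.
  rewrite -uE; have u0' := u0; move: js; case: (s) u0' => u0' ; rewrite !inE => /or3P[] /eqP ->;
  [exact: (u0' i1) | exact: (u0' i2) | exact: (u0' i3) |
   exact: (u0' i1) | exact: (u0' i2) | exact: (u0' i3)].
rewrite brkZr (tb_brk tb) => /(congr1 (co l)).
have := cb_linear tb l (co k u : K) (ev e (g_tab j k)) 0.
rewrite !(linear_map0 (cb_linear tb l)) !addr0 => -> /eqP.
rewrite (co_ev charK tb) // scaler_eq0; case: (coef _ _) jkl => [b|//] _ /=.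
by rewrite signr_eq0 orbF => /eqP.
Qed.

Lemma radical_gev v : radical R p23 v <-> gev model_cm v = 0.
Proof.
apply: (@radicalE K charK 3 (A23 K) R p23 model_cm 26 g_tab g_par e co tb rv lift_basis).
- move=> h h0; rewrite (cb_expand cb h) big1 // => k _.
  have := congr1 (co (22 + k)%N) h0; rewrite (linear_map0 (cb_linear tb _)) /= /model_h (co_sum tb).
  rewrite (bigD1 k) //= (cb_dual tb) eqxx (_ : (22 + k < 26)%N) ?ltn_add2l // mulr1.
  rewrite big1 ?addr0 => [->|l lk]; first by rewrite scale0r.
  by rewrite (cb_dual tb) eqn_add2l eq_sym val_eqE (negbTE lk) mulr0.
- move=> h k k0; rewrite /= /model_h (co_sum tb) big1 // => l _.
  rewrite (cb_dual tb); case: eqP => [kE|]; last by rewrite mulr0.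
  by rewrite kE rv_out ?leq_addr // eqxx in k0.
- move=> i k; rewrite (cb_dual tb); case: (k =P i) => // -> /eqP[].
  by move: i; apply: ord3P; apply/rowP; apply: ord3P; rewrite !mxE.
- move=> i k; rewrite (cb_dual tb); case: (k =P i + 11)%N => // -> /eqP[].
  by move: i; apply: ord3P; apply/rowP; apply: ord3P; rewrite !mxE.
- by move=> i j t; exact: rv_brk.
- exact: lift_deg.
- exact: gev_lift.
exact: model_no_singular.
Qed.

Definition gA_to_model (x : g23 R) : M := gev model_cm (qrepr x).
Local Notation phi := gA_to_model.

Lemma phi_pi v : phi (qpi (radical R p23) v) = gev model_cm v.
Proof.
apply/eqP; rewrite -subr_eq0; apply/eqP.
have /radical_gev := qrepr_pi (radical R p23) v.
by rewrite addrC -scaleN1r (gev_linear model_cm) scaleN1r addrC.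
Qed.

Lemma phi_linear : linear phi.
Proof.
move=> a; do 2!elim/qW => ?.
by rewrite -qpiZ -qpiD !phi_pi (gev_linear model_cm).
Qed.

Lemma phi_inj x y : phi x = phi y -> x = y.
Proof.
elim/qW: x => u; elim/qW: y => v; rewrite !phi_pi => uv; apply/qpiP/radical_gev.
by rewrite addrC -scaleN1r (gev_linear model_cm) uv scaleN1r addNr.
Qed.

Definition g_e (i : nat) : g23 R := qpi (radical R p23) (lift_basis i).
Definition g_co (i : nat) (x : g23 R) : K^o := co i (phi x).

Lemma phi_e i : phi (g_e i) = e i.
Proof. by rewrite phi_pi gev_lift. Qed.

(** The map to the model is injective and reaches every basis vector, so the table can be pulled
    back along it. *)
Lemma g_basis : table_basis 26 g_tab g_par g_e g_co.
Proof.
split.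
- split=> [i a u v|u|i j].
  + by rewrite /g_co phi_linear (cb_linear tb).
  + apply: phi_inj; rewrite (linear_map_sum phi_linear) {1}(cb_expand tb (phi u)).
    by apply: eq_bigr => i _; rewrite phi_e.
  by rewrite /g_co phi_e (cb_dual tb).
- move=> i; apply: phi_inj; rewrite phi_e [part _ _]qpartE phi_pi gev_part gev_lift.
  exact: (tb_homog tb).
move=> i j; apply: phi_inj; rewrite (ev_linear _ _ phi_linear).
rewrite [⁅_, _⁆]qbrkE phi_pi gev_brk !gev_lift (tb_brk tb).
by apply: eq_ev => k; rewrite /= phi_e.
Qed.

Lemma g_gx (i : 'I_3) : gx R p23 i = g_e i.
Proof. by move: i; apply: ord3P. Qed.

Lemma g_gy (i : 'I_3) : gy R p23 i = g_e (i + 11)%N.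
Proof. by move: i; apply: ord3P. Qed.

Lemma g_gh u : gh p23 u = \sum_(k < 4) (f k u : K) *: g_e (22 + k)%N.
Proof.
apply: phi_inj; rewrite phi_pi gev_word (linear_map_sum phi_linear).
by apply: eq_bigr => k _; rewrite phi_e.
Qed.


End ConcreteG.

(** * The basis of bj *)

(** The coefficient of e_t in [z, e_j], for z with coordinates z_i, i < 24; the unknown z_i is coded
    as (0, i) to fit the type of unknowns. *)
Definition center_row (j t : nat) : comb unknown :=
  [seq (coef (g_tab i j) t, (0%N, i)) | i <- iota 0 24].

(** D occurs in no bracket, and every other basis vector is a bracket up to sign: the derived
    algebra is the span of the first 25. Propagation then bounds its center. *)
Definition derived_check : bool :=
  [&& all (fun i => all (fun j => coef (g_tab i j) 25 == None) (iota 0 26)) (iota 0 26),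
      all (fun i => has (fun j => has (fun k =>
          if g_tab j k is [:: (Some _, l)] then l == i else false) (iota 0 26)) (iota 0 26))
        (iota 0 25),
      all (fun i => is_known (propagate 3 [seq center_row j t | j <- iota 0 24, t <- iota 0 26] [::])
          (0%N, i)) (iota 0 24) &
      all (fun i => all (fun j => (bj_tab i j ==
            [seq (t.1, if t.2 == 24 then 22 else t.2) | t <- g_tab i j]) &&
          all (fun t => t.2 < 25)%N (g_tab i j)) (iota 0 24)) (iota 0 24)].

Lemma derived_checked : derived_check. Proof. by vm_compute. Qed.

Lemma bj_tab_out i j : ~~ ((i < 24)%N && (j < 24)%N) -> bj_tab i j = [::].
Proof.
rewrite /bj_tab negb_and -!leqNgt => ij; have [iM|iM] := leqP 24 i.
  by rewrite [nth [::] bj_rows i]nth_default ?nth_nil.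
rewrite nth_default //; move: ij; rewrite leqNgt iM /=; apply: leq_trans.
have /allP/(_ i) : all (fun i => size (nth [::] bj_rows i) <= 24)%N (iota 0 24) by [].
by rewrite mem_iota; apply.
Qed.

Section DerivedModCenter.
Variables (K : fieldType) (charK : 3%N \in [pchar K]) (L : lieSuperType K).
Variables (e : nat -> L) (co : nat -> L -> K^o).
Hypothesis tb : table_basis 26 g_tab g_par e co.

Lemma derived_co u : derived_mem u -> co 25 u = 0.
Proof.
move=> [s ->]; elim: s => [|[a b] s IHs]; first by rewrite big_nil (linear_map0 (cb_linear tb _)).
rewrite big_cons -[⁅_, _⁆]scale1r (cb_linear tb) IHs addr0 scale1r /=.
rewrite (brk_suml tb) (co_sum tb) big1 // => i _; rewrite (brk_sumr tb) (co_sum tb).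
rewrite big1 ?mulr0 // => j _; rewrite (tb_brk tb) (co_ev charK tb) //.
have /and4P[/allP/(_ i) + _ _ _] := derived_checked; rewrite mem_iota ltn_ord.
by move=> /(_ isT)/allP/(_ j); rewrite mem_iota ltn_ord => /(_ isT)/eqP ->; rewrite mulr0.
Qed.

Lemma basis_derived i : (i < 25)%N -> derived_mem (e i).
Proof.
move=> i25; have /and4P[_ /allP/(_ i) + _ _] := derived_checked; rewrite mem_iota.
move=> /(_ i25)/hasP[j _ /hasP[k _]]; case E: (g_tab j k) => [|[[s|] l] [|? ?]] // /eqP lE.
have -> : e i = ⁅(-1) ^+ s *: e j, e k⁆.
  rewrite brkZl (tb_brk tb) E ev_cons ev_nil addr0 scalerA /= -signr_addb addbb scale1r.
  by rewrite lE.
exact: derived_brk.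
Qed.

(** Deciding membership makes the family total; D, number 25, is not in the derived algebra and
    yields 0. *)
Definition derived_e (i : nat) : derived L :=
  if pselect (derived_mem (e i)) is left h then dmk h else 0.

Lemma derived_eE i : i != 25 -> dval (derived_e i) = e i.
Proof.
move=> i25; rewrite /derived_e; case: pselect => // h.
have [li | il] := ltnP i 25; first by case: h; exact: basis_derived.
by rewrite (basis_out tb) // ltn_neqAle eq_sym i25.
Qed.

Local Notation pi := (qpi (center (derived L))).

(** Coordinates modulo h_1 - h_2: the coefficient of h_2 is added to that of h_1. *)
Definition center_co (i : nat) (u : L) : K^o := co i u + (i == 22)%:R * co 24 u.

Lemma center_co_linear i : linear (center_co i).
Proof.
move=> a u v; rewrite /center_co !(cb_linear tb) scalerDr addrACA; congr (_ + _).
by rewrite mulrDr /GRing.scale /= mulrCA.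
Qed.

Lemma sum_center_co (V : lmodType K) (F : nat -> V) u : F 24 = F 22 -> co 25 u = 0 ->
  \sum_(i < 26) (co i u : K) *: F i = \sum_(i < 24) (center_co i u : K) *: F i.
Proof.
move=> F24 u25; rewrite 2!big_ord_recr /= u25 scale0r addr0 F24.
rewrite [RHS](eq_bigr (fun i : 'I_24 => (co i u : K) *: F i +
    (((i : nat) == 22)%:R * co 24 u : K) *: F i)); last by move=> i _; rewrite scalerDl.
rewrite big_split /=; congr (_ + _); rewrite (bigD1 (@Ordinal 24 22 isT)) //= mul1r.
rewrite big1 ?addr0 // => i i22; case: eqP => [iE|]; last by rewrite mul0r scale0r.
by case/eqP: i22; apply: val_inj.
Qed.

Lemma brk_e24 v : ⁅e 24, v⁆ = ⁅e 22, v⁆.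
Proof.
rewrite !(brk_sumr tb _ v); apply: eq_bigr => k _; congr (_ *: _).
by rewrite !(tb_brk tb).
Qed.

Lemma pi_e24 : pi (derived_e 24) = pi (derived_e 22).
Proof.
apply/qpiP => v; apply: val_inj.
by rewrite /= !derived_eE // brkBl brk_e24 subrr.
Qed.

(** This makes the coordinates well defined on bj. As h_1 and h_2 act alike, the equations [z, e_j]
    = 0 involve z through its merged coordinates only, and propagation shows these to be 0. *)
Lemma center_co0 z i : center (derived L) z -> (i < 24)%N -> center_co i (dval z) = 0.
Proof.
move=> hz i24; have /and4P[_ _ /allP/(_ i) + _] := derived_checked.
rewrite mem_iota => /(_ i24); apply: (propagateP charK (x := fun u => center_co u.2 (dval z)))
  => [r|u]; last by rewrite /is_known !nth_nil.
move=> /allpairsP[[j t] [j24 t26 ->]]; rewrite mem_iota in j24; rewrite mem_iota in t26.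
have u25 := derived_co (asboolW (dvalP z)).
have : co t ⁅dval z, e j⁆ = 0.
  have /(congr1 (@dval _ _)) /= := hz (derived_e j).
  rewrite derived_eE => [->|]; first by rewrite (linear_map0 (cb_linear tb t)).
  by rewrite ltn_eqF // (leq_trans j24).
move=> c0; rewrite -[RHS]c0 (brk_suml tb).
rewrite (sum_center_co (F := fun i => ⁅e i, e j⁆)) ?brk_e24 // (co_sum tb) /ev /center_row big_map big_iota.
apply: eq_bigr => k _; rewrite (tb_brk tb) (co_ev charK tb) //.
exact: mulrC.
Qed.

Definition bj_e (i : nat) : quot (center (derived L)) :=
  if (i < 24)%N then pi (derived_e i) else 0.
Definition bj_co (i : nat) (x : quot (center (derived L))) : K^o :=
  if (i < 24)%N then center_co i (dval (qrepr x)) else 0.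

Lemma bj_co_pi i u : (i < 24)%N -> bj_co i (pi u) = center_co i (dval u).
Proof.
move=> i24; rewrite /bj_co i24; apply/eqP; rewrite -subr_eq0; apply/eqP.
rewrite -(center_co0 (qrepr_pi (center (derived L)) u) i24) /=.
by rewrite addrC -scaleN1r -center_co_linear scaleN1r addrC.
Qed.

Lemma pi_linear : linear pi.
Proof. by move=> a u v; rewrite qpiD qpiZ. Qed.

Lemma bj_e_pi i : (i < 24)%N -> bj_e i = pi (derived_e i).
Proof. by rewrite /bj_e => ->. Qed.

Lemma dval_linear : linear (@dval K L).
Proof. by []. Qed.

Lemma bj_basis : table_basis 24 bj_tab g_par bj_e bj_co.
Proof.
split.
- split=> [i a|u|i j].
  + have [i24 | i24] := boolP (i < 24)%N; last first.
      by move=> u v; rewrite /bj_co (negbTE i24) scaler0 addr0.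
    do 2!elim/qW => ?.
    by rewrite -pi_linear !bj_co_pi // dval_linear center_co_linear.
  + elim/qW: u => u; have u25 := derived_co (asboolW (dvalP u)).
    have {1}-> : u = \sum_(i < 26) (co i (dval u) : K) *: derived_e i.
      apply: val_inj; rewrite /= (linear_map_sum dval_linear) {1}(cb_expand tb (dval u)).
      apply: eq_bigr => i _; have [i25 | i25] := eqVneq (i : nat) 25.
        by rewrite i25 u25 !scale0r.
      by rewrite derived_eE.
    rewrite (linear_map_sum pi_linear) (sum_center_co (F := fun i => pi (derived_e i))) ?pi_e24 //.
    by apply: eq_bigr => i _; rewrite bj_co_pi // bj_e_pi.
  have [i24 | i24] := boolP (i < 24)%N; last by rewrite /bj_co (negbTE i24) andbF.
  have [j24 | j24] := boolP (j < 24)%N; last first.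
    rewrite /bj_e (negbTE j24) -(linear_map0 pi_linear) bj_co_pi // (linear_map0 (center_co_linear i)).
    by case: eqP => // ij; rewrite -ij i24 in j24.
  rewrite bj_e_pi // bj_co_pi // derived_eE; last by rewrite ltn_eqF // (leq_trans j24).
  rewrite /center_co !(cb_dual tb) (leq_trans i24) // [(24 == j)]gtn_eqF //=.
  by rewrite mulr0 addr0 andbT.
- move=> i; rewrite /bj_e; case: ifP => i24; last exact: part0.
  rewrite /homog [LHS]qpartE; congr qpi; apply: val_inj.
  rewrite /= derived_eE ?ltn_eqF ?(leq_trans i24) //; exact: (tb_homog tb).
move=> i j; have [/andP[i24 j24] | ij] := boolP ((i < 24)%N && (j < 24)%N); last first.
  rewrite bj_tab_out // ev_nil; move: ij; rewrite negb_and /bj_e.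
  by case/orP => /negbTE ->; rewrite ?brk0l ?brk0r.
have /and4P[_ _ _ /allP/(_ i)] := derived_checked; rewrite mem_iota => /(_ i24)/allP/(_ j).
rewrite mem_iota => /(_ j24)/andP[/eqP -> /allP t25].
rewrite (ev_map _ (fun k => if k == 24 then 22 else k)) !bj_e_pi // [LHS]qbrkE.
have -> : ⁅derived_e i, derived_e j⁆ = ev derived_e (g_tab i j).
  apply: val_inj; rewrite /= (ev_linear _ _ dval_linear).
  rewrite !derived_eE ?ltn_eqF ?(leq_trans i24) ?(leq_trans j24) // (tb_brk tb) /ev !big_seq.
  by apply: eq_bigr => t /t25 tE; rewrite /= derived_eE // ltn_eqF.
rewrite (ev_linear _ _ pi_linear) /ev !big_seq; apply: eq_bigr => t /t25 tE /=.
congr (_ *: _); case: eqP => [-> | /eqP t24]; first by rewrite pi_e24 bj_e_pi.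
by rewrite bj_e_pi // ltn_neqAle t24 -ltnS.
Qed.

End DerivedModCenter.

(** * Derivations and cocycles of bj *)

Definition theta_rows : seq (comb nat) := Eval vm_compute in mkseq theta 24.
Definition theta_inv_rows : seq (comb nat) := Eval vm_compute in mkseq theta_inv 24.

Definition theta_check : bool :=
  let th := nth [::] theta_rows in let thi := nth [::] theta_inv_rows in
  [&& all (fun i => [&& ceq (cbind (th i) thi) [:: (Some false, i)],
          ceq (cbind (thi i) th) [:: (Some false, i)],
          all (fun t => g_par t.2 == g_par i) (th i) &
          all (fun j => ceq (cbind (bj_tab i j) th) (tbrk bj_tab (th i) (th j)))
            (iota 0 24)]) (iota 0 24),
      all (fun k => all (fun i => ceq (nth [::] (nth [::] bj_ders (k + 2)) i)
          (cbind (cbind (thi i) (nth [::] (nth [::] bj_ders k))) th)) (iota 0 24)) (iota 0 2) &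
      all (fun k => all (fun i => all (fun j => form_nth (nth [::] bj_forms (k + 2)) (i, j) ==
          cdot [seq (f3mul s.1 t.1, (s.2, t.2)) | s <- th i, t <- th j]
            (form_nth (nth [::] bj_forms k))) (iota 0 24)) (iota 0 24)) (iota 0 2)].

Lemma theta_checked : theta_check. Proof. by vm_compute. Qed.

Lemma ridxs_checked : (map pos_ridx ridxs == iota 0 22) &&
  all (fun r => (ridx_odd r == g_par (pos_ridx r)) && (ridx_of (pos_ridx r) == r)) ridxs.
Proof. by vm_compute. Qed.

Lemma pos_ridx_eq r s : r \in ridxs -> s \in ridxs ->
  (pos_ridx r == pos_ridx s) = (r == s).
Proof.
have /andP[_ /allP ok] := ridxs_checked.
move=> /ok/andP[_ /eqP rE] /ok/andP[_ /eqP sE].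
by apply/eqP/eqP => [rs|-> //]; rewrite -rE rs sE.
Qed.

Lemma pos_ridx_lt r : r \in ridxs -> (pos_ridx r < 22)%N.
Proof.
have /andP[/eqP posE _] := ridxs_checked.
by move=> /(map_f pos_ridx); rewrite posE mem_iota.
Qed.

Definition in_ridxs (A : Type) (t : seq (A * ridx * ridx)) : bool :=
  all (fun e => (e.1.2 \in ridxs) && (e.2 \in ridxs)) t.

Section DualBasis.
Variables (K : fieldType) (V : lmodType K).

Lemma is_basis_dual (s : seq V) (F : nat -> V -> K^o) : (forall i, linear (F i)) ->
  (forall i j, (i < size s)%N -> (j < size s)%N -> F i s`_j = (i == j)%:R) ->
  (forall z, (forall i, (i < size s)%N -> F i z = 0) -> z = 0) -> is_basis s.
Proof.
move=> Fl Fs F0; split=> // z _.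
have F_sum i (c : 'I_(size s) -> K) : (i < size s)%N ->
    F i (\sum_(k < size s) c k *: s`_k) = \sum_(k < size s) c k * (i == k)%:R.
  by move=> si; rewrite (linear_map_sum (Fl i)); apply: eq_bigr => k _; rewrite Fs.
have delta_sum (c : 'I_(size s) -> K) (i : 'I_(size s)) :
    \sum_(k < size s) c k * ((i : nat) == k)%:R = c i.
  rewrite (bigD1 i) //= eqxx mulr1 big1 ?addr0 // => k ki.
  by rewrite val_eqE eq_sym (negbTE ki) mulr0.
have FB i u v : F i (u - v) = F i u - F i v.
  by have := Fl i (-1) v u; rewrite !scaleN1r ![- _ + _]addrC.
exists (\row_i F i z); split.
  apply: F0 => i si; rewrite FB (F_sum _ (fun k => (\row_j F j z) 0 k)) //.
  by rewrite (delta_sum _ (Ordinal si)) mxE subrr.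
move=> c /eqP; rewrite subr_eq0 => /eqP zE; apply/rowP => i.
by rewrite mxE zE (F_sum i (c 0)) // delta_sum.
Qed.

(** For the passage from D to the given D_4, whose coefficient of D is nonzero but arbitrary. *)
Lemma basis_mod_scale (Z B : V -> Prop) v a : a != 0 -> Z (a *: v) ->
  basis_mod Z B [:: v] -> basis_mod Z B [:: a *: v].
Proof.
move=> a0 Zav [_ vB]; split=> [w /[!inE] /eqP-> //|z /vB[c [Bc cu]]].
exists (a^-1 *: c); split.
  by move: Bc; rewrite !big_ord1 mxE scalerA mulrAC mulVf ?mul1r.
move=> c'; rewrite big_ord1 /= scalerA => Bc'.
have -> : c = a *: c'; last by rewrite scalerA mulVf ?scale1r.
apply: cu; rewrite big_ord1 mxE /=; by rewrite mulrC in Bc'.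
Qed.

End DualBasis.

(** * The automorphism theta, the derivations and the forms on bj *)

Section BjAlgebra.
Variables (K : fieldType) (charK : 3%N \in [pchar K]) (L : lieSuperType K).
Variables (e : nat -> L) (co : nat -> L -> K^o).
Hypothesis tb : table_basis 24 bj_tab g_par e co.
Local Notation x := (fun j : 'I_3 => e j).
Local Notation y := (fun j : 'I_3 => e (j + 11)%N).
Local Notation map_of d := (mapt 24 e co (nth [::] d)).
Local Notation form_of g := (formt 24 co (form_nth g)).

Lemma map_of_basis (d : seq (comb nat)) i : size d = 24 ->
  map_of d (e i) = ev e (nth [::] d i).
Proof. by move=> d24; apply: (mapt_basis tb) => j j24; rewrite nth_default ?d24. Qed.

Lemma map_of_ev (d : seq (comb nat)) r : size d = 24 ->
  map_of d (ev e r) = ev e (cbind r (nth [::] d)).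
Proof.
move=> d24; rewrite (ev_linear _ _ (mapt_linear tb _)) ev_bind; apply: eq_ev => i.
exact: map_of_basis.
Qed.

Definition bj_theta : L -> L := map_of theta_rows.
Definition bj_theta_inv : L -> L := map_of theta_inv_rows.

Lemma theta_basis i : bj_theta (e i) = ev e (nth [::] theta_rows i).
Proof. exact: map_of_basis. Qed.

Lemma theta_inv_basis i : bj_theta_inv (e i) = ev e (nth [::] theta_inv_rows i).
Proof. exact: map_of_basis. Qed.

Lemma theta_automorphism : automorphism bj_theta bj_theta_inv.
Proof.
have /and3P[/allP th_ok _ _] := theta_checked.
have lt24 i : (i < 24)%N -> i \in iota 0 24 by rewrite mem_iota.
have th_lin : linear bj_theta := mapt_linear tb (nth [::] theta_rows).
have thi_lin : linear bj_theta_inv := mapt_linear tb (nth [::] theta_inv_rows).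
split.
- exact: th_lin.
- move=> b u; apply: (homog_ind tb (P := fun u => homog b (bj_theta u))).
  + by rewrite /homog (linear_map0 th_lin) part0.
  + by move=> a v w hv hw; rewrite /homog th_lin partD partZ hv hw.
  move=> i /lt24/th_ok/and4P[_ _ /allP pd _] <-; rewrite theta_basis.
  rewrite /homog (ev_linear _ _ (part_linear _)) /ev !big_seq.
  by apply: eq_bigr => t /pd /eqP <-; rewrite /= (tb_homog tb).
- apply: (bilinear_ext tb) => [u a v w|v a u w|u a v w|v a u w|i j im jm].
  + by rewrite brk_linearr th_lin.
  + by rewrite brk_linearl th_lin.
  + by rewrite th_lin brk_linearr.
  + by rewrite th_lin brk_linearl.
  have /and4P[_ _ _ /allP/(_ j (lt24 _ jm)) ok] := th_ok i (lt24 _ im).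
  rewrite (tb_brk tb) !theta_basis (brk_ev tb) -(ceqP charK e ok).
  exact: map_of_ev.
- apply: (linear_ext tb (g := id)) => [a u v|//|i im] /=; first by rewrite th_lin thi_lin.
  have /and4P[ok _ _ _] := th_ok i (lt24 _ im).
  by rewrite theta_basis [bj_theta_inv _]map_of_ev // (ceqP charK e ok) ev1.
apply: (linear_ext tb (g := id)) => [a u v|//|i im] /=; first by rewrite thi_lin th_lin.
have /and4P[_ ok _ _] := th_ok i (lt24 _ im).
by rewrite theta_inv_basis [bj_theta _]map_of_ev // (ceqP charK e ok) ev1.
Qed.

Lemma rootv_xy r : r \in ridxs -> rootv x y r = e (pos_ridx r).
Proof. exact: (rootv_basis tb). Qed.

Lemma hv_xy : [/\ hv x y i1 = e 22, hv x y i2 = e 22 & hv x y i3 = e 23].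
Proof. by split; rewrite /hv (tb_brk tb) ev1. Qed.

Lemma bj_map_table (t : seq ('F_3 * ridx * ridx)) : in_ridxs t ->
  map_table x y [seq (f3 K a.1.1, a.1.2, a.2) | a <- f3_entries t]
    (map_of (map_rows (f3_entries t))).
Proof.
move=> /allP tr; have {}tr a : a \in f3_entries t -> (a.1.2 \in ridxs) && (a.2 \in ridxs).
  by move=> /mapP[b /tr + ->].
have size24 : size (map_rows (f3_entries t)) = 24 by rewrite size_mkseq.
have hE i : (22 <= i)%N -> (i < 24)%N -> map_of (map_rows (f3_entries t)) (e i) = 0.
  move=> i22 i24; rewrite map_of_basis // nth_mkseq // /ev big_map big_filter big1_seq //.
  by move=> a /andP[/eqP ai /tr/andP[/pos_ridx_lt + _]]; rewrite ai ltnNge i22.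
split; first exact: (mapt_linear tb).
  move=> r rr; have r22 := pos_ridx_lt rr.
  rewrite rootv_xy // map_of_basis // nth_mkseq ?(leq_trans r22) //.
  rewrite /ev big_map big_filter [RHS]big_map big_seq_cond [RHS]big_seq_cond /=.
  apply: eq_big => [a|a /andP[/tr/andP[_ a2] _]]; last by rewrite rootv_xy.
  by case: (boolP (a \in _)) => // /tr/andP[a1 _]; rewrite pos_ridx_eq.
have [h1 h2 h3] := hv_xy.
by apply: ord3P; rewrite ?h1 ?h2 ?h3 hE.
Qed.

Lemma form_nth_mkseq (F : nat -> nat -> F3) u :
  form_nth (mkseq (fun i => mkseq (F i) 24) 24) u =
    if (u.1 < 24)%N && (u.2 < 24)%N then F u.1 u.2 else None.
Proof.
rewrite /form_nth; case: ltnP => u1 /=; last first.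
  by rewrite [nth [::] _ _]nth_default ?nth_nil ?size_mkseq.
rewrite nth_mkseq //; case: ltnP => u2; first by rewrite nth_mkseq.
by rewrite nth_default ?size_mkseq.
Qed.

Lemma form_of_mkseq (F : nat -> nat -> F3) i j :
  form_of (mkseq (fun i => mkseq (F i) 24) 24) (e i) (e j) =
    if (i < 24)%N && (j < 24)%N then f3 K (F i j) else 0.
Proof.
rewrite (formt_basis tb) ?form_nth_mkseq /=; first by case: ifP.
by move=> u /negbTE uF; rewrite form_nth_mkseq uF.
Qed.

Lemma f3_foldr (A : Type) (F : A -> F3) (s : seq A) :
  f3 K (foldr (fun a => f3add (F a)) None s) = \sum_(a <- s) f3 K (F a).
Proof.
elim: s => [|a s IHs]; first by rewrite big_nil.
by rewrite big_cons /= f3D // IHs.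
Qed.

Lemma bj_form_table (t : seq ('F_3 * ridx * ridx)) : in_ridxs t ->
  form_table x y [seq (f3 K a.1.1, a.1.2, a.2) | a <- f3_entries t]
    (form_of (form_rows (f3_entries t))).
Proof.
move=> /allP tr; have {}tr a : a \in f3_entries t -> (a.1.2 \in ridxs) && (a.2 \in ridxs).
  by move=> /mapP[b /tr + ->].
have h0 i j : (22 <= i)%N || (22 <= j)%N ->
    form_of (form_rows (f3_entries t)) (e i) (e j) = 0.
  move=> ij; rewrite form_of_mkseq; case: ifP => // _; rewrite f3_foldr big1_seq //.
  move=> a /andP[_ /tr/andP[/pos_ridx_lt a1 /pos_ridx_lt a2]].
  have ltF b k : (b < 22)%N -> (22 <= k)%N -> (b == k) = false.
    by move=> b22 k22; rewrite ltn_eqF // (leq_trans b22).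
  by case/orP: ij => k22; rewrite !(ltF _ _ a1 k22) !(ltF _ _ a2 k22) ?andbF.
split; [|split; [|split]].
- exact: (formt_linearr tb).
- exact: (formt_linearl tb).
- move=> r s rr ss; have r22 := pos_ridx_lt rr; have s22 := pos_ridx_lt ss.
  have r24 := leq_trans r22 (isT : 22 <= 24)%N; have s24 := leq_trans s22 (isT : 22 <= 24)%N.
  rewrite !rootv_xy // form_of_mkseq r24 s24 /= f3_foldr.
  rewrite [RHS]big_map !big_seq; apply: eq_bigr => a /tr/andP[a1 a2] /=.
  have /andP[_ /allP ok] := ridxs_checked.
  have /andP[/eqP -> _] := ok r rr; have /andP[/eqP -> _] := ok s ss.
  rewrite f3D // !pos_ridx_eq // mulrBr ![_ == r]eq_sym ![_ == s]eq_sym; congr (_ + _).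
    by case: ifP; rewrite ?mulr1 ?mulr0.
  rewrite [(s == a.1.2) && _]andbC; case: ifP; last by rewrite mulr0 mulr0 oppr0.
  rewrite -/(f3mul (Some (~~ (g_par (pos_ridx r) && g_par (pos_ridx s)))) a.1.1).
  by rewrite f3M /= signrN mulr1 mulNr mulrC.
- move=> i v; have [h1 h2 h3] := hv_xy.
  suff H k : (22 <= k)%N -> form_of (form_rows (f3_entries t)) (e k) v = 0.
    by move: i; apply: ord3P; rewrite ?h1 ?h2 ?h3; exact: H.
  move=> k22; apply: (linear_ext tb (formt_linearr tb _ (e k)) (g := fun=> 0)) => [a u w|j _].
    by rewrite scaler0 addr0.
  by rewrite h0 // k22.
move=> i v; have [h1 h2 h3] := hv_xy.
suff H k : (22 <= k)%N -> form_of (form_rows (f3_entries t)) v (e k) = 0.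
  by move: i; apply: ord3P; rewrite ?h1 ?h2 ?h3; exact: H.
move=> k22; apply: (linear_ext tb (formt_linearl tb _ (e k)) (g := fun=> 0)) => [a u w|j _].
  by rewrite scaler0 addr0.
by rewrite h0 // k22 orbT.
Qed.

Lemma bj_is_basis : is_basis (rootvs x y ++ [:: hv x y i1; hv x y i3]).
Proof.
have -> : rootvs x y ++ [:: hv x y i1; hv x y i3] = [seq e k | k <- iota 0 24].
  have [-> _ ->] := hv_xy; have /andP[/eqP posE _] := ridxs_checked.
  rewrite /rootvs (_ : iota 0 24 = iota 0 22 ++ [:: 22; 23]%N) // map_cat -posE -map_comp.
  by congr (_ ++ _); apply/eq_in_map => r /rootv_xy.
apply: (is_basis_dual (F := co)).
- exact: (cb_linear tb).
- move=> i j; rewrite size_map size_iota => i24 j24.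
  by rewrite (nth_map 0%N) ?size_iota // nth_iota // (cb_dual tb) i24 andbT.
move=> z; rewrite size_map size_iota => z0; apply: (co_eq tb) => k k24.
by rewrite z0 // (linear_map0 (cb_linear tb k)).
Qed.

Lemma theta_x (i : 'I_3) : bj_theta (x i) = y i.
Proof. by move: i; apply: ord3P; rewrite theta_basis /= ev1. Qed.

Lemma theta_y (i : 'I_3) : bj_theta (y i) = (-1) ^+ p23 i *: x i.
Proof. by move: i; apply: ord3P; rewrite theta_basis /= ev_cons ev_nil addr0. Qed.

Definition bj_der k : L -> L := map_of (nth [::] bj_ders k).
Definition bj_form k : L -> L -> K^o := form_of (nth [::] bj_forms k).

(** The list of derivations stores the conjugates of numbers 0 and 1 at places 2 and 3. *)
Lemma bj_conj k : (k < 2)%N -> bj_theta \o bj_der k \o bj_theta_inv = bj_der (k + 2).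
Proof.
move=> k2; have size24 i : (i < 7)%N -> size (nth [::] bj_ders i) = 24.
  by do 7?[case: i => // i].
apply/funext; apply: (linear_ext tb) => [a u v|a u v|i i24]; rewrite /=.
- by rewrite /bj_theta_inv (mapt_linear tb) /bj_der (mapt_linear tb) [LHS](mapt_linear tb).
- by rewrite /bj_der (mapt_linear tb).
have k7 : (k < 7)%N by lia.
have k27 : (k + 2 < 7)%N by lia.
rewrite theta_inv_basis /bj_der map_of_ev ?size24 // [bj_theta _]map_of_ev //.
rewrite map_of_basis ?size24 //.
have /and3P[_ /allP/(_ k) + _] := theta_checked; rewrite mem_iota => /(_ k2)/allP/(_ i).
by rewrite mem_iota => /(_ i24)/(ceqP charK e) ->.
Qed.

Lemma form_of_ev g r s : (forall u, ~~ ((u.1 < 24)%N && (u.2 < 24)%N) -> form_nth g u = None) ->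
  form_of g (ev e r) (ev e s) =
    f3 K (cdot [seq (f3mul a.1 b.1, (a.2, b.2)) | a <- r, b <- s] (form_nth g)).
Proof.
move=> g0; rewrite -(ev_dot charK) /ev big_allpairs_dep.
rewrite [LHS](ev_linear _ _ (formt_linearl tb _ (ev e s))); apply: eq_bigr => a _ /=.
rewrite (ev_linear _ _ (formt_linearr tb _ (e a.2))) scaler_sumr; apply: eq_bigr => b _ /=.
by rewrite (formt_basis tb) // f3M scalerA.
Qed.

Lemma bj_forms_out k u : ~~ ((u.1 < 24)%N && (u.2 < 24)%N) ->
  form_nth (nth [::] bj_forms k) u = None.
Proof.
have ok : all (fun g => (size g == 24) && all (fun r => size r == 24) g) bj_forms by [].
have [k7 | k7] := ltnP k (size bj_forms); last first.
  by rewrite /form_nth [nth [::] bj_forms k]nth_default // !nth_nil.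
have /andP[/eqP sg /allP sr] := allP ok _ (mem_nth [::] k7).
rewrite /form_nth negb_and -!leqNgt; have [u1 | u1 _] := ltnP u.1 24; last first.
  by rewrite [nth [::] (nth _ _ _) _]nth_default ?sg // nth_nil.
move=> /= u2; rewrite nth_default // (eqP (sr _ _)) // mem_nth ?sg //.
Qed.

Lemma bj_pullback k : (k < 2)%N ->
  (fun u v => bj_form k (bj_theta u) (bj_theta v)) = bj_form (k + 2).
Proof.
move=> k2; apply/funext => u; apply/funext => v; rewrite /bj_form.
have th_lin : linear bj_theta by exact: (mapt_linear tb).
apply: (bilinear_ext tb (f := fun u v => form_of (nth [::] bj_forms k) (bj_theta u) (bj_theta v))
  (g := form_of (nth [::] bj_forms (k + 2)))).
- by move=> z a z1 z2; rewrite th_lin (formt_linearr tb).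
- by move=> z a z1 z2; rewrite th_lin (formt_linearl tb).
- exact: (formt_linearr tb).
- exact: (formt_linearl tb).
move=> i j i24 j24; rewrite !theta_basis form_of_ev; last exact: bj_forms_out.
rewrite (formt_basis tb); last exact: bj_forms_out.
have /and3P[_ _ /allP/(_ k)] := theta_checked; rewrite mem_iota => /(_ k2)/allP/(_ i).
by rewrite mem_iota => /(_ i24)/allP/(_ j); rewrite mem_iota => /(_ j24)/eqP ->.
Qed.

End BjAlgebra.

(** * Cohomology of bj *)

Section BjCohomology.
Variables (K : fieldType) (charK : 3%N \in [pchar K]) (L : lieSuperType K).
Variables (e : nat -> L) (co : nat -> L -> K^o).
Hypothesis tb : table_basis 24 bj_tab g_par e co.
Local Notation x := (fun j : 'I_3 => e j).
Local Notation y := (fun j : 'I_3 => e (j + 11)%N).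

Lemma bj_H1_iota : H1_basis (map (bj_der e co) (iota 0 7)).
Proof.
have nth_der i : (i < 7)%N -> (map (bj_der e co) (iota 0 7))`_i = bj_der e co i.
  by move=> i7; rewrite (nth_map 0%N) ?size_iota // nth_iota.
apply: (H1_basis_check charK tb (ds := map (nth [::]) bj_ders) _ _ _ bj_even_der_check
  bj_der_check) => // [i|i j] i7; rewrite nth_der //; first exact: (mapt_linear tb).
rewrite /bj_der (map_of_basis tb); last by do 7?[case: i i7 => // i i7].
by rewrite (nth_map [::]).
Qed.

Lemma bj_H2_iota : H2_basis (map (bj_form co) (iota 0 7)).
Proof.
have nth_form i : (i < 7)%N -> (map (bj_form co) (iota 0 7))`_i = bj_form co i.
  by move=> i7; rewrite (nth_map 0%N) ?size_iota // nth_iota.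
apply: (H2_basis_check charK tb (gs := map form_nth bj_forms) _ _ _ _ bj_forms_check
  bj_coc_check) => // [i u|i u|i j k] i7; rewrite nth_form //.
- exact: (formt_linearr tb).
- exact: (formt_linearl tb).
rewrite /bj_form (formt_basis tb); first by rewrite (nth_map [::]).
exact: bj_forms_out.
Qed.

Lemma bj_H1_basis : let th := bj_theta e co in let thi := bj_theta_inv e co in
  let D := bj_der e co in
  H1_basis [:: D 0; D 1; th \o D 0 \o thi; th \o D 1 \o thi; D 4; D 5; D 6]%N.
Proof.
have := (bj_conj charK tb (isT : 0 < 2)%N, bj_conj charK tb (isT : 1 < 2)%N).
by move: bj_H1_iota; move: (bj_der e co) => D /= H [-> ->].
Qed.

Lemma bj_H2_basis : let th := bj_theta e co in let c := bj_form co in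
  H2_basis [:: c 0; c 1; fun u v => c 0 (th u) (th v); fun u v => c 1 (th u) (th v);
               c 4; c 5; c 6]%N.
Proof.
have := (bj_pullback charK tb (isT : 0 < 2)%N, bj_pullback charK tb (isT : 1 < 2)%N).
by move: bj_H2_iota; move: (bj_form co) => c /= H [-> ->].
Qed.

Lemma bj_der_tables : [/\ map_table x y (D3_1 K) (bj_der e co 0),
  map_table x y (D3_2 K) (bj_der e co 1), map_table x y (D0_1 K) (bj_der e co 4),
  map_table x y (D0_2 K) (bj_der e co 5) & map_table x y (D0_3 K) (bj_der e co 6)].
Proof.
have H k t t' : t' = [seq (f3 K a.1.1, a.1.2, a.2) | a <- f3_entries t] ->
    nth [::] bj_ders k = map_rows (f3_entries t) -> in_ridxs t ->
    map_table x y t' (bj_der e co k).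
  by move=> -> kE; rewrite /bj_der kE; exact: bj_map_table.
split; [apply: (H 0%N (D3_1 'F_3)) | apply: (H 1%N (D3_2 'F_3)) | apply: (H 4 (D0_1 'F_3))
  | apply: (H 5 (D0_2 'F_3)) | apply: (H 6 (D0_3 'F_3))];
  first [by rewrite /= !(expr0, expr1) | by vm_compute].
Qed.

Lemma bj_form_tables : [/\ form_table x y (c3_1 K) (bj_form co 0),
  form_table x y (c3_2 K) (bj_form co 1), form_table x y (c0_1 K) (bj_form co 4),
  form_table x y (c0_2 K) (bj_form co 5) & form_table x y (c0_3 K) (bj_form co 6)].
Proof.
have H k t t' : t' = [seq (f3 K a.1.1, a.1.2, a.2) | a <- f3_entries t] ->
    nth [::] bj_forms k = form_rows (f3_entries t) -> in_ridxs t ->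
    form_table x y t' (bj_form co k).
  by move=> -> kE; rewrite /bj_form kE; exact: bj_form_table.
split; [apply: (H 0%N (c3_1 'F_3)) | apply: (H 1%N (c3_2 'F_3)) | apply: (H 4 (c0_1 'F_3))
  | apply: (H 5 (c0_2 'F_3)) | apply: (H 6 (c0_3 'F_3))];
  (* A coefficient 2 is read over ['F_3] as -1 and has to be turned back into 2 in K. *)
  first [by rewrite /= !(expr0, expr1) -(two_char3 charK) | by vm_compute].
Qed.

End BjCohomology.

(** * Cohomology of g(2,3) *)

Section GCohomology.
Variables (K : fieldType) (charK : 3%N \in [pchar K]) (L : lieSuperType K).
Variables (e : nat -> L) (co : nat -> L -> K^o).
Hypothesis tb : table_basis 26 g_tab g_par e co.
Local Notation x := (fun j : 'I_3 => e j).
Local Notation y := (fun j : 'I_3 => e (j + 11)%N).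

Lemma g_hv : [/\ hv x y i1 = e 22, hv x y i2 = e 24 & hv x y i3 = e 23].
Proof. by split; rewrite /hv (tb_brk tb) ev1. Qed.

Lemma g_outerE u : mapt 26 e co (nth [::] outer_rows) u = (co 25 u : K) *: (- e 22 + e 24).
Proof.
rewrite /mapt big_ord_recr /= big1 ?add0r => [|i _].
  by rewrite !ev_cons ev_nil /= expr1 expr0 scaleN1r scale1r addr0.
by case: i => i i25; rewrite nth_rcons size_nseq i25 nth_nseq i25 ev_nil scaler0.
Qed.

Lemma g_H1_basis : H1_basis [:: mapt 26 e co (nth [::] outer_rows)].
Proof.
apply: (H1_basis_check charK tb (ds := [:: nth [::] outer_rows]) _ _ _ _ g_der_check)
  => // [[|//] _|[|//] j _] /=; first exact: (mapt_linear tb).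
by apply: (mapt_basis tb) => i i26; rewrite nth_default.
Qed.

Lemma g_H2_dim : H2_dim L 0.
Proof. by exists [::] => //; apply: (H2_basis_check charK tb (gs := [::]) _ _ _ _ _ g_coc_check). Qed.

Lemma g_is_basis (D4 : L) : co 25 D4 != 0 ->
  is_basis (rootvs x y ++ [:: hv x y i1; hv x y i2; hv x y i3; D4]).
Proof.
(* The statement lists h_1, h_2, h_3 whereas the numbering is h_1, h_3, h_2; on the indices below 26
   this is the transposition of 23 and 24. *)
move=> a0; pose perm := nth 26 (iota 0 22 ++ [:: 22; 24; 23; 25])%N.
have permK i : (i < 26)%N -> (perm i < 26)%N && (perm (perm i) == i).
  move=> i26; have /allP/(_ i) : all (fun i => (perm i < 26)%N && (perm (perm i) == i)) (iota 0 26).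
    by [].
  by rewrite mem_iota; apply.
have perm25 i : (i < 25)%N -> perm i == 25 = false.
  move=> i25; have /allP/(_ i) : all (fun i => (perm i == 25) == false) (iota 0 25) by [].
  by rewrite mem_iota => /(_ i25)/eqP.
have -> : rootvs x y ++ [:: hv x y i1; hv x y i2; hv x y i3; D4] =
    rcons [seq e (perm k) | k <- iota 0 25] D4.
  have [-> -> ->] := g_hv; have /andP[/eqP posE _] := ridxs_checked.
  rewrite -cats1 (_ : iota 0 25 = iota 0 22 ++ [:: 22; 23; 24]%N) // map_cat -catA.
  congr (_ ++ _); transitivity [seq e (pos_ridx r) | r <- ridxs].
    by apply/eq_in_map => r; exact: (rootv_basis tb).
  rewrite (map_comp e) posE; apply/eq_in_map => k; rewrite mem_iota add0n => /= k22.
  by rewrite /perm nth_cat size_iota k22 nth_iota.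
(* The functionals dual to the new basis: the coefficient of [D4] is read off at D, and its
   contribution is subtracted from all other coordinates. *)
pose F i u : K^o := if i == 25 then co 25 u / co 25 D4
  else co (perm i) u - co (perm i) D4 / co 25 D4 * co 25 u.
apply: (is_basis_dual (F := F)).
- move=> i a u v; rewrite /F; case: ifP => _; rewrite !(cb_linear tb) /GRing.scale /=; ring.
- move=> i j; rewrite size_rcons size_map size_iota => i26 j26.
  have /andP[pi26 /eqP pK] := permK i i26.
  rewrite nth_rcons size_map size_iota; have [j25 | j25] := ltnP j 25.
    rewrite (nth_map 0%N) ?size_iota // nth_iota // add0n /F !(cb_dual tb) pi26 [25%N == perm j]eq_sym perm25 //.
    rewrite mulr0 subr0 mul0r andbT; case: eqP => [->|i25]; first by rewrite gtn_eqF.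
    congr (_%:R); congr nat_of_bool; apply/eqP/eqP => [E|-> //].
    by rewrite -pK E; have /andP[_ /eqP] := permK j j26.
  have -> : j = 25 by lia.
  rewrite eqxx /F; case: eqP => [_|_]; first by rewrite divff.
  by rewrite mulfVK // subrr.
move=> z; rewrite size_rcons size_map size_iota => z0.
have z25 : co 25 z = 0.
  have := z0 25 isT; rewrite /F eqxx => /eqP; rewrite mulf_eq0 invr_eq0 (negbTE a0) orbF.
  by move/eqP.
apply: (co_eq tb) => k k26; rewrite (linear_map0 (cb_linear tb k)).
have /andP[pk26 /eqP pK] := permK k k26.
have := z0 (perm k) pk26; rewrite /F pK z25 mulr0 subr0.
by case: eqP => [pk25|//]; rewrite -pK pk25 z25.
Qed.

End GCohomology.

Theorem lemma2p20 (K : closedFieldType) (charK : 3%N \in [pchar K])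
    (R : realization (A23 K)) (d4 : R)
    (hd4 : <<d4 :: [seq coroot R i | i : 'I_3]>>%VS = fullv) :
  let h := hv (@gx _ _ _ R p23) (@gy _ _ _ R p23) in
  let D4 : g23 R := gh p23 d4 in
  let x := @g1cx _ _ _ R p23 in
  let y := @g1cy _ _ _ R p23 in
  let der := map_table x y in
  let form := form_table x y in
  [/\ is_basis (rootvs (@gx _ _ _ R p23) (@gy _ _ _ R p23)
                ++ [:: h i1; h i2; h i3; D4]),
      exists2 D : g23 R -> g23 R,
        D D4 = - h i1 + h i2 /\ (forall u, derived_mem u -> D u = 0) &
        H1_basis [:: D] &
      H2_dim (g23 R) 0] /\
  [/\ is_basis (rootvs x y ++ [:: hv x y i1; hv x y i3]),
      exists theta theta' : bj R -> bj R,
      [/\ automorphism theta theta',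
          forall i, theta (x i) = y i,
          forall i, theta (y i) = (-1) ^+ p23 i *: x i,
          exists D31 D32 D01 D02 D03 : bj R -> bj R,
            [/\ der (D3_1 K) D31, der (D3_2 K) D32, der (D0_1 K) D01,
                der (D0_2 K) D02 & der (D0_3 K) D03] /\
            H1_basis [:: D31; D32; theta \o D31 \o theta';
                         theta \o D32 \o theta'; D01; D02; D03] &
          exists c31 c32 c01 c02 c03 : bj R -> bj R -> K^o,
            [/\ form (c3_1 K) c31, form (c3_2 K) c32, form (c0_1 K) c01,
                form (c0_2 K) c02 & form (c0_3 K) c03] /\
            H2_basis [:: c31; c32; fun u v => c31 (theta u) (theta v);
                         fun u v => c32 (theta u) (theta v); c01; c02; c03]] &
      H2_dim (bj R) 7].
Proof.
have [d [f [cb [d1 d2 d3] fd4]]] := realization_coord charK hd4.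
have tb := g_basis charK cb d1 d2 d3.
set e := g_e d in tb; set co := g_co charK cb d1 d2 d3 in tb.
move=> h D4 x y der form.
have gxE : gx R p23 = fun j : 'I_3 => e j.
  by apply/funext => j; exact: (g_gx d).
have gyE : gy R p23 = fun j : 'I_3 => e (j + 11)%N.
  by apply/funext => j; exact: (g_gy d).
have coD4 : co 25 D4 = f 3 d4.
  rewrite /D4 (g_gh charK cb d1 d2 d3) (co_sum tb) (bigD1 (@Ordinal 4 3 isT)) //=.
  rewrite (cb_dual tb) /= mulr1 big1 ?addr0 // => k k3; rewrite (cb_dual tb).
  case: eqP => [kE|]; last by rewrite mulr0.
  by case/eqP: k3; apply: val_inj; apply: (@addnI 22).
have D4_neq0 : co 25 D4 != 0 by rewrite coD4.
have bj_xE : x = fun j : 'I_3 => bj_e e j.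
  apply/funext => j; rewrite bj_e_pi; last by move: j; apply: ord3P.
  by congr qpi; apply: val_inj; rewrite /= (derived_eE tb) ?gxE //; move: j; apply: ord3P.
have bj_yE : y = fun j : 'I_3 => bj_e e (j + 11)%N.
  apply/funext => j; rewrite bj_e_pi; last by move: j; apply: ord3P.
  by congr qpi; apply: val_inj; rewrite /= (derived_eE tb) ?gyE //; move: j; apply: ord3P.
have tbj := bj_basis charK tb.
have [h1 h2 h3] := g_hv tb.
split; split.
- by rewrite /h gxE gyE; exact: (g_is_basis charK tb).
(* The tabulated derivation sends [D4] to [co 25 D4] times -h_1 + h_2, whence the factor. *)
- exists ((co 25 D4 : K)^-1 *: mapt 26 e co (nth [::] outer_rows)).
    split=> [|u /(derived_co charK tb) u25].
      rewrite /h gxE gyE h1 h2 -[LHS]/(_ *: mapt _ _ _ _ _) g_outerE scalerA.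
      by rewrite mulVf ?scale1r.
    by rewrite -[LHS]/(_ *: mapt _ _ _ _ _) g_outerE u25 scale0r scaler0.
  have [D0_der _] := g_H1_basis charK tb.
  apply: basis_mod_scale (g_H1_basis charK tb); first by rewrite invr_eq0.
  rewrite -[_ *: _]addr0; apply: derivation_lin; first exact/D0_der/mem_head.
  exact: hderivation_derivation (hderivation0 _ false).
- exact: (g_H2_dim charK tb).
- by rewrite bj_xE bj_yE; exact: (bj_is_basis tbj).
- rewrite /der /form bj_xE bj_yE.
  exists (bj_theta (bj_e e) (bj_co co)), (bj_theta_inv (bj_e e) (bj_co co)).
  split; [exact: (theta_automorphism charK tbj) | exact: (theta_x tbj) | exact: (theta_y tbj) | | ].
    have [t1 t2 t3 t4 t5] := bj_der_tables tbj.
    do 5!eexists; split; first by split; [exact: t1 | exact: t2 | exact: t3 | exact: t4 | exact: t5].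
    exact: (bj_H1_basis charK tbj).
  have [t1 t2 t3 t4 t5] := bj_form_tables charK tbj.
  do 5!eexists; split; first by split; [exact: t1 | exact: t2 | exact: t3 | exact: t4 | exact: t5].
  exact: (bj_H2_basis charK tbj).
by exists (map (bj_form (bj_co co)) (iota 0 7)); [| exact: (bj_H2_iota charK tbj)].
Qed.
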